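(* Consider the $K$-tier network model described in the context, with noise power $W\ge 0$ and target SINR $\beta>0$, and let $\mathcal O_k=\mathbb P\{\mathrm{SINR}_k<\beta\}$ be the outage probability of a typical user associated with tier $k$. Let $\sigma_k=\beta W/P_k$, $\tau_{j,k}=\beta/(M_{j,k}B_{j,k})$, $$\varphi_{j,k}(0)=\frac{\delta_j\tau_{j,k}\,{}_2F_1(1,1-\delta_j;2-\delta_j;-\tau_{j,k})}{1-\delta_j},\qquad \varphi_{j,k}(n)=\frac{\delta_j\tau_{j,k}^n\,{}_2F_1(n+1,n-\delta_j;n+1-\delta_j;-\tau_{j,k})}{n-\delta_j}\ (n\ge1),$$ and for $x>0$ let $g_{k,n}(x)=\sum_{j=1}^K\mathcal A_j\lambda_j\Omega_{j,k}^{\delta_j}\varphi_{j,k}(n)\,x^{\delta_{j,k}}$. Let $\mathbf Q_{M_k}(x)$ be the $M_k\times M_k$ lower triangular Toeplitz matrix with zero diagonal whose $(p,q)$ entry is $g_{k,p-q}(x)$ for $p>q$ (and $0$ for $p\le q$), and write $\mathbf Q^i_{M_k}(x)(p,q)$ for the $(p,q)$ entry of its $i$-th power. Then $$\mathcal O_k=1-\frac{\lambda_k}{\mathcal T_k}\sum_{i=0}^{M_k-1}\sum_{m=0}^{M_k-1}\sum_{n=0}^{m}\int_0^{R_k^2}\frac{\pi^{i+1}\sigma_k^{m-n}}{(m-n)!\,i!}x^{\frac{\alpha_k}{2}(m-n)}\exp\Big(-\sigma_kx^{\alpha_k/2}-\pi g_{k,0}(x)-\pi\sum_{j=1}^K\lambda_j\Omega_{j,k}^{\delta_j}x^{\delta_{j,k}}\Big)\mathbf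 Q^i_{M_k}(x)(n+1,1)\,dx.$$ Moreover, if $\alpha_j=\alpha$ for all $j$ (so $\delta_j=\delta$), let $\Lambda=\sum_j\lambda_j\Omega_j^\delta$, $\theta_{k,n}=\sum_{j=1}^K\mathcal A_j\lambda_j\Omega_{j,k}^{\delta}\varphi_{j,k}(n)$, $\mathbf\Theta_{M_k}$ the $M_k\times M_k$ lower triangular Toeplitz matrix with zero diagonal and $(p,q)$ entry $\theta_{k,p-q}$ for $p>q$, $\mathcal Z_k=\theta_{k,0}+\Lambda/\Omega_k^{\delta}$, and $\mathcal Q_k(i,m,n)=\int_0^{R_k^2}x^{i+\frac{\alpha}{2}(m-n)}e^{-\sigma_kx^{\alpha/2}-\pi\mathcal Z_kx}dx$. Then $$\mathcal O_k=1-\frac{\lambda_k}{\mathcal T_k}\sum_{i=0}^{M_k-1}\sum_{m=0}^{M_k-1}\sum_{n=0}^{m}\frac{\pi^{i+1}\sigma_k^{m-n}\mathcal Q_k(i,m,n)}{i!\,(m-n)!}\mathbf\Theta^i_{M_k}(n+1,1).$$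
   Context: Network model: $\mathcal K=\{1,\dots,K\}$. In $\mathbb R^2$, tier-$k$ base stations (BSs) form a homogeneous PPP of intensity $\lambda_k>0$ and users a homogeneous PPP of intensity $\lambda_u>0$, all independent. Tier-$k$ BSs have transmit power $P_k>0$, $M_k\in\mathbb N$ antennas, biasing factor $B_k>0$, and path-loss exponent $\alpha_k>2$. Notation: $\Omega_k=P_kM_kB_k$, $\delta_k=2/\alpha_k$, and $\mathcal V_{j,k}=\mathcal V_j/\mathcal V_k$ for $\mathcal V\in\{P,M,B,\Omega,\delta\}$. An access threshold $\epsilon>0$ is fixed and $R_k=(\Omega_k/\epsilon)^{1/\alpha_k}$. Association: for a user at the origin with $D_k$ the distance to the nearest tier-$k$ BS, set $\hat\rho_k=\Omega_kD_k^{-\alpha_k}$ if $D_k\le R_k$, else $0$; the user is associated with (the nearest BS of) tier $k$ iff $\hat\rho_k>\hat\rho_j$ for all $j\neq k$, and $\mathcal T_k$ is the probability of this event (it equals $\pi\lambda_k\int_0^{R_k^2}\exp(-\pi\sum_{j}\lambda_j\Omega_{j,k}^{\delta_j}r^{\delta_{j,k}})dr$). Activation: the activation probability of tier $j$ is $\mathcal A_j=1-\exp\big(-\pi\lambda_u\int_0^{R_j^2}\exp(-\pi\sum_{l=1}^K\lambda_l\Omega_{l,j}^{\delta_l}r^{\delta_{l,j}})dr\big)$, and active tier-$j$ BSs are modeled as a homogeneous PPP of intensity $\mathcal A_j\lambda_j$. SINR model: conditional on association with tier $k$, the distance $X_k$ to the serving BS has density $f_{X_k}(x)=\frac{2\pi\lambda_k}{\mathcal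 T_k}x\exp(-\pi\sum_j\lambda_j\Omega_{j,k}^{\delta_j}x^{2\delta_{j,k}})$ for $0<x\le R_k$ (and $0$ otherwise). Given $X_k$, the interfering BSs of tier $j$ are the points of independent homogeneous PPPs $\Phi_j^o$ of intensity $\mathcal A_j\lambda_j$ lying outside the disk centred at the user of radius $r_{j,k}=\Omega_{j,k}^{1/\alpha_j}X_k^{\alpha_k/\alpha_j}$. The serving BS uses maximum ratio transmission, so the signal gain $\|\mathbf h\|^2\sim\mathrm{Gamma}(M_k,1)$; an interferer of tier $j$ at distance $r$ contributes $P_jVr^{-\alpha_j}$ with $V\sim\mathrm{Exp}(1)$; all fading variables are independent of each other and of the point processes. $I_o$ is the total interference and $\mathrm{SINR}_k=P_k\|\mathbf h\|^2X_k^{-\alpha_k}/(I_o+W)$. ${}_2F_1$ is the Gauss hypergeometric function. *)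

(* Defs.v *)
From HB Require Import structures.
From mathcomp Require Import all_boot all_order all_algebra.
From mathcomp Require Import all_classical all_reals all_analysis.
Set Implicit Arguments.
Unset Strict Implicit.
Unset Printing Implicit Defensive.
Import Order.TTheory GRing.Theory Num.Theory.
Local Open Scope classical_set_scope.
Local Open Scope ring_scope.

Section special.
Context {R : realType}.
Local Notation mu := (@lebesgue_measure R).

Definition Gammaf (s : R) : R :=
  Rintegral mu `]0, +oo[%classic (fun t => t `^ (s - 1) * expR (- t)).

(* Gauss hypergeometric function 2F1(a,b;c;z), given (for c > b > 0 and
   real z < 1) by Euler's integral representation, i.e. the analytic
   continuation of the hypergeometric series to (-oo,1). *)
Definition hyp2F1 (a b c z : R) : R :=
  Gammaf c / (Gammaf b * Gammaf (c - b)) *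
  Rintegral mu `]0, 1[%classic
    (fun t => t `^ (b - 1) * (1 - t) `^ (c - b - 1) * (1 - z * t) `^ (- a)).

Definition gamma_pdf (M : nat) (x : R) : R :=
  if 0 < x then x ^+ M.-1 * expR (- x) / (M.-1)`!%:R else 0.

Definition poisson_mass (m : R) (n : nat) : R :=
  expR (- m) * m ^+ n / n`!%:R.

(* (p,q) entry of a square matrix, indices counted from 0 *)
Definition mxentry n (A : 'M[R]_n) (p q : nat) : R :=
  match insub p, insub q with
  | Some p', Some q' => A p' q'
  | _, _ => 0
  end.

Definition norm2 (y : R * R) : R := Num.sqrt (y.1 ^+ 2 + y.2 ^+ 2).

Definition area (A : set (R * R)) : \bar R := (mu \x mu)%E A.
End special.

Section proba.
Context {R : realType} {d : measure_display} {Omega : measurableType d}.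
Variable P : probability Omega R.

Definition sigma_gen {d' : measure_display} {T : measurableType d'} {I : Type}
  (Z : I -> Omega -> T) : set (set Omega) :=
  <<s [set E | exists i B, measurable B /\ E = Z i @^-1` B] >>.

Definition mutually_independent {I : eqType} (F : I -> set (set Omega)) :=
  forall (s : seq I) (E : I -> set Omega), uniq s ->
    (forall i, i \in s -> F i (E i)) ->
    P (\bigcap_(i in [set` s]) E i) = (\prod_(i <- s) P (E i))%E.

Definition has_density (X : Omega -> R) (f : R -> R) :=
  forall B : set R, measurable B ->
    P (X @^-1` B) = (\int[@lebesgue_measure R]_(x in B) (f x)%:E)%E.

Definition pcount (Y : nat -> Omega -> R * R) (A : set (R * R)) (w : Omega)
  : \bar R := (\sum_(n <oo) (\1_A (Y n w))%:E)%E.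

(* Y (an enumeration of the points) is a homogeneous Poisson point process
   on R^2 of intensity lam: counts in disjoint Borel sets of finite area
   are independent Poisson variables with mean lam * area. *)
Definition is_hPPP (Y : nat -> Omega -> R * R) (lam : R) :=
  forall (m : nat) (A : 'I_m -> set (R * R)) (c : 'I_m -> nat),
    (forall i, measurable (A i)) ->
    (forall i, (area (A i) < +oo)%E) ->
    (forall i j, i != j -> A i `&` A j = set0) ->
    P (\bigcap_i [set w | pcount Y (A i) w = (c i)%:R%:E]) =
      (\prod_(i < m) poisson_mass (lam * fine (area (A i))) (c i))%:E.
End proba.

Section network.
Context {R : realType} {K : nat}.
Variables (lam Pw Bb al : 'I_K -> R) (Mn : 'I_K -> nat) (eps lamu : R).
Local Notation mu := (@lebesgue_measure R).

Definition Omg j : R := Pw j * (Mn j)%:R * Bb j.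
Definition dlt j : R := 2 / al j.
Definition assoc_exp (k : 'I_K) (x : R) : R :=
  \sum_(l < K) lam l * (Omg l / Omg k) `^ dlt l * x `^ (dlt l / dlt k).
Definition Rk k : R := (Omg k / eps) `^ (al k)^-1.
Definition Tk k : R :=
  pi * lam k * Rintegral mu `[0, Rk k ^+ 2]%classic
                 (fun r => expR (- (pi * assoc_exp k r))).
Definition Act j : R :=
  1 - expR (- (pi * lamu * Rintegral mu `[0, Rk j ^+ 2]%classic
                 (fun r => expR (- (pi * assoc_exp j r))))).
(* density of the serving distance X_k *)
Definition fX k (x : R) : R :=
  if (0 < x) && (x <= Rk k) then
    2 * pi * lam k / Tk k * x * expR (- (pi * assoc_exp k (x ^+ 2)))
  else 0.
(* exclusion radius r_{j,k} given X_k = x *)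
Definition rjk (j k : 'I_K) (x : R) : R :=
  (Omg j / Omg k) `^ (al j)^-1 * x `^ (al k / al j).

Variables (W beta : R).
Definition sig k : R := beta * W / Pw k.
Definition tau (j k : 'I_K) : R :=
  beta / (((Mn j)%:R / (Mn k)%:R) * (Bb j / Bb k)).
Definition phi (j k : 'I_K) (n : nat) : R :=
  if n == 0%N then
    dlt j * tau j k * hyp2F1 1 (1 - dlt j) (2 - dlt j) (- tau j k) / (1 - dlt j)
  else
    dlt j * tau j k ^+ n *
      hyp2F1 n.+1%:R (n%:R - dlt j) (n.+1%:R - dlt j) (- tau j k) /
      (n%:R - dlt j).
Definition gkn (k : 'I_K) (n : nat) (x : R) : R :=
  \sum_(j < K) Act j * lam j * (Omg j / Omg k) `^ dlt j * phi j k n *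
    x `^ (dlt j / dlt k).
Definition Qmx (k : 'I_K) (x : R) : 'M[R]_(Mn k) :=
  \matrix_(p, q) (if (q < p)%N then gkn k (p - q) x else 0).

Definition outage_formula (k : 'I_K) : R :=
  1 - lam k / Tk k *
    \sum_(i < Mn k) \sum_(m < Mn k) \sum_(n < m.+1)
      Rintegral mu `[0, Rk k ^+ 2]%classic (fun x =>
        pi ^+ i.+1 * sig k ^+ (m - n) / ((m - n)`!%:R * i`!%:R) *
        x `^ (al k / 2 * (m - n)%:R) *
        expR (- (sig k * x `^ (al k / 2)) - pi * gkn k 0 x
              - pi * assoc_exp k x) *
        mxentry (Qmx k x ^+ i) n 0).

(* equal path-loss exponent case: al j = a for all j, delta = 2/a *)
Definition Lam (a : R) : R := \sum_(j < K) lam j * Omg j `^ (2 / a).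
Definition theta (a : R) (k : 'I_K) (n : nat) : R :=
  \sum_(j < K) Act j * lam j * (Omg j / Omg k) `^ (2 / a) * phi j k n.
Definition Theta (a : R) (k : 'I_K) : 'M[R]_(Mn k) :=
  \matrix_(p, q) (if (q < p)%N then theta a k (p - q) else 0).
Definition Zk (a : R) (k : 'I_K) : R :=
  theta a k 0 + Lam a / Omg k `^ (2 / a).
Definition Qk (a : R) (k : 'I_K) (i m n : nat) : R :=
  Rintegral mu `[0, Rk k ^+ 2]%classic (fun x =>
    x `^ (i%:R + a / 2 * (m - n)%:R) *
    expR (- (sig k * x `^ (a / 2)) - pi * Zk a k * x)).
Definition outage_formula_eq (a : R) (k : 'I_K) : R :=
  1 - lam k / Tk k *
    \sum_(i < Mn k) \sum_(m < Mn k) \sum_(n < m.+1)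
      pi ^+ i.+1 * sig k ^+ (m - n) * Qk a k i m n / (i`!%:R * (m - n)`!%:R) *
      mxentry (Theta a k ^+ i) n 0.
End network.

(* index type of the mutually independent components of the model:
   inl true = X_k, inl false = signal gain, inr (inl j) = point process of
   tier j, inr (inr (j,n)) = fading mark of the n-th tier-j interferer *)
Definition comp_index (K : nat) : eqType := (bool + ('I_K + ('I_K * nat)))%type.

(* Main.v *)
Require Import Defs.
From HB Require Import structures.
From mathcomp Require Import all_boot all_order all_algebra.
From mathcomp Require Import all_classical all_reals all_analysis.
From mathcomp Require Import measurable_realfun.
From mathcomp Require Import ring lra.
Import Order.TTheory GRing.Theory Num.Theory.
Import numFieldNormedType.Exports.
Local Open Scope classical_set_scope.
Local Open Scope ring_scope.

(** Condition on the serving distance X_k = x. Given it, multiplying interference plus noise by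
    beta x^alpha_k / P_k produces a nonnegative random variable Z that is independent of the
    Gamma(M_k, 1) signal gain, so the success probability is the sum over m < M_k of
    p_m = E[e^(-Z) Z^m / m!]. These are the first M_k Taylor coefficients in s of
    E[e^(-(1-s) Z)], which the Laplace functional of Poisson processes with exponential marks
    evaluates: tier j contributes the integral of (1-s)c/(1 + (1-s)c) over the complement of the
    exclusion disk, c being a multiple of |y|^(-alpha_j). In polar coordinates this is a Beta-type
    integral over ]0, 1[, whose expansion in s has the coefficients phi_{j,k}(n) by Euler's formula
    for 2F1. Expansions in s are compared up to O(s^M_k) only, which determines the coefficients
    without differentiating under the expectation. Taking coefficients in the exponential of a power
    series amounts to taking powers of the nilpotent Toeplitz matrix. Integrating against the density
    of X_k and substituting x^2 for x gives the formula. *)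

(** * Independence *)

(** A Poisson process is given here by its counts only, which do not describe the joint law of the
    enumerated points. The positions of a tier are therefore never integrated one by one: the marks
    are integrated out singly, and the positions are then treated as one block, through events that
    prescribe the counts in finitely many disjoint sets. All of this happens for the first N points
    of each tier, and N tends to infinity last. No conditional probability is formed: X_k is one of
    the independent components, and fixing its value is Tonelli's theorem between X_k and the
    sigma-algebra generated by all the others. The interference stays in the extended reals, e^(-z)
    and e^(-z) z^m / m! being extended by 0 at +oo, so that neither its finiteness nor its moments
    are ever discussed: the remainder of order M of e^(-(1-s)z) = e^(-z) e^(sz) lies between 0 and
    s^M for every z >= 0. The variable s is confined to ]0, 1/2] to keep the Laplace variable 1 - s
    positive. In the variable t = (r/|y|)^alpha_j, the exclusion radius r enters only through the
    factor pi r^2; this is what separates the powers of x from the constants phi_{j,k}(n). *)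

Section independence.
Context {R : realType} {d : measure_display} {Om : measurableType d}.
Variable P : probability Om R.

Section others.
Context {I : eqType} (F : I -> set (set Om)).
Hypothesis sF : forall i, sigma_algebra setT (F i).
Hypothesis mF : forall i, F i `<=` measurable.
Hypothesis indF : mutually_independent P F.

Definition others (i : I) : set (set Om) := [set A | exists2 j, j != i & F j A].

Lemma others_measurable i : others i `<=` measurable.
Proof. by move=> A [j _ /mF]. Qed.

Let FT j : F j setT.
Proof. by rewrite -(setD0 setT); case: (sF j) => F0 FD _; exact: FD. Qed.

Let FI j A B : F j A -> F j B -> F j (A `&` B).
Proof.
pose T : measurableType (F j).-sigma := g_sigma_algebraType (F j).
have E : <<s F j>> = F j by apply: sigma_algebra_id; exact: sF.
move=> FA FB; rewrite -E.
by apply: (@measurableI _ T); rewrite /measurable/= E.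
Qed.

(** Finite intersections of sets taken from the other families form a pi-system [C] that generates
    the same sigma-algebra. The finite measures A -> P(A n S) and A -> P(S) P(A) agree on [C] by
    mutual independence, hence everywhere. *)
Lemma independent_others i S S' : F i S -> <<s others i>> S' ->
  P (S `&` S') = (P S * P S')%E.
Proof.
move=> FS.
pose C := [set A | exists s E, [/\ uniq s, i \notin s,
  (forall j, j \in s -> F j (E j)) & A = \bigcap_(j in [set` s]) E j]].
have mS : measurable S := mF _ _ FS.
have PSfin : P S \is a fin_num by exact: fin_num_measure.
have CT : C setT.
  by exists [::], (fun=> setT); split => //; rewrite set_nil bigcap_set0.
have CI : setI_closed C.
  move=> _ _ [s [E [us nis FE ->]]] [s' [E' [us' nis' FE' ->]]].
  (* Two finite intersections are brought to a common index list by inserting [setT] where an index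
     is missing. *)
  exists (undup (s ++ s')), (fun j => (if j \in s then E j else setT) `&`
    (if j \in s' then E' j else setT)); split.
  - exact: undup_uniq.
  - by rewrite mem_undup mem_cat negb_or nis.
  - by move=> j _; apply: FI; case: ifPn => // js; [exact: FE|exact: FE'].
  - apply/seteqP; split=> w /=.
      move=> [w1 w2] j _; split; case: ifPn => // js; [exact: w1|exact: w2].
    move=> w1; split=> j js.
      have [|+ _] := w1 j; first by rewrite /= mem_undup mem_cat js.
      by rewrite js.
    have [|_] := w1 j; first by rewrite /= mem_undup mem_cat js orbT.
    by rewrite js.
have mC : C `<=` measurable.
  move=> _ [s [E [us nis FE ->]]].
  apply: fin_bigcap_measurable; first exact: finite_seq.
  by move=> j /= /FE /mF.
have OC : others i `<=` C.
  move=> A [j ji FA]; exists [:: j], (fun=> A); split => //.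
  - by rewrite inE eq_sym.
  - by move=> k; rewrite inE => /eqP ->.
  - by apply/seteqP; split=> [w Aw k//|w /(_ j)]; rewrite /= inE eqxx; exact.
pose m1 : {measure set Om -> \bar R} := mrestr P mS.
have PS0 : (0 <= fine (P S))%R by rewrite fine_ge0.
pose m2 : {measure set Om -> \bar R} := mscale (NngNum PS0) P.
suff m12 A : <<s C>> A -> m1 A = m2 A.
  move=> S'o; have : <<s C>> S' by apply: sub_smallest2r S'o.
  by move=> /m12; rewrite /m1/m2/= /mscale/= /mrestr setIC fineK.
apply: (g_sigma_algebra_measure_unique C mC (fun=> setT)) => //.
- by rewrite bigcup_const//; exists 0%N.
- move=> _ [s [E [us nis FE ->]]]; rewrite /m1/m2/= /mscale/= /mrestr fineK//.
  have := indF (i :: s) (fun j => if j == i then S else E j).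
  rewrite /= nis us => /(_ erefl) => ind.
  have {}ind := ind _; move: ind.
  rewrite big_cons eqxx.
  set Q := (\prod_(j <- s) _)%E.
  have -> : Q = (\prod_(j <- s) P (E j))%E.
    rewrite /Q !big_seq; apply: eq_bigr => j js; case: ifPn => // /eqP ji.
    by move: nis; rewrite -ji js.
  rewrite -(indF _ _ us FE) => <-.
    congr (P _); apply/seteqP; split=> w /=.
      move=> [ws wS] j; rewrite /= inE => /orP[/eqP ->|js]; first by rewrite eqxx.
      by case: ifPn => // _; exact: ws.
    move=> wE; split; last by have := wE i; rewrite eqxx; apply; rewrite /= inE eqxx.
    move=> j js; have := wE j; rewrite /= inE js orbT => /(_ isT).
    by case: ifPn => // /eqP ji; move: nis; rewrite -ji js.
  move=> j; rewrite inE => /orP[/eqP ->|js]; first by rewrite eqxx.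
  by case: ifPn => [/eqP ->//|_]; exact: FE.
- by move=> ?; rewrite /m1 /= /mrestr setTI (le_lt_trans (probability_le1 _ _)) ?ltry.
Qed.

End others.

Context {d1 d2 : measure_display} {T1 : measurableType d1} {T2 : measurableType d2}.
Variables (U : Om -> T1) (V : Om -> T2).
Hypotheses (mU : measurable_fun setT U) (mV : measurable_fun setT V).
Hypothesis indUV : forall A B, measurable A -> measurable B ->
  P (U @^-1` A `&` V @^-1` B) = (P (U @^-1` A) * P (V @^-1` B))%E.

(** Independence says that the joint law of [U] and [V] is the product of their laws; both
    equalities are Tonelli's theorem for that product, pulled back. The target [T2] is arbitrary
    because [V] will later be the identity of the sample space, seen with a smaller
    sigma-algebra. *)
Lemma independent_fubini (f : T1 * T2 -> \bar R) :
  measurable_fun setT f -> (forall z, (0 <= f z)%E) ->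
  (\int[P]_w f (U w, V w) = \int[P]_w \int[P]_w' f (U w, V w'))%E /\
  (\int[P]_w f (U w, V w) = \int[P]_w' \int[P]_w f (U w, V w'))%E.
Proof.
move=> mf f0.
pose U' : {mfun Om >-> T1} := HB.pack U (isMeasurableFun.Build _ _ _ _ _ mU).
pose V' : {mfun Om >-> T2} := HB.pack V (isMeasurableFun.Build _ _ _ _ _ mV).
have mUV : measurable_fun setT (fun w => (U w, V w)) by exact: measurable_fun_pair.
pose UV : {mfun Om >-> (T1 * T2)%type} :=
  HB.pack (fun w => (U w, V w)) (isMeasurableFun.Build _ _ _ _ _ mUV).
pose PU : probability _ _ := distribution P U'.
pose PV : probability _ _ := distribution P V'.
pose PUV : probability _ _ := distribution P UV.
have prodE A : measurable A -> (PU \x PV)%E A = PUV A.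
  by apply: product_measure_unique => A1 A2 mA1 mA2; exact: indUV.
have E0 : (\int[P]_w f (U w, V w) = \int[(PU \x PV)%E]_z f z)%E.
  rewrite (eq_measure_integral PUV); last by move=> A mA _; exact: prodE.
  by rewrite /PUV ge0_integral_distribution.
split.
- rewrite E0 fubini_tonelli1//.
  rewrite /PU ge0_integral_distribution//=; last 2 first.
  + exact: measurable_fun_fubini_tonelli_F.
  + by move=> x; exact: integral_ge0.
  apply: eq_integral => w _; rewrite /fubini_F /PV.
  rewrite ge0_integral_distribution//.
  by apply/measurableT_comp => //; exact: pair1_measurable.
- rewrite E0 fubini_tonelli1// fubini_tonelli//.
  rewrite /PV ge0_integral_distribution//=; last 2 first.
  + exact: measurable_fun_fubini_tonelli_G.
  + by move=> x; exact: integral_ge0.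
  apply: eq_integral => w _; rewrite /fubini_G /PU.
  rewrite ge0_integral_distribution//.
  by apply/measurableT_comp => //; exact: pair2_measurable.
Qed.

End independence.

(** * Random variables with values in [0, 1] *)

Section unit_random_variables.
Context {R : realType} {d : measure_display} {Om : measurableType d}.
Variable P : probability Om R.
Implicit Types W : Om -> R.

(** Every quantity whose expectation is taken (Laplace factors, Poisson probabilities) is of this
    kind: integrability is automatic, products stay in the class, and dominated convergence holds
    with the constant 1 as bound. *)
Definition rv01 W := measurable_fun setT W /\ forall w, 0 <= W w <= 1.

Lemma rv01_integrable W : rv01 W -> P.-integrable setT (EFin \o W).
Proof.
move=> [mW W01]; apply: (@le_integrable _ _ _ _ _ measurableT _ (cst 1%E)).
- exact/measurable_EFinP.
- by move=> w _ /=; have /andP[? ?] := W01 w; rewrite lee_fin !ger0_norm.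
- exact: finite_measure_integrable_cst.
Qed.

Lemma rv01_integral W : rv01 W ->
  (\int[P]_w (W w)%:E)%E = (Rintegral P setT W)%:E.
Proof.
by move=> W01; rewrite fineK//; apply: integrable_fin_num => //; exact: rv01_integrable.
Qed.

Lemma rv01_cst (r : R) : 0 <= r <= 1 -> rv01 (cst r).
Proof. by move=> r01; split. Qed.

Lemma rv01_onem W : rv01 W -> rv01 (fun w => 1 - W w).
Proof.
move=> [mW W1]; split; first exact: measurable_funB.
by move=> w; have /andP[? ?] := W1 w; rewrite subr_ge0 gerBl; apply/andP.
Qed.

Lemma rv01M W W' : rv01 W -> rv01 W' -> rv01 (fun w => W w * W' w).
Proof.
move=> [mW W1] [mW' W1']; split; first exact: measurable_funM.
move=> w; have /andP[? ?] := W1 w; have /andP[? ?] := W1' w.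
by rewrite mulr_ge0//= mulr_ile1.
Qed.

Lemma rv01_prod (I : Type) (s : seq I) (W : I -> Om -> R) :
  (forall i, rv01 (W i)) -> rv01 (fun w => \prod_(i <- s) W i w).
Proof.
move=> W1; elim: s => [|i s IH].
  by under eq_fun do rewrite big_nil; apply: rv01_cst; rewrite ler01 lexx.
by under eq_fun do rewrite big_cons; exact: rv01M.
Qed.

Lemma rv01_le W W' : rv01 W -> rv01 W' -> (forall w, W w <= W' w) ->
  Rintegral P setT W <= Rintegral P setT W'.
Proof.
by move=> W1 W1' WW'; apply: le_Rintegral => //; exact: rv01_integrable.
Qed.

Lemma rv01_cvg (W : nat -> Om -> R) W' :
  (forall n, rv01 (W n)) -> (forall w, W ^~ w @ \oo --> W' w) ->
  rv01 W' /\ Rintegral P setT (W n) @[n --> \oo] --> Rintegral P setT W'.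
Proof.
move=> W1 WW'.
have mW' : measurable_fun setT W'.
  by apply: (@measurable_fun_cvg _ _ _ _ W) => [n|w _]; [have [] := W1 n|exact: WW'].
have W'1 : rv01 W'.
  split=> // w; have cW : cvgn (W ^~ w) by apply/cvg_ex; exists (W' w); exact: WW'.
  have /cvg_lim <- // := WW' w; apply/andP; split.
    by apply: limr_ge => //; apply: nearW => n; have [_ /(_ w)/andP[]] := W1 n.
  by apply: limr_le => //; apply: nearW => n; have [_ /(_ w)/andP[]] := W1 n.
split=> //; apply: (@fine_cvg _ _ _ _ (fun n => \int[P]_w (W n w)%:E)%E).
rewrite -/(Rintegral P setT W') -rv01_integral//.
apply: (@dominated_cvg _ _ _ P setT measurableT (fun n w => (W n w)%:E) _ (cst 1%E)).
- by move=> n; apply/measurable_EFinP; have [] := W1 n.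
- by move=> w _; apply: cvg_EFin; [exact: nearW|exact: WW'].
- by [].
- exact: finite_measure_integrable_cst.
- move=> n w _ /=; have [_ /(_ w)/andP[? ?]] := W1 n.
  by rewrite lee_fin ger0_norm.
Qed.

End unit_random_variables.

(** * Poisson point processes *)

Section poisson_process.
Context {R : realType} {d : measure_display} {Om : measurableType d}.
Variables (P : probability Om R) (Y : nat -> Om -> R * R) (lam : R).
Hypothesis mY : forall n, measurable_fun setT (Y n).

Local Notation cnt A N w := (\sum_(n < N) (Y n w \in A))%N.

Lemma measurable_pcount (A : set (R * R)) : measurable A ->
  measurable_fun setT (pcount Y A).
Proof.
move=> mA; apply: ge0_emeasurable_sum => // n _.
apply/measurable_EFinP; apply: measurableT_comp => //.
Qed.

(** The partial counts are integers, so they equal their finite limit [c] as soon as they are within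
    distance 1 of it. *)
Lemma near_pcount (A : set (R * R)) w (c : nat) :
  pcount Y A w = c%:R%:E -> \forall N \near \oo, cnt A N w = c.
Proof.
move=> Yc.
have sumE N : (\sum_(0 <= n < N) (\1_A (Y n w))%:E)%E = (cnt A N w)%:R%:E :> \bar R.
  rewrite big_mkord natr_sum -sumEFin; apply: eq_bigr => n _.
  by rewrite indicE.
have : (cnt A N w)%:R%:E @[N --> \oo] --> (c%:R%:E : \bar R).
  rewrite -Yc; under eq_fun do rewrite -sumE.
  by apply: is_cvg_nneseries => n _ _; rewrite lee_fin.
move=> /fine_cvg/cvgrPdist_lt/(_ _ ltr01); apply: filterS => N /=.
move=> /ltr_normlP[h1 h2].
have : (cnt A N w)%:R < c.+1%:R :> R by rewrite -natr1; lra.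
have : c%:R < (cnt A N w).+1%:R :> R by rewrite -natr1; lra.
by rewrite !ltr_nat !ltnS => cN Nc; apply/eqP; rewrite eqn_leq Nc cN.
Qed.

Lemma cvg_poisson_pgf (mu u : R) :
  \sum_(c < C) u ^+ c * poisson_mass mu c @[C --> \oo] --> expR (- ((1 - u) * mu)).
Proof.
have -> : - ((1 - u) * mu) = - mu + u * mu by ring.
rewrite expRD; have -> : (fun C => \sum_(c < C) u ^+ c * poisson_mass mu c) =
    (fun C => expR (- mu) * series (exp_coeff (u * mu)) C).
  apply/funext => C; rewrite /series/= big_mkord mulr_sumr; apply: eq_bigr => c _.
  by rewrite /poisson_mass /exp_coeff/= exprMn; ring.
by apply: cvgMr; exact: is_cvg_series_exp_coeff.
Qed.

Hypothesis hY : is_hPPP P Y lam.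

Section simple.
Variables (m : nat) (A : 'I_m -> set (R * R)).
Hypothesis mA : forall i, measurable (A i).
Hypothesis fA : forall i, (area (A i) < +oo)%E.
Hypothesis dA : forall i j, i != j -> A i `&` A j = set0.

Let B (i : 'I_m) (c : nat) := [set w | pcount Y (A i) w = c%:R%:E].

Let mB i c : measurable (B i c).
Proof.
have := measurable_pcount _ (mA i) measurableT [set c%:R%:E] (emeasurable_set1 _).
by rewrite setTI.
Qed.

(** Truncated joint generating function of the counts: the product of the u_i^(count in A_i) if all
    counts are finite and less than [C], and 0 otherwise. In particular [poly (fun=> 1) C] is the
    indicator of the event that all counts are less than [C]. *)
Let poly (u : 'I_m -> R) C (w : Om) :=
  \prod_(i < m) \sum_(c < C) u i ^+ c * \1_(B i c) w.

Let sumB (u : R) i C w : \sum_(c < C) u ^+ c * \1_(B i c) w =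
  if [pick c : 'I_C | `[< B i c w >]] is Some c then u ^+ c else 0.
Proof.
case: pickP => [c /asboolP Bc|noB].
  rewrite (bigD1 c)//= big1 ?addr0 ?indicE ?mem_set ?mulr1// => c' c'c.
  rewrite indicE memNset ?mulr0// => Bc'; move/eqP: c'c; apply; apply/val_inj.
  move: Bc Bc'; rewrite /B/= => -> [] /eqP.
  by rewrite eqr_nat => /eqP ->.
by apply: big1 => c _; rewrite indicE memNset ?mulr0// => Bc; have := noB c; rewrite asboolT.
Qed.

Let rv01_poly u C : (forall i, 0 <= u i <= 1) -> rv01 (poly u C).
Proof.
move=> u01; apply: rv01_prod => i; split.
  by apply: measurable_sum => c; apply: measurable_funM => //; exact: measurable_indic.
move=> w; rewrite sumB; case: pickP => [c _|_]; last by rewrite lexx ler01.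
by have /andP[u0 u1] := u01 i; rewrite exprn_ge0//= exprn_ile1.
Qed.

(** Expanding the product over all vectors of counts below [C] produces exactly the joint events
    whose probabilities the definition of the Poisson process prescribes. *)
Let expectation_poly u C : (forall i, 0 <= u i <= 1) ->
  Rintegral P setT (poly u C) =
  \prod_(i < m) \sum_(c < C) u i ^+ c * poisson_mass (lam * fine (area (A i))) c.
Proof.
move=> u01; rewrite bigA_distr_bigA/=.
pose T (c : {ffun 'I_m -> 'I_C}) : Om -> R :=
  fun w => (\prod_i u i ^+ c i) * \1_(\bigcap_i B i (c i)) w.
have mBc (c : {ffun 'I_m -> 'I_C}) : measurable (\bigcap_i B i (c i)).
  exact: fin_bigcap_measurable.
have -> : poly u C = (fun w => \sum_(c : {ffun 'I_m -> 'I_C}) T c w).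
  apply/funext => w; rewrite /poly bigA_distr_bigA; apply: eq_bigr => c _.
  rewrite /T big_split/=; congr (_ * _); rewrite indicE.
  have [Bw|nB] := pselect (forall i, B i (c i) w).
    rewrite mem_set => [|i _]; last exact: Bw.
    by rewrite big1// => i _; rewrite indicE mem_set.
  rewrite memNset => [|Bw]; last by apply: nB => i; exact: Bw.
  have [i nBi] : exists i, ~ B i (c i) w by apply/existsNP.
  by rewrite (bigD1 i)//= indicE memNset// mul0r.
rewrite /Rintegral.
have T0 c w : 0 <= T c w.
  rewrite /T mulr_ge0//; apply: prodr_ge0 => i _.
  by apply: exprn_ge0; have /andP[] := u01 i.
have mT c : measurable_fun setT (T c).
  by apply: measurable_funM => //; exact: measurable_indic.
under eq_integral do rewrite -sumEFin.
rewrite ge0_integral_sum//; last 2 first.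
  by move=> c; apply/measurable_EFinP.
  by move=> c w _; rewrite lee_fin.
rewrite (eq_bigr (fun c : {ffun 'I_m -> 'I_C} =>
    (\prod_i (u i ^+ c i * poisson_mass (lam * fine (area (A i))) (c i)))%:E)); last first.
  move=> c _; rewrite /T; under eq_integral do rewrite EFinM.
  rewrite ge0_integralZl_EFin//; last 2 first.
    by apply/measurable_EFinP; exact: measurable_indic.
    by apply: prodr_ge0 => i _; apply: exprn_ge0; have /andP[] := u01 i.
  rewrite integral_indic// setIT big_split/= EFinM; congr (_ * _)%E.
  by rewrite (hY m A (fun i => c i)) // prodEFin.
by rewrite sumEFin.
Qed.

(** The products decrease with N, hence converge pointwise to some W'. Where the counts are finite,
    W' is the product of the (1 - v_i)^count; that they are finite almost surely is not proved
    separately but comes out of the sandwich below, since the Poisson masses sum to 1. *)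
Lemma cvg_poisson_simple (v : 'I_m -> R) : (forall i, 0 <= v i <= 1) ->
  Rintegral P setT (fun w => \prod_(n < N) \prod_(i < m) (1 - v i * \1_(A i) (Y n w)))
    @[N --> \oo] --> expR (- (lam * \sum_(i < m) v i * fine (area (A i)))).
Proof.
move=> v01.
pose W N w := \prod_(n < N) \prod_(i < m) (1 - v i * \1_(A i) (Y n w)).
have f01 i n w : 0 <= 1 - v i * \1_(A i) (Y n w) <= 1.
  have /andP[? ?] := v01 i; rewrite indicE; case: (_ \in _); rewrite ?mulr1 ?mulr0; lra.
have W01 N : rv01 (W N).
  apply: rv01_prod => n; apply: rv01_prod => i; split=> //.
  apply: measurable_funB => //; apply: measurable_funM => //.
  exact: measurableT_comp.
have dW w : nonincreasing_seq (W ^~ w).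
  apply/nonincreasing_seqP => N; rewrite /W big_ord_recr/= ler_piMr//.
    by apply: prodr_ge0 => n _; apply: prodr_ge0 => i _; have /andP[] := f01 i n w.
  by apply: prodr_ile1 => i _.
have cW w : cvgn (W ^~ w).
  apply: nonincreasing_is_cvgn => //; exists 0 => _ [N _ <-].
  by have [_ /(_ w)/andP[]] := W01 N.
pose W' w := limn (W ^~ w).
have [W'01 cvgEW] := rv01_cvg P W W' W01 cW.
suff -> : expR (- (lam * \sum_(i < m) v i * fine (area (A i)))) = Rintegral P setT W'.
  exact: cvgEW.
pose u i := 1 - v i.
have u01 i : 0 <= u i <= 1 by have := v01 i; rewrite /u; lra.
have WE N w : W N w = \prod_(i < m) u i ^+ cnt (A i) N w.
  rewrite /W exchange_big/=; apply: eq_bigr => i _; rewrite -prodrXr.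
  by apply: eq_bigr => n _; rewrite indicE /u; case: (_ \in _); rewrite ?mulr1// mulr0 subr0.
(* Either all counts are less than [C], and both bounds equal W', or both truncations vanish, and
   the bounds are 0 and 1. The expectations of the two bounds have the same limit as [C] grows. *)
have H C w : poly u C w <= W' w <= poly u C w + (1 - poly (fun=> 1) C w).
  have /andP[W'0 W'1] : 0 <= W' w <= 1 by have [_] := W'01.
  have [Bw|/existsNP[i nBi]] := pselect (forall i, exists c : 'I_C, B i c w).
    have {Bw} [c Bw] := choice Bw.
    have pE y : poly y C w = \prod_(i < m) y i ^+ c i.
      apply: eq_bigr => i _; rewrite sumB; case: pickP => [c' /asboolP|/(_ (c i))].
        by move: (Bw i); rewrite /B/= => -> /eqP; rewrite eqe eqr_nat => /eqP ->.
      by rewrite asboolT.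
    rewrite !pE; rewrite [X in 1 - X]big1 ?subrr ?addr0 => [|i _]; last by rewrite expr1n.
    suff -> : W' w = \prod_(i < m) u i ^+ c i by rewrite lexx.
    apply: lim_near_cst => //.
    have : \forall N \near \oo, forall i, cnt (A i) N w = c i.
      by apply: filter_forall => i; exact: near_pcount (Bw i).
    by apply: filterS => N E; rewrite WE; apply: eq_bigr => i _; rewrite E.
  have pE y : poly y C w = 0.
    rewrite /poly (bigD1 i)//= sumB; case: pickP => [c /asboolP Bc|_]; last by rewrite mul0r.
    by case: nBi; exists c.
  by rewrite !pE subr0 add0r W'0.
have one01 (i : 'I_m) : 0 <= (1 : R) <= 1 by rewrite ler01 lexx.
have EH C : Rintegral P setT (poly u C) <= Rintegral P setT W' <=
    Rintegral P setT (poly u C) + (1 - Rintegral P setT (poly (fun=> 1) C)).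
  have iu : P.-integrable setT (EFin \o poly u C).
    by apply: rv01_integrable; exact: rv01_poly.
  have i1 : P.-integrable setT (EFin \o poly (fun=> 1) C).
    by apply: rv01_integrable; exact: rv01_poly.
  have ib : P.-integrable setT (EFin \o (fun w => 1 - poly (fun=> 1) C w)).
    by apply: rv01_integrable; apply: rv01_onem; exact: rv01_poly.
  have ic : P.-integrable setT (EFin \o cst (1 : R)) by exact: finite_measure_integrable_cst.
  have iW : P.-integrable setT (EFin \o W') by exact: rv01_integrable.
  apply/andP; split.
    by apply: le_Rintegral => // w _; have /andP[] := H C w.
  have E1 : Rintegral P setT (cst 1) = 1.
    by rewrite Rintegral_cst// mul1r -[RHS]/(fine 1%E); congr fine; exact: probability_setT.
  rewrite -[X in X - _]E1 -RintegralB// -RintegralD//.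
  apply: le_Rintegral => //; first exact: (@integrableD _ _ _ P setT measurableT _ _ iu ib).
  by move=> w _; have /andP[] := H C w.
have cvgp y : (forall i, 0 <= y i <= 1) -> Rintegral P setT (poly y C) @[C --> \oo] -->
    expR (- (lam * \sum_(i < m) (1 - y i) * fine (area (A i)))).
  move=> y01; under eq_fun do rewrite expectation_poly//.
  have -> : expR (- (lam * \sum_(i < m) (1 - y i) * fine (area (A i)))) =
      \prod_(i < m) expR (- ((1 - y i) * (lam * fine (area (A i))))).
    rewrite -expR_sum mulr_sumr -sumrN; congr expR; apply: eq_bigr => i _; ring.
  apply: cvg_big => [|i _]; last exact: cvg_poisson_pgf.
  exact: mul_continuous.
have cu : Rintegral P setT (poly u C) @[C --> \oo] -->
    expR (- (lam * \sum_(i < m) v i * fine (area (A i)))).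
  have -> : \sum_(i < m) v i * fine (area (A i)) =
      \sum_(i < m) (1 - u i) * fine (area (A i)).
    by apply: eq_bigr => i _; rewrite /u; ring.
  exact: cvgp.
suff cc : (fun _ : nat => Rintegral P setT W') @ \oo -->
    expR (- (lam * \sum_(i < m) v i * fine (area (A i)))).
  by rewrite -(cvg_lim _ cc)// lim_cst.
apply: (@squeeze_cvgr _ _ _ _ (fun C => Rintegral P setT (poly u C)) 
  (fun C => Rintegral P setT (poly u C) + (1 - Rintegral P setT (poly (fun=> 1) C)))) => //.
  by apply: nearW => C; exact: EH.
rewrite -[X in _ --> X]addr0; apply: cvgD => //.
rewrite -(subrr 1); apply: cvgB; first exact: cvg_cst.
have := cvgp (fun=> 1) one01; rewrite big1 ?mulr0 ?oppr0 ?expR0//.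
by move=> i _; rewrite subrr mul0r.
Qed.

End simple.

End poisson_process.

Import HBNNSimple.

Section poisson_laplace.
Context {R : realType} {d : measure_display} {Om : measurableType d}.
Variables (P : probability Om R) (Y : nat -> Om -> R * R) (lam : R).
Hypothesis mY : forall n, measurable_fun setT (Y n).
Hypothesis hY : is_hPPP P Y lam.
Local Notation mu := (@lebesgue_measure R).
Local Notation mu2 := (mu \x mu)%E.

Lemma cvg_poisson_nnsfun (g : {nnsfun (R * R)%type >-> R}) :
  (forall y, g y <= 1) -> (\int[mu2]_y (g y)%:E < +oo)%E ->
  Rintegral P setT (fun w => \prod_(n < N) (1 - g (Y n w)))
    @[N --> \oo] --> expR (- (lam * fine (\int[mu2]_y (g y)%:E))).
Proof.
move=> g1 goo.
(* The value 0 is discarded because its level set may have infinite area; each other level set has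
   finite area, the integral of [g] being finite. *)
pose vs := [seq v <- finmap.enum_fset (fset_set (range g)) | v != 0].
pose m := size vs.
pose v (i : 'I_m) := tnth (in_tuple vs) i.
pose A (i : 'I_m) := g @^-1` [set v i].
have mA i : measurable (A i) by exact: measurable_sfunP.
have mI i : measurable_fun setT (\1_(A i) : R * R -> R).
  by apply: measurable_indic; exact: mA.
have dA i j : i != j -> A i `&` A j = set0.
  move=> ij; apply/seteqP; split=> // y []; rewrite /A/= => -> /eqP.
  rewrite /v (tnth_nth 0) (tnth_nth 0)/= nth_uniq//; last exact/filter_uniq/finmap.fset_uniq.
  by move/eqP/val_inj => ijE; rewrite ijE eqxx in ij.
have v0 i : 0 < v i <= 1.
  have : v i \in vs by exact: mem_tnth.
  rewrite mem_filter => /andP[vi0]; rewrite in_fset_set// inE => -[y _ gy].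
  by rewrite -gy g1 lt_neqAle eq_sym {1}gy vi0 fun_ge0.
have vP y : g y = 0 \/ exists i, A i y.
  have [->|gy0] := eqVneq (g y) 0; [by left|right].
  have : g y \in vs.
    rewrite mem_filter gy0 in_fset_set//; apply: mem_set; by exists y.
  by move=> /(tnthP (in_tuple vs)) [i gy]; exists i.
have nA y i j : A i y -> j != i -> \1_(A j) y = 0 :> R.
  move=> Ai ji; rewrite indicE memNset// => Aj.
  by have : (A j `&` A i) y by []; rewrite dA.
have n0A y i : g y = 0 -> \1_(A i) y = 0 :> R.
  move=> gy0; rewrite indicE memNset// /A/= gy0 => vi.
  by have := v0 i; rewrite -vi ltxx.
have gE y : g y = \sum_i v i * \1_(A i) y.
  have [gy|[i Ai]] := vP y; first by rewrite gy big1// => i _; rewrite n0A// mulr0.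
  rewrite (bigD1 i)//= big1 ?addr0; last by move=> j ji; rewrite (nA y i)// mulr0.
  by rewrite indicE mem_set// mulr1.
have gP y : 1 - g y = \prod_i (1 - v i * \1_(A i) y).
  have [gy|[i Ai]] := vP y.
    by rewrite gy subr0 big1// => i _; rewrite n0A// mulr0 subr0.
  rewrite (bigD1 i)//= big1 ?mulr1; last by move=> j ji; rewrite (nA y i)// mulr0 subr0.
  by rewrite indicE mem_set// mulr1 Ai.
have ig : (\int[mu2]_y (g y)%:E = \sum_i (v i)%:E * mu2 (A i))%E.
  under eq_integral do rewrite gE -sumEFin.
  rewrite ge0_integral_sum//.
  - apply: eq_bigr => i _; under eq_integral do rewrite EFinM.
    have /andP[vi _] := v0 i.
    rewrite ge0_integralZl_EFin ?(ltW vi)//; last first.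
      by apply/measurable_EFinP; exact: mI.
    congr (_ * _)%E; exact: (eq_trans (integral_indic mu2 measurableT (mA i)) (congr1 mu2 (setIT _))).
  - move=> i; apply/measurable_EFinP; apply: measurable_funM => //; exact: mI.
  - by move=> i y _; have /andP[vi _] := v0 i; rewrite lee_fin mulr_ge0// ltW.
have fA i : (area (A i) < +oo)%E.
  move: goo; rewrite ig; have /andP[vi _] := v0 i.
  have ge0 j : (0 <= (v j)%:E * mu2 (A j))%E.
    by have /andP[vj _] := v0 j; rewrite mule_ge0// lee_fin ltW.
  rewrite (bigD1 i)//= => H; rewrite /area ltNge leye_eq; apply/negP => /eqP Aoo.
  move: H; rewrite Aoo gt0_muley ?lte_fin// addye ?ltxx//.
  by rewrite gt_eqF// (lt_le_trans (ltNyr 0))// sume_ge0.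
have -> : fine (\int[mu2]_y (g y)%:E) = \sum_i v i * fine (area (A i)).
  rewrite ig -sum_fine//; last by move=> i _; rewrite fin_numM// ge0_fin_numE//; exact: fA.
  by apply: eq_bigr => i _; rewrite fineM// ge0_fin_numE//; exact: fA.
under eq_fun do under eq_Rintegral do under eq_bigr do rewrite gP.
by apply: cvg_poisson_simple => // i; have /andP[vi ->] := v0 i; rewrite ltW.
Qed.

(** Simple functions g_k increase to f, and the two limits are exchanged by monotonicity. The
    expectations for g_k decrease in N to their limit L_k, so they are at least L_k, and k -> oo at
    fixed N bounds the expectation for f below by L. From above it is bounded by the expectation for
    g_k, which is close to L_k, hence to L, once k and then N are large. *)
Theorem cvg_poisson_laplace (f : R * R -> R) :
  measurable_fun setT f -> (forall y, 0 <= f y <= 1) ->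
  (\int[mu2]_y (f y)%:E < +oo)%E ->
  Rintegral P setT (fun w => \prod_(n < N) (1 - f (Y n w)))
    @[N --> \oo] --> expR (- (lam * fine (\int[mu2]_y (f y)%:E))).
Proof.
move=> mf f01 foo.
have mEf : measurable_fun setT (EFin \o f) by exact/measurable_EFinP.
pose g k := nnsfun_approx measurableT mEf k.
have f0 y : setT y -> (0 <= (EFin \o f) y)%E by rewrite lee_fin; have /andP[] := f01 y.
have cg y : g ^~ y @ \oo --> f y.
  by have /fine_cvg := @cvg_nnsfun_approx _ _ _ _ measurableT _ mEf f0 y I.
have ndg y : nondecreasing_seq (g ^~ y).
  by move=> a b ab; exact/lefP/nd_nnsfun_approx.
have gf k y : g k y <= f y.
  have /cvg_lim <- // := cg y; apply: nondecreasing_cvgn_le => //.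
  by apply/cvg_ex; exists (f y).
have g1 k y : 0 <= g k y <= 1.
  by have /andP[_ f1] := f01 y; rewrite fun_ge0 (le_trans (gf k y)).
have mg k : measurable_fun setT (g k : R * R -> R) by [].
have igf k : (\int[mu2]_y (g k y)%:E <= \int[mu2]_y (f y)%:E)%E.
  apply: ge0_le_integral => //.
  - by move=> y _; rewrite lee_fin fun_ge0.
  - by apply/measurable_EFinP; exact: mg.
  - by move=> y _; rewrite lee_fin gf.
pose W (h : R * R -> R) N w := \prod_(n < N) (1 - h (Y n w)).
pose e h N := Rintegral P setT (W h N).
have W1 (h : R * R -> R) N : measurable_fun setT h -> (forall y, 0 <= h y <= 1) -> rv01 (W h N).
  move=> mh h01; apply: rv01_prod => n; apply: rv01_onem; split=> //.
  exact: measurableT_comp.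
have gW k N : rv01 (W (g k) N) by exact: W1.
have fW N : rv01 (W f N) by exact: W1.
pose L := expR (- (lam * fine (\int[mu2]_y (f y)%:E))).
pose Lk k := expR (- (lam * fine (\int[mu2]_y (g k y)%:E))).
have cLk : Lk @ \oo --> L.
  apply: (@continuous_cvg _ _ _ _ _ (fun k => - (lam * fine (\int[mu2]_y (g k y)%:E))) expR); first exact: continuous_expR.
  apply: cvgN; apply: cvgMr; apply: fine_cvg; rewrite fineK; last first.
    by rewrite ge0_fin_numE//; apply: integral_ge0 => y _; exact: f0.
  have -> : (\int[mu2]_y (f y)%:E = \int[mu2]_y limn (fun k => (g k y)%:E))%E.
    apply: eq_integral => y _; apply/esym/cvg_lim => //.
    exact: (@cvg_nnsfun_approx _ _ _ _ measurableT _ mEf f0 y I).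
  apply: (@cvg_monotone_convergence _ _ _ mu2 _ measurableT (fun k y => (g k y)%:E)).
  - by move=> k; apply/measurable_EFinP; exact: mg.
  - by move=> k y _; rewrite lee_fin fun_ge0.
  - by move=> y _ a b ab; rewrite lee_fin ndg.
have ek k : e (g k) N @[N --> \oo] --> Lk k.
  apply: cvg_poisson_nnsfun => [y|]; first by have /andP[] := g1 k y.
  exact: le_lt_trans (igf k) foo.
have Lke k N : Lk k <= e (g k) N.
  have /cvg_lim <- // := ek k; apply: nonincreasing_cvgn_ge; last by apply/cvg_ex; exists (Lk k).
  apply/nonincreasing_seqP => n; apply: rv01_le => // w.
  rewrite /W big_ord_recr/= ler_piMr//; last by have := g1 k (Y n w); lra.
  by have [_ /(_ w)/andP[]] := gW k n.
have Le N : L <= e f N.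
  have ce : e (g k) N @[k --> \oo] --> e f N.
    apply: (rv01_cvg P (fun k => W (g k) N) (W f N) _ _).2 => // w.
    apply: cvg_big => [|n _]; first exact: mul_continuous.
    by apply: cvgB; [exact: cvg_cst|exact: cg].
  by apply: (ler_cvg_to cLk ce); apply: nearW.
have ef k N : e f N <= e (g k) N.
  apply: rv01_le => // w; apply: ler_prod => n _.
  by have := gf k (Y n w); have := f01 (Y n w); lra.
apply/cvgrPdist_lt => eps eps0.
have /cvgrPdist_lt/(_ (eps / 2))[|k _ kL] := cLk; first by lra.
have /cvgrPdist_lt/(_ (eps / 2)) := ek k; move=> /(_ ltac:(lra)).
apply: filterS => N; have := kL k (leqnn k) => /=.
rewrite -/(e f N) -/L; have := Le N; have := ef k N; have := Lke k N.
move=> h1 h2 h3; rewrite !ltr_norml => /andP[h4 h5] /andP[h6 h7].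
by apply/andP; split; lra.
Qed.

End poisson_laplace.

(** * Integration on segments and in the plane *)

Section calculus.
Context {R : realType}.
Local Notation mu := (@lebesgue_measure R).

Lemma is_derive_continuous (F : R -> R) (x f : R) :
  is_derive x (1 : R) F f -> {for x, continuous F}.
Proof. by case=> dF _; apply: differentiable_continuous; exact/derivable1_diffP. Qed.

Section segment.
Variables (F f : R -> R) (a b : R).
Hypotheses (ab : a <= b) (dF : forall x, a <= x <= b -> is_derive x (1 : R) F (f x)).

Let dFoo : derivable_oo_LRcontinuous F a b.
Proof.
split.
- move=> x; rewrite in_itv/= => /andP[ax xb].
  by have [] := dF x; rewrite ?ltW.
- by apply: cvg_at_right_filter; apply: (@is_derive_continuous _ _ (f a)); apply: dF; rewrite lexx.
- by apply: cvg_at_left_filter; apply: (@is_derive_continuous _ _ (f b)); apply: dF; rewrite lexx andbT.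
Qed.

Let F'E x : a <= x <= b -> derive1 F x = f x.
Proof. by move=> axb; rewrite derive1E; apply: derive_val; exact: dF. Qed.

(** The derivative is assumed at the end points as well, which provides all one-sided limits; the
    degenerate segment a = b, allowed here, is treated apart. The two substitution rules below
    follow the same pattern. *)
Lemma is_derive_FTC2 : {within `[a, b], continuous f} ->
  (\int[mu]_(x in `[a, b]) (f x)%:E = (F b - F a)%:E)%E.
Proof.
move: ab; rewrite le_eqVlt => /predU1P[-> _|ltab cf].
  by rewrite set_itv1 integral_set1 subrr.
rewrite EFinB; apply: continuous_FTC2 => //.
by move=> x; rewrite in_itv/= => /andP[ax xb]; rewrite F'E// !ltW.
Qed.

Hypothesis cf : forall x, a <= x <= b -> {for x, continuous f}.
Variable G : R -> R.

Let near_F' x : a < x < b -> \forall y \near x, derive1 F y = f y.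
Proof.
move=> /andP[ax xb]; near=> y; apply: F'E; apply/andP; split; apply/ltW; near: y.
  exact: lt_nbhsr.
exact: lt_nbhsl.
Unshelve. all: by end_near. Qed.

Let cF' : {in `]a, b[, continuous (derive1 F)}.
Proof.
move=> x; rewrite in_itv/= => xab.
have := cf x; rewrite /prop_for /continuous_at/= => /(_ _) c.
have xab' : a <= x <= b by case/andP: xab => *; rewrite !ltW.
rewrite /continuous_at F'E//.
apply: cvg_trans (c _); last exact: xab'.
apply: near_eq_cvg; have := near_F' _ xab; apply: filterS => y; by move=> ->.
Qed.

Let cvgF'a : a < b -> cvg (derive1 F x @[x --> a^'+]).
Proof.
move=> ltab; apply/cvg_ex; exists (f a).
have : f x @[x --> a^'+] --> f a by apply: cvg_at_right_filter; apply: cf; rewrite lexx.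
apply: cvg_trans; apply: near_eq_cvg; near=> y; apply/esym/F'E; apply/andP; split; apply/ltW; near: y.
  exact: nbhs_right_gt.
exact: nbhs_right_lt.
Unshelve. all: by end_near. Qed.

Let cvgF'b : a < b -> cvg (derive1 F x @[x --> b^'-]).
Proof.
move=> ltab; apply/cvg_ex; exists (f b).
have : f x @[x --> b^'-] --> f b.
  by apply: cvg_at_left_filter; apply: cf; rewrite lexx andbT.
apply: cvg_trans; apply: near_eq_cvg; near=> y; apply/esym/F'E; apply/andP; split; apply/ltW; near: y.
  exact: nbhs_left_gt.
exact: nbhs_left_lt.
Unshelve. all: by end_near. Qed.

Lemma is_derive_substitution_increasing :
  {in `[a, b] &, {homo F : x y / x < y}} ->
  {within `[F a, F b], continuous G} ->
  (\int[mu]_(x in `[F a, F b]) (G x)%:E =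
   \int[mu]_(x in `[a, b]) (G (F x) * f x)%:E)%E.
Proof.
move=> iF cG; move: ab; rewrite le_eqVlt => /predU1P[->|ltab].
  by rewrite !set_itv1 !integral_set1.
rewrite (integration_by_substitution_increasing ab iF)//; [|exact: cvgF'a|exact: cvgF'b].
by apply: eq_integral => x; rewrite inE/= in_itv/= => xab; congr EFin; rewrite -[LHS]/(G (F x) * derive1 F x) F'E.
Qed.

Lemma is_derive_substitution_decreasing :
  {in `[a, b] &, {homo F : x y /~ x < y}} ->
  {within `[F b, F a], continuous G} ->
  (\int[mu]_(x in `[F b, F a]) (G x)%:E =
   \int[mu]_(x in `[a, b]) (G (F x) * - f x)%:E)%E.
Proof.
move=> iF cG; move: ab; rewrite le_eqVlt => /predU1P[->|ltab].
  by rewrite !set_itv1 !integral_set1.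
rewrite (integration_by_substitution_decreasing ab iF)//; [|exact: cvgF'a|exact: cvgF'b].
by apply: eq_integral => x; rewrite inE/= in_itv/= => xab; congr EFin; rewrite -[LHS]/(G (F x) * - derive1 F x) F'E.
Qed.
End segment.
End calculus.

(** * Area of a disc and radial integrals *)

Section disc.
Context {R : realType}.
Local Notation mu := (@lebesgue_measure R).
Local Notation mu2 := (mu \x mu)%E.

(** Length of the chord at abscissa x of the disc of squared radius v. Beyond the disc the radicand
    is negative and [Num.sqrt] returns 0, the right length. *)
Let G (v x : R) : R := 2 * Num.sqrt (v - x ^+ 2).

Let continuous_G v : continuous (G v).
Proof.
move=> x; apply: cvgM; first exact: cvg_cst.
have h : {for x, continuous (fun x : R => v - x ^+ 2)}.
  by apply: cvgB; [exact: cvg_cst|exact: exprn_continuous].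
exact: (continuous_comp h (@sqrt_continuous R _)).
Qed.

(** Substitution x = r sin(theta) with r^2 = v; the integrand becomes 2 v cos^2, with primitive v
    (theta + sin cos). *)
Let integral_G (v : R) : 0 < v -> (\int[mu]_x (G v x)%:E = (pi * v)%:E)%E.
Proof.
move=> v0; pose r : R := Num.sqrt v.
have r0 : 0 < r by rewrite sqrtr_gt0.
have r2 : r ^+ 2 = v by rewrite sqr_sqrtr// ltW.
have -> : (\int[mu]_x (G v x)%:E = \int[mu]_(x in `[(- r)%R, r]%classic) (G v x)%:E)%E.
  rewrite [RHS]integral_mkcond; apply: eq_integral => x _.
  rewrite patchE; case: ifPn => //; rewrite notin_setE/= in_itv/= -ler_norml => /negP.
  rewrite -ltNge => xr; rewrite /G ler0_sqrtr ?mulr0// subr_le0 -r2 -(real_normK (num_real x)).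
  by rewrite ler_sqr ?nnegrE ?(ltW r0) ?(ltW xr).
have pi2 : - (pi / 2) <= pi / 2 :> R by have := pi_gt0 R; lra.
have dF x : - (pi / 2) <= x <= pi / 2 ->
    is_derive x (1 : R) (fun x => r * sin x) (r * cos x).
  by move=> _; apply: is_derive_eq; rewrite /GRing.scale/=; ring.
have Fa : - r = r * sin (- (pi / 2)) by rewrite sinN sin_pihalf; ring.
have Fb : r = r * sin (pi / 2) by rewrite sin_pihalf mulr1.
rewrite {1}Fa {2}Fb.
rewrite (is_derive_substitution_increasing (fun x => r * sin x) (fun x => r * cos x))//.
- transitivity (\int[mu]_(x in `[(- (pi / 2))%R, (pi / 2)%R]%classic) (2 * v * cos x ^+ 2)%:E)%E.
    apply: eq_integral => x; rewrite inE/= in_itv/= => /cos_ge0_pihalf c0; congr EFin.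
    rewrite /G (_ : v - (r * sin x) ^+ 2 = (r * cos x) ^+ 2); last first.
      by rewrite !exprMn cos2sin2 -r2; ring.
    by rewrite sqrtr_sqr ger0_norm ?(mulr_ge0 (ltW r0))// -r2; ring.
  have dS x : - (pi / 2) <= x <= pi / 2 ->
      is_derive x (1 : R) (fun x => v * (x + sin x * cos x)) (2 * v * cos x ^+ 2).
    move=> _; apply: is_derive_eq; rewrite /GRing.scale/=.
    by have := cos2Dsin2 x => h; rewrite -[X in v * (X + _)]h; ring.
  rewrite (is_derive_FTC2 _ _ _ _ pi2 dS).
    by rewrite sinN cosN sin_pihalf cos_pihalf; congr EFin; field.
  apply: continuous_subspaceT => x; apply: cvgM; first exact: cvg_cst.
  exact: (continuous_comp (@continuous_cos R x) (@exprn_continuous R 2 _)).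
- by move=> x _; apply: cvgM; [exact: cvg_cst|exact: continuous_cos].
- move=> x y xab yab xy; rewrite ltr_pM2l// ltr_sin//.
- by apply: continuous_subspaceT => x; exact: continuous_G.
Qed.

Lemma area_disc (v : R) : 0 <= v ->
  area [set y : R * R | y.1 ^+ 2 + y.2 ^+ 2 < v] = (pi * v)%:E.
Proof.
move=> v0; rewrite /area /product_measure1/=.
transitivity (\int[mu]_x (G v x)%:E)%E.
  apply: eq_integral => x _.
  have -> : xsection [set y : R * R | y.1 ^+ 2 + y.2 ^+ 2 < v] x =
      if x ^+ 2 < v then `](- Num.sqrt (v - x ^+ 2)), Num.sqrt (v - x ^+ 2)[%classic else set0.
    apply/seteqP; split => y; rewrite /xsection/= inE/=.
      case: ifPn => [xv xyv|]; last by rewrite -leNgt; have := sqr_ge0 y; lra.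
      by rewrite /= in_itv/= -ltr_norml -sqrtr_sqr ltr_sqrt; lra.
    case: ifPn => // xv; rewrite /= in_itv/= -ltr_norml -sqrtr_sqr ltr_sqrt; lra.
  rewrite /G; case: ifPn => [xv|].
    rewrite lebesgue_measure_itv/= lte_fin; case: ltP => [_|]; first by rewrite -EFinB; congr EFin; ring.
    have := sqrtr_ge0 (v - x ^+ 2) => s0 s1.
    by have -> : Num.sqrt (v - x ^+ 2) = 0 by [lra]; rewrite mulr0.
  by rewrite -leNgt => vx; rewrite measure0 ler0_sqrtr ?mulr0//; lra.
move: v0; rewrite le_eqVlt => /predU1P[<-|]; last exact: integral_G.
rewrite mulr0; transitivity (\int[mu]_x (cst 0%E x))%E; last by rewrite integral0.
by apply: eq_integral => x _; congr EFin; rewrite /G ler0_sqrtr ?mulr0//; have := sqr_ge0 x; lra.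
Qed.

Let q (y : measurableTypeR R * measurableTypeR R) : R := y.1 ^+ 2 + y.2 ^+ 2.

Let mq : measurable_fun setT (q : _ -> measurableTypeR R).
Proof.
have h : measurable_fun setT q by apply: measurable_funD; apply: measurable_funX.
exact: h.
Qed.

Let mm : {measure set (measurableTypeR R * measurableTypeR R)%type -> \bar R} := mu2.

Let m1 : {measure set (measurableTypeR R) -> \bar R} :=
  @measure_function_pushforward__canonical__measure_function_Measure _ _ _ _ _ mm (q : _ -> measurableTypeR R) mq.

Let m0 : measurable (`[0, +oo[%classic : set (measurableTypeR R)).
Proof. exact: measurable_itv. Qed.

Let m2 : {measure set (measurableTypeR R) -> \bar R} :=
  mscale (NngNum (pi_ge0 R)) (mrestr mu m0).

Let mq_ray v : 0 <= v -> mm (q @^-1` `]-oo, v[%classic) = (pi * v)%:E.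
Proof.
move=> v0; have := area_disc _ v0; rewrite /area => <-; congr (mu2 _).
Qed.

(** The image of planar area under the squared norm is pi times Lebesgue measure on the half-line.
    Both measures agree on the rays ]-oo, x[, which form a generating pi-system: this is the area of
    a disc as a function of its squared radius. *)
Let m12 A : measurable A -> m1 A = m2 A.
Proof.
apply: (@measure_unique _ R (measurableTypeR R) (@RGenInftyO.G R)
  (fun n => `]-oo, n%:R[%classic) _ _ _ _ m1 m2).
- exact: RGenInftyO.measurableE.
- move=> _ _ [x ->] [y ->]; exists (Num.min x y).
  by apply/seteqP; split => z; rewrite /= !in_itv/= lt_min => /andP.
- by move=> n; exists n%:R.
- apply/seteqP; split => // x _; exists (Num.truncn `|x|).+1 => //=.
  by rewrite in_itv/= (le_lt_trans (ler_norm x))// truncnS_gt.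
- move=> _ [x ->]; rewrite /m1 /m2 /= /mscale/= /mrestr /pushforward/=.
  have [x0|x0] := leP 0 x.
    transitivity (pi * x)%:E; first exact: mq_ray.
    rewrite (_ : _ `&` _ = `[0, x[%classic); last first.
      by apply/seteqP; split => z; rewrite /= !in_itv/= andbT andbC => /andP.
    rewrite lebesgue_measure_itv/= lte_fin EFinM; congr (_ * _)%E.
    by move: x0; rewrite le_eqVlt => /predU1P[<-|->]; rewrite ?ltxx// -EFinB subr0.
  rewrite (_ : _ `&` _ = set0); last first.
    by apply/seteqP; split => z //=; rewrite !in_itv/= andbT => -[? ?]; lra.
  rewrite (_ : q @^-1` _ = set0) ?measure0 ?mule0//.
  apply/seteqP; split => z //=; rewrite /q in_itv/=.
  by have := sqr_ge0 z.1; have := sqr_ge0 z.2; lra.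
- move=> k; rewrite /m1 /= /pushforward.
  by rewrite mq_ray// ltry.
Qed.

Lemma ge0_integral_radial (f : R -> \bar R) : measurable_fun setT f ->
  (forall x, (0 <= f x)%E) ->
  (\int[mu2]_y f (y.1 ^+ 2 + y.2 ^+ 2)%R = pi%:E * \int[mu]_(x in `[0%R, +oo[) f x)%E.
Proof.
move=> mf f0.
pose D := `[0%R, +oo[%classic : set (measurableTypeR R).
have -> : (\int[mu2]_y f (y.1 ^+ 2 + y.2 ^+ 2)%R = \int[m1]_(x in D) f x)%E.
  rewrite (ge0_integral_pushforward mq mm m0).
  - rewrite (_ : _ @^-1` D = setT)//; apply/seteqP; split => // y _.
    by rewrite /preimage /D /= in_itv/= andbT /q addr_ge0 ?sqr_ge0.
  - exact: measurable_funTS.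
  - by move=> x _; exact: f0.
rewrite (eq_measure_integral (mscale (NngNum (pi_ge0 R)) mu)).
  rewrite ge0_integral_mscale//; exact: measurable_funTS.
move=> A mA AD; have /= -> := m12 _ mA.
by rewrite /mscale/= /mrestr setIidl.
Qed.

End disc.

(** * The substitution t = (r/|y|)^a outside a disc *)

Section power_substitution.
Context {R : realType}.
Local Notation mu := (@lebesgue_measure R).
Local Notation mu2 := (mu \x mu)%E.

Lemma continuous_powR_gt0 (p t : R) : 0 < t -> {for t, continuous (fun t => t `^ p)}.
Proof. by move=> /(is_derive1_powR p)/is_derive_continuous. Qed.

Lemma bigcup_itv_invS :
  \bigcup_n `[(n.+1%:R^-1 : R), 1]%classic = `]0, 1]%classic.
Proof.
apply/seteqP; split => [t [n _]|t]; rewrite /= !in_itv/= => /andP[t0 t1].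
  by rewrite t1 (lt_le_trans _ t0)// invr_gt0.
exists (Num.truncn t^-1) => //=; rewrite in_itv/= t1 andbT.
by rewrite invf_ple ?posrE// ltW// truncnS_gt.
Qed.

Section radial.
Variables (F : R -> R) (r a : R).
Hypotheses (r0 : 0 < r) (a0 : 0 < a).
Hypotheses (cF : forall t, 0 < t -> {for t, continuous F}) (F0 : forall t, 0 < t -> 0 <= F t).
Hypothesis (mF : measurable_fun setT F).
Let dl := 2 / a.
Let dl0 : 0 < dl. Proof. by rewrite divr_gt0. Qed.
(** Squared distance as a function of t = (r/|y|)^a. It decreases from +oo at t = 0 to r^2 at t = 1,
    and [G] below is [F] read in the squared distance. *)
Let u t := r ^+ 2 * t `^ (- dl).
Let G v := F (r `^ a * v `^ (- (a / 2))).
Let e n : R := n.+1%:R^-1.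
Let e0 n : 0 < e n. Proof. by rewrite invr_gt0. Qed.
Let e1 n : e n <= 1. Proof. by rewrite invf_le1// ler1n. Qed.

Let u0 t : 0 < t -> 0 < u t.
Proof. by move=> t0; rewrite mulr_gt0 ?exprn_gt0 ?powR_gt0. Qed.

Let Gu t : 0 < t -> G (u t) = F t.
Proof.
move=> t0; rewrite /G /u; congr F.
rewrite powRM ?exprn_ge0 ?powR_ge0 ?ltW// -powR_mulrn ?ltW// -!powRrM mulrA -powRD; last first.
  by rewrite (gt_eqF r0) implybT.
rewrite (_ : a + 2 * - (a / 2) = 0); last by field.
rewrite (_ : - dl * - (a / 2) = 1); last by rewrite /dl; field; rewrite gt_eqF.
by rewrite powRr0 mul1r powRr1// ltW.
Qed.

Let decu x y : 0 < x -> x < y -> u y < u x.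
Proof.
move=> x0 xy; rewrite /u ltr_pM2l ?exprn_gt0// !powRN ltf_pV2 ?posrE ?powR_gt0//.
  by apply: gt0_ltr_powR; rewrite ?nnegrE// ltW// (lt_trans x0).
by rewrite (lt_trans x0).
Qed.

Let step n : (\int[mu]_(v in `[(r ^+ 2)%R, u (e n)]) (G v)%:E =
  \int[mu]_(t in `[e n, 1%R]) (F t * (r ^+ 2 * dl * t `^ (- dl - 1)))%:E)%E.
Proof.
have u1 : u 1 = r ^+ 2 by rewrite /u powR1 mulr1.
rewrite -u1.
have dU t : e n <= t <= 1 -> is_derive t (1 : R) u (r ^+ 2 * (- dl * t `^ (- dl - 1))).
  move=> /andP[t0 _]; have H := is_derive1_powR (- dl) (lt_le_trans (e0 n) t0).
  by apply: is_derive_eq; rewrite /GRing.scale/=; ring.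
rewrite (is_derive_substitution_decreasing _ _ _ _ (e1 n) dU)//.
- apply: eq_integral => t; rewrite inE/= in_itv/= => /andP[t0 _].
  by rewrite Gu ?(lt_le_trans (e0 n))//; congr EFin; rewrite u1; ring.
- move=> t /andP[t0 _]; apply: cvgM; first exact: cvg_cst.
  apply: cvgM; first exact: cvg_cst.
  exact: (continuous_powR_gt0 _ _ (lt_le_trans (e0 n) t0)).
- move=> x y; rewrite !in_itv/= => /andP[x0 _] /andP[y0 _] xy.
  by apply: decu => //; exact: lt_le_trans (e0 n) y0.
- apply/continuous_in_subspaceT => v; rewrite inE/= in_itv/= => /andP[v0 _].
  have {}v0 : 0 < v by rewrite (lt_le_trans _ v0)// u0.
  have h : {for v, continuous (fun v => r `^ a * v `^ (- (a / 2)))}.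
    apply: cvgM; first exact: cvg_cst.
    exact: continuous_powR_gt0.
  apply: (continuous_comp h); apply: cF.
  by rewrite mulr_gt0// powR_gt0.
Qed.

Let mG : measurable_fun setT G.
Proof. by apply: (measurableT_comp mF); apply: measurable_funM. Qed.

Let G0 v : 0 < v -> 0 <= G v.
Proof. by move=> v0; apply: F0; rewrite mulr_gt0// powR_gt0. Qed.

Let e_dec m n : (m <= n)%N -> e n <= e m.
Proof. by move=> mn; rewrite /e lef_pV2 ?posrE// ler_nat. Qed.

(** The substitution is carried out on the segments [1/(n+1), 1], where everything is continuous;
    both sides are then monotone limits, all integrands being nonnegative. *)
Let integral_u : (\int[mu]_(v in `](r ^+ 2)%R, +oo[) (G v)%:E =
  \int[mu]_(t in `]0%R, 1%R[) (F t * (r ^+ 2 * dl * t `^ (- dl - 1)))%:E)%E.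
Proof.
have mGE (D : set R) : measurable_fun D (EFin \o G).
  by apply: measurable_funTS; exact/measurable_EFinP.
pose H t := F t * (r ^+ 2 * dl * t `^ (- dl - 1)).
have mHE (D : set R) : measurable_fun D (EFin \o H).
  by apply: measurable_funTS; apply/measurable_EFinP; apply: measurable_funM => //; apply: measurable_funM.
rewrite integral_itv_obnd_cbnd//.
rewrite integral_itv_bndo_bndc//.
have cu : (\int[mu]_(v in `[(r ^+ 2)%R, u (e n)]) (G v)%:E)%E @[n --> \oo] -->
    (\int[mu]_(v in `[(r ^+ 2)%R, +oo[) (G v)%:E)%E.
  have -> : `[(r ^+ 2)%R, +oo[%classic = \bigcup_n `[(r ^+ 2)%R, u (e n)]%classic.
    apply/seteqP; split => [v|v [n _]]; rewrite /= !in_itv/=; last by case/andP => ->.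
    rewrite andbT => rv.
    have v0 : 0 < v by rewrite (lt_le_trans _ rv)// exprn_gt0.
    (* [s] is the parameter of v, that is u(s) = v; v lies in the n-th segment once 1/(n+1) < s. *)
    pose s := r `^ a * v `^ (- (a / 2)).
    have s0 : 0 < s by rewrite mulr_gt0// powR_gt0.
    have us : u s = v.
      rewrite /u /s powRM ?powR_ge0// -!powRrM.
      rewrite (_ : a * - dl = - 2%:R); last by rewrite /dl; field; rewrite gt_eqF.
      rewrite (_ : - (a / 2) * - dl = 1); last by rewrite /dl; field; rewrite gt_eqF.
      rewrite powRr1 ?(ltW v0)// powR_invn ?(ltW r0)// mulrA divff ?mul1r//.
      by rewrite expf_neq0// gt_eqF.
    exists (Num.truncn s^-1) => //=; rewrite in_itv/= rv/=.
    have : e (Num.truncn s^-1) < s by rewrite /e invf_plt ?posrE// truncnS_gt.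
    by move=> /(decu _ _ (e0 _)) /ltW; rewrite us.
  apply: ge0_nondecreasing_set_cvg_integral => //.
  - move=> m n mn; rewrite subsetEset => v; rewrite /= !in_itv/= => /andP[-> vm] /=.
    apply: le_trans vm _; have : (e n == e m) || (e n < e m) by rewrite -le_eqVlt e_dec.
    case/orP=> [/eqP ->//|enm].
    by rewrite ltW// decu.
  - by move=> n; exact: mGE.
  - move=> n v; rewrite /= in_itv/= lee_fin => /andP[rv _]; apply: G0.
    by rewrite (lt_le_trans _ rv)// exprn_gt0.
have ct : (\int[mu]_(v in `[e n, 1%R]) (H v)%:E)%E @[n --> \oo] -->
    (\int[mu]_(v in `]0%R, 1%R]) (H v)%:E)%E.
  rewrite -bigcup_itv_invS; apply: ge0_nondecreasing_set_cvg_integral => //.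
  - move=> m n mn; rewrite subsetEset => v; rewrite /= !in_itv/= => /andP[vm ->].
    by rewrite andbT; apply: le_trans vm; exact: e_dec.
  - by move=> n; exact: mHE.
  - move=> n v; rewrite /= in_itv/= lee_fin => /andP[v0 _].
    have {}v0 := lt_le_trans (e0 n) v0.
    apply: mulr_ge0; first exact: F0.
    by apply: mulr_ge0; [apply: mulr_ge0; [exact: sqr_ge0|exact: ltW]|exact: powR_ge0].
have E : (fun n => \int[mu]_(v in `[(r ^+ 2)%R, u (e n)]) (G v)%:E)%E =
    (fun n => \int[mu]_(v in `[e n, 1%R]) (H v)%:E)%E by apply/funext => n; exact: step.
by rewrite -(cvg_lim _ cu)// E (cvg_lim _ ct).
Qed.

(** Polar coordinates in the squared norm, followed by |y|^2 = r^2 t^(-dl), whose differential has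
    absolute value r^2 dl t^(-dl-1) dt. *)
Lemma integral_radial_power :
  (\int[mu2]_y (if r < norm2 y then F (r `^ a * norm2 y `^ (- a)) else 0)%:E =
   (pi * r ^+ 2)%:E * \int[mu]_(t in `]0%R, 1%R[) (dl * F t * t `^ (- dl - 1))%:E)%E.
Proof.
pose f v : \bar R := (if r ^+ 2 < v then G v else 0)%:E.
transitivity (\int[mu2]_y f (y.1 ^+ 2 + y.2 ^+ 2)%R)%E.
  apply: eq_integral => y _; rewrite /f /G; congr EFin.
  have q0 : 0 <= y.1 ^+ 2 + y.2 ^+ 2 by rewrite addr_ge0 ?sqr_ge0.
  have -> : (r < norm2 y) = (r ^+ 2 < y.1 ^+ 2 + y.2 ^+ 2).
    by rewrite -[in RHS](sqr_sqrtr q0) ltr_sqr ?nnegrE ?sqrtr_ge0 ?ltW.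
  by case: ifP => // _; rewrite /norm2 -powR12_sqrt// -powRrM; congr (F (_ * _ `^ _)); field.
rewrite ge0_integral_radial//; last 2 first.
- apply/measurable_EFinP; apply: measurable_fun_ifT => //.
  exact: measurable_fun_ltr.
- move=> v; rewrite lee_fin; case: ifP => // rv; apply: G0.
  by rewrite (lt_trans _ rv)// exprn_gt0.
rewrite EFinM -muleA; congr (_ * _)%E.
transitivity (\int[mu]_(v in `](r ^+ 2)%R, +oo[) (G v)%:E)%E.
  rewrite integral_mkcond [RHS]integral_mkcond; apply: eq_integral => v _.
  rewrite !patchE !mem_setE !in_itv/= !andbT /f.
  case: (ltP (r ^+ 2) v) => rv; last by case: ifP.
  by have -> : 0 <= v by rewrite (le_trans _ (ltW rv)) ?sqr_ge0.
rewrite integral_u -ge0_integralZl_EFin ?sqr_ge0//.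
- apply: eq_integral => t _; rewrite -EFinM; congr EFin; ring.
- move=> t; rewrite /= in_itv/= => /andP[t0 _].
  rewrite lee_fin; apply: mulr_ge0; last exact: powR_ge0.
  by apply: mulr_ge0; [exact: ltW|exact: F0].
- apply/measurable_EFinP; apply: measurable_funTS; apply: measurable_funM => //.
  exact: measurable_funM.
Qed.
End radial.
End power_substitution.

(** * Special functions *)

Section exponential_bounds.
Context {R : realType}.

Lemma exp_coeff_le_expR (x : R) n : 0 <= x -> x ^+ n / n`!%:R <= expR x.
Proof.
move=> x0; have c0 i : 0 <= exp_coeff x i by exact: exp_coeff_ge0.
apply: (@le_trans _ _ (series (exp_coeff x) n.+1)).
  by rewrite /series/= big_nat_recr//= lerDr sumr_ge0.
apply: nondecreasing_cvgn_le; last exact: is_cvg_series_exp_coeff.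
by apply/nondecreasing_seqP => i; rewrite /series/= big_nat_recr//= lerDl.
Qed.

(** The difference is the tail of the exponential series from rank M on; as t <= 1, a factor t^M
    comes out of each of its terms, and the tail that remains is at most e^z. *)
Lemma expR_taylor_bound (t z : R) M : 0 <= t <= 1 -> 0 <= z ->
  0 <= expR (t * z) - \sum_(m < M) (t * z) ^+ m / m`!%:R <= t ^+ M * expR z.
Proof.
move=> /andP[t0 t1] z0.
pose S (x : R) N := \sum_(M <= m < N) x ^+ m / m`!%:R.
have tz0 : 0 <= t * z by rewrite mulr_ge0.
have cS x : S x N @[N --> \oo] --> expR x - \sum_(m < M) x ^+ m / m`!%:R.
  have : (fun N => series (exp_coeff x) N - \sum_(m < M) x ^+ m / m`!%:R) @ \oo -->
      expR x - \sum_(m < M) x ^+ m / m`!%:R.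
    by apply: cvgB; [exact: is_cvg_series_exp_coeff|exact: cvg_cst].
  apply: cvg_trans; apply: near_eq_cvg; near=> N.
  rewrite /series/= /S (@big_cat_nat _ _ _ M 0%N N)//=; last by near: N; exact: nbhs_infty_ge.
  rewrite big_mkord [X in X - _]addrC; exact: addrK.
have S0 x N : 0 <= x -> 0 <= S x N.
  by move=> x0; apply: sumr_ge0 => m _; exact: exp_coeff_ge0.
have /cvg_lim <- // := cS (t * z); have cStz : cvgn (S (t * z)).
  by apply/cvg_ex; eexists; exact: cS.
apply/andP; split.
  by apply: limr_ge => //; apply: nearW => N; exact: S0.
apply: (@le_trans _ _ (limn (fun N => t ^+ M * S z N))); last first.
  have /cvg_lim -> // : t ^+ M * S z N @[N --> \oo] -->
     t ^+ M * (expR z - \sum_(m < M) z ^+ m / m`!%:R) by apply: cvgMr; exact: cS.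
  apply: ler_wpM2l; first exact: exprn_ge0.
  by rewrite gerBl sumr_ge0// => m _; exact: exp_coeff_ge0.
apply: ler_lim => //.
  by apply/cvg_ex; eexists; apply: cvgMr; exact: cS.
apply: nearW => N; rewrite /S mulr_sumr; apply: ler_sum_nat => m /andP[Mm _].
rewrite exprMn -mulrA ler_wpM2r ?exp_coeff_ge0//.
by apply: ler_wiXn2l.
Unshelve. all: by end_near. Qed.

End exponential_bounds.

(** * The Gamma function: functional equation, positivity, value at 1 *)

Section gamma_function.
Context {R : realType}.
Local Notation mu := (@lebesgue_measure R).

Let b n : R := n.+1%:R.
Let e n : R := n.+1%:R^-1.
Let b0 n : 0 < b n. Proof. by rewrite ltr0n. Qed.
Let e0 n : 0 < e n. Proof. by rewrite invr_gt0. Qed.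
Let e1 n : e n <= 1. Proof. by rewrite invf_le1// ler1n. Qed.
Let b1 n : 1 <= b n. Proof. by rewrite ler1n. Qed.
Let eb n : e n <= b n. Proof. exact: le_trans (e1 n) (b1 n). Qed.

Let cvg_e_at_right : e n @[n --> \oo] --> 0^'+.
Proof.
move=> A [eps /= eps0 HA].
have := @cvg_harmonic R => /cvgrPdist_lt/(_ _ eps0); apply: filterS => n en.
by apply: HA => //=; exact: e0.
Qed.

Let cvg_e_powR (s : R) : 0 < s -> e n `^ s @[n --> \oo] --> 0.
Proof. move=> s0; exact: (cvg_comp _ _ cvg_e_at_right (powR_cvg0 s0)). Qed.

Lemma integral_powR_lt_pinfty (s : R) : 0 < s ->
  (\int[mu]_(t in `]0%R, 1%R]) (t `^ (s - 1))%:E < +oo)%E.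
Proof.
move=> s0; apply: (@le_lt_trans _ _ (s^-1)%:E); last exact: ltry.
have mp (D : set R) : measurable_fun D (fun t => (t `^ (s - 1))%:E).
  by apply: measurable_funTS; apply/measurable_EFinP.
have c : (\int[mu]_(t in `[e n, 1%R]) (t `^ (s - 1))%:E)%E @[n --> \oo] -->
    (\int[mu]_(t in `]0%R, 1%R]) (t `^ (s - 1))%:E)%E.
  rewrite -bigcup_itv_invS; apply: ge0_nondecreasing_set_cvg_integral => //.
  - move=> m n mn; rewrite subsetEset => v; rewrite /= !in_itv/= => /andP[vm ->].
    by rewrite andbT; apply: le_trans vm; rewrite lef_pV2 ?posrE// ler_nat.
  - by move=> n; exact: mp.
  - by move=> n t _; rewrite lee_fin powR_ge0.
have /cvg_lim <- // := c; apply: lime_le; first by apply/cvg_ex; eexists; exact: c.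
apply: nearW => n.
have dF t : e n <= t <= 1 -> is_derive t (1 : R) (fun t => s^-1 * t `^ s) (t `^ (s - 1)).
  move=> /andP[t0 _]; have H := is_derive1_powR s (lt_le_trans (e0 n) t0).
  by apply: is_derive_eq; rewrite /GRing.scale/=; field; rewrite gt_eqF.
rewrite (is_derive_FTC2 _ _ _ _ (e1 n) dF); last first.
  apply/continuous_in_subspaceT => t; rewrite inE/= in_itv/= => /andP[t0 _].
  exact: (continuous_powR_gt0 _ _ (lt_le_trans (e0 n) t0)).
by rewrite lee_fin powR1 mulr1 gerBl mulr_ge0 ?powR_ge0 ?invr_ge0 ?ltW.
Qed.

Let g (s t : R) := t `^ (s - 1) * expR (- t).

Let g0 s t : 0 <= g s t.
Proof. by rewrite mulr_ge0 ?powR_ge0 ?expR_ge0. Qed.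

Let mg s : measurable_fun setT (g s).
Proof. by apply: measurable_funM => //; apply: measurableT_comp. Qed.

Let mgE s (D : set R) : measurable_fun D (EFin \o g s).
Proof. by apply: measurable_funTS; exact/measurable_EFinP. Qed.

Let Gam s := (\int[mu]_(t in `]0%R, +oo[) (g s t)%:E)%E.

(** Half of the exponential absorbs the power: t^p <= t^N <= 2^N N! e^(t/2) for an integer N >= |p|,
    by keeping only the N-th term of the series of e^(t/2). *)
Let powR_expR_bound (p : R) : exists2 C : R, 0 <= C & forall t, 1 <= t -> t `^ p * expR (- t) <= C * expR (- (2^-1 * t)).
Proof.
pose N := (Num.truncn `|p|).+1.
exists (2 ^+ N * N`!%:R) => [|t t1]; first by rewrite mulr_ge0 ?exprn_ge0.
have t0 : 0 <= t by rewrite (le_trans ler01).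
have tp : t `^ p <= t ^+ N.
  rewrite -powR_mulrn//; apply: ler_powR => //.
  by rewrite (le_trans (ler_norm p))// ltW// truncnS_gt.
have := @exp_coeff_le_expR R (2^-1 * t) N; rewrite mulr_ge0// => /(_ isT).
rewrite ler_pdivrMr ?ltr0n ?fact_gt0// exprMn exprVn => H.
have tN : t ^+ N <= 2 ^+ N * N`!%:R * expR (2^-1 * t).
  have := ler_wpM2l (exprn_ge0 N (ler0n R 2)) H.
  rewrite mulrA divff ?expf_neq0// mul1r => /le_trans; apply.
  by rewrite le_eqVlt; apply/orP; left; apply/eqP; ring.
have -> : expR (- t) = expR (- (2^-1 * t)) * expR (- (2^-1 * t)).
  by rewrite -expRD; congr expR; field.
rewrite mulrA ler_wpM2r ?expR_ge0// [X in _ * X]expRN.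
rewrite ler_pdivrMr ?expR_gt0//; exact: le_trans tp tN.
Qed.

(** Near 0 the integrand is dominated by t^(s-1), and beyond 1 by a multiple of an exponential
    density. *)
Let Gam_lty (s : R) : 0 < s -> (Gam s < +oo)%E.
Proof.
move=> s0; have [C C0 HC] := powR_expR_bound (s - 1).
have E : `]0%R, +oo[%classic = `]0%R, 1%R] `|` `]1%R, +oo[%classic :> set R.
  apply/seteqP; split => t; rewrite /= !in_itv/= ?andbT.
    by move=> ->; case: (leP t 1) => ?; [left|right].
  by move=> [/andP[]//|]; exact: lt_trans ltr01.
rewrite /Gam E ge0_integral_setU//; last 3 first.
- exact: mgE.
- by move=> t _; rewrite lee_fin.
- rewrite disj_set2E; apply/eqP/seteqP; split => // t /=; rewrite !in_itv/= andbT.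
  by move=> [/andP[_ t1]]; rewrite ltNge t1.
rewrite lte_add_pinfty//.
  apply: le_lt_trans (integral_powR_lt_pinfty _ s0).
  apply: ge0_le_integral => //.
  - by move=> t _; rewrite lee_fin.
  - exact: mgE.
  - by apply: measurable_funTS; apply/measurable_EFinP.
  - move=> t; rewrite /= in_itv/= => /andP[t0 _]; rewrite lee_fin ler_piMr ?powR_ge0//.
    by rewrite -expR0 ler_expR oppr_le0 ltW.
have half0 : 0 < 2^-1 :> R by rewrite invr_gt0.
have mpdf : measurable_fun setT (exponential_pdf (2^-1 : R)) by exact: measurable_exponential_pdf.
(* The factor 2 compensates the normalisation 1/2 of the exponential density of rate 1/2. *)
apply: (@le_lt_trans _ _ (\int[mu]_x ((2 * C)%:E * (exponential_pdf 2^-1 x)%:E))%E).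
  rewrite integral_mkcond; apply: ge0_le_integral => //.
  - by move=> t _; rewrite patchE; case: ifP => // _; rewrite /= lee_fin.
  - apply/(measurable_restrictT _ _).1 => //; exact: mgE.
  - by apply/measurable_EFinP; apply: measurable_funM.
  - move=> t _; rewrite patchE mem_setE in_itv/= andbT -EFinM; case: ifPn => [t1|_].
      rewrite lee_fin exponential_pdfE; last by rewrite (le_trans ler01)// ltW.
      by apply: le_trans (HC _ (ltW t1)) _; rewrite mulNr; have := expR_ge0 (- (2^-1 * t)); nra.
    by rewrite lee_fin mulr_ge0 ?(mulr_ge0 _ C0)// exponential_pdf_ge0// ltW.
rewrite ge0_integralZl_EFin//; last 3 first.
- by move=> t _; rewrite lee_fin exponential_pdf_ge0// ltW.
- exact/measurable_EFinP.
- exact: mulr_ge0.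
by rewrite integral_exponential_pdf// mule1 ltry.
Qed.

Let bigcup_eb : \bigcup_n `[e n, b n]%classic = `]0, +oo[%classic.
Proof.
apply/seteqP; split => [t [n _]|t]; rewrite /= !in_itv/= ?andbT.
  by move=> /andP[t0 t1]; rewrite (lt_le_trans (e0 n) t0).
move=> t0; exists (maxn (Num.truncn t^-1) (Num.truncn t)) => //=; rewrite in_itv/=.
rewrite /e /b invf_ple ?posrE//; apply/andP; split; apply/ltW.
  by apply: lt_le_trans (truncnS_gt _) _; rewrite ler_nat ltnS leq_maxl.
by apply: lt_le_trans (truncnS_gt _) _; rewrite ler_nat ltnS leq_maxr.
Qed.

Let cvg_Gam s : 0 < s ->
  Rintegral mu `[e n, b n]%classic (g s) @[n --> \oo] --> Gammaf s.
Proof.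
move=> s0; apply: (@fine_cvg _ _ _ _ (fun n => \int[mu]_(t in `[e n, b n]) (g s t)%:E)%E).
rewrite fineK; last first.
  by rewrite ge0_fin_numE ?Gam_lty//; apply: integral_ge0 => t _; rewrite lee_fin; exact: g0.
rewrite -bigcup_eb; apply: ge0_nondecreasing_set_cvg_integral => //.
- move=> m n mn; rewrite subsetEset => v; rewrite /= !in_itv/= => /andP[vm vM].
  rewrite (le_trans _ vm) ?(le_trans vM)//; first by rewrite /b ler_nat.
  by rewrite lef_pV2 ?posrE// ler_nat.
- by move=> n; exact: mgE.
- by move=> n t _; rewrite lee_fin.
Qed.

Let continuous_g s t : 0 < t -> {for t, continuous (g s)}.
Proof.
move=> t0; apply: cvgM; first exact: continuous_powR_gt0.
apply: (continuous_comp (g := expR) (f := -%R)); last exact: continuous_expR.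
exact: oppr_continuous.
Qed.

Let integrable_g s n : mu.-integrable `[e n, b n] (EFin \o g s).
Proof.
apply: continuous_compact_integrable; first exact: segment_compact.
apply/continuous_in_subspaceT => t; rewrite inE/= in_itv/= => /andP[t0 _].
by apply: continuous_g; exact: lt_le_trans (e0 n) t0.
Qed.

(** Integration by parts on [1/(n+1), n+1]; the boundary terms vanish in the limit, through the
    exponential at the upper end and through t^s, s > 0, at the lower one. *)
Lemma Gammaf_rec (s : R) : 0 < s -> Gammaf (s + 1) = s * Gammaf s.
Proof.
move=> s0; pose F t := - (t `^ s * expR (- t)).
have step n : Rintegral mu `[e n, b n]%classic (g (s + 1)) =
    s * Rintegral mu `[e n, b n]%classic (g s) + (F (b n) - F (e n)).
  have dF t : e n <= t <= b n -> is_derive t (1 : R) F (g (s + 1) t - s * g s t).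
    move=> /andP[t0 _]; have H := is_derive1_powR s (lt_le_trans (e0 n) t0).
    apply: is_derive_eq; rewrite /GRing.scale/= /g addrK; ring.
  have cgs s' t : e n <= t -> {for t, continuous (g s')}.
    by move=> t0; apply: continuous_g; exact: lt_le_trans (e0 n) t0.
  have I : Rintegral mu `[e n, b n]%classic (fun t => g (s + 1) t - s * g s t) = F (b n) - F (e n).
    rewrite /Rintegral (is_derive_FTC2 _ _ _ _ (eb n) dF)//.
    apply/continuous_in_subspaceT => t; rewrite inE/= in_itv/= => /andP[t0 _].
    apply: cvgB; first exact: cgs.
    by apply: cvgMr; exact: cgs.
  rewrite -I RintegralB//; last first.
    exact: (@integrableZl _ _ _ mu _ (measurable_itv _) s _ (integrable_g s n)).
  by rewrite RintegralZl//; ring.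
have cF : F (b n) - F (e n) @[n --> \oo] --> 0.
  have ch := @cvg_harmonic R.
  rewrite -[X in _ --> X](subrr 0); apply: cvgB.
    have [C C0 HC] := powR_expR_bound s.
    rewrite -oppr0; apply: cvgN.
    (* From e^x >= x at x = (n+1)/2, one gets C e^(-(n+1)/2) <= 2C/(n+1). *)
    apply: (@squeeze_cvgr _ _ _ _ (cst 0) (fun n => (2 * C) * harmonic n)).
    - apply: nearW => n; rewrite mulr_ge0 ?powR_ge0 ?expR_ge0//=.
      apply: le_trans (HC _ (b1 n)) _; rewrite (mulrC 2) -mulrA ler_wpM2l// expRN.
      have H : 2^-1 * b n <= expR (2^-1 * b n).
        by apply: le_trans (expR_ge1Dx _); rewrite lerDr.
      have -> : 2 * harmonic n = (2^-1 * b n)^-1 by rewrite invfM invrK.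
      by rewrite lef_pV2 ?posrE ?expR_gt0 ?mulr_gt0.
    - exact: cvg_cst.
    - by rewrite -[X in _ --> X](mulr0 (2 * C)); apply: cvgMr.
  rewrite -oppr0; apply: cvgN.
  apply: (@squeeze_cvgr _ _ _ _ (cst 0) (fun n => e n `^ s)).
  - apply: nearW => n; rewrite mulr_ge0 ?powR_ge0 ?expR_ge0//=.
    by rewrite ler_piMr ?powR_ge0// -expR0 ler_expR oppr_le0 ltW.
  - exact: cvg_cst.
  - exact: cvg_e_powR.
have c1 := cvg_Gam _ (addr_gt0 s0 ltr01).
have c2 : s * Rintegral mu `[e n, b n]%classic (g s) + (F (b n) - F (e n))
    @[n --> \oo] --> s * Gammaf s.
  rewrite -[X in _ --> X]addr0; apply: cvgD => //.
  by apply: cvgMr; exact: cvg_Gam.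
have E : (fun n => Rintegral mu `[e n, b n]%classic (g (s + 1))) =
  (fun n => s * Rintegral mu `[e n, b n]%classic (g s) + (F (b n) - F (e n))).
  exact/funext.
by rewrite -(cvg_lim _ c1)// E (cvg_lim _ c2).
Qed.

(** On [1/2, 1] the integrand is at least t^(s-1)/e, whose integral is explicit and positive. *)
Lemma Gammaf_gt0 (s : R) : 0 < s -> 0 < Gammaf s.
Proof.
move=> s0; have h1 : (2^-1 : R) <= 1 by lra.
have h0 : 0 < (2^-1 : R) by lra.
have dF (t : R) : 2^-1 <= t <= 1 -> is_derive t (1 : R) (fun t => s^-1 * t `^ s) (t `^ (s - 1)).
  move=> /andP[t0 _]; have H := is_derive1_powR s (lt_le_trans h0 t0).
  by apply: is_derive_eq; rewrite /GRing.scale/=; field; rewrite gt_eqF.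
have I := is_derive_FTC2 _ _ _ _ h1 dF.
have {}I : (\int[mu]_(t in `[(2^-1)%R, 1%R]) (t `^ (s - 1))%:E = (s^-1 * (1 - 2^-1 `^ s))%:E)%E.
  rewrite I ?powR1; first by congr EFin; ring.
  apply/continuous_in_subspaceT => t; rewrite inE/= in_itv/= => /andP[t0 _].
  exact: (continuous_powR_gt0 _ _ (lt_le_trans h0 t0)).
have pos : 0 < expR (-1) * (s^-1 * (1 - 2^-1 `^ s)).
  rewrite mulr_gt0 ?expR_gt0// mulr_gt0 ?invr_gt0// subr_gt0.
  have l0 : ln (2^-1 : R) < 0 by apply: ln_lt0; lra.
  by rewrite /powR gt_eqF// -[X in _ < X]expR0 ltr_expR nmulr_llt0.
rewrite /Gammaf /Rintegral -lte_fin fineK; last first.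
  by rewrite ge0_fin_numE ?Gam_lty//; apply: integral_ge0 => t _; rewrite lee_fin; exact: g0.
apply: (@lt_le_trans _ _ (expR (-1) * (s^-1 * (1 - 2^-1 `^ s)))%:E); first by rewrite lte_fin.
rewrite EFinM -I -ge0_integralZl_EFin ?expR_ge0//; last 2 first.
- by move=> t _; rewrite lee_fin powR_ge0.
- by apply: measurable_funTS; apply/measurable_EFinP.
apply: (@le_trans _ _ (\int[mu]_(t in `[(2^-1)%R, 1%R]) (g s t)%:E)%E).
  apply: ge0_le_integral => //.
  - by move=> t _; rewrite lee_fin mulr_ge0 ?powR_ge0 ?expR_ge0.
  - by apply: measurable_funTS; apply/measurable_EFinP; apply: measurable_funM.
  - exact: mgE.
  - move=> t; rewrite /= in_itv/= => /andP[_ t1]; rewrite lee_fin mulrC ler_wpM2l ?powR_ge0//.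
    by rewrite ler_expR lerN2.
apply: ge0_subset_integral => //.
- exact: mgE.
- by move=> t _; rewrite lee_fin g0.
- by move=> t /=; rewrite !in_itv/= => /andP[t0 _]; rewrite andbT (lt_le_trans h0).
Qed.

Lemma Gammaf1 : Gammaf 1 = 1 :> R.
Proof.
have -> : Gammaf 1 = Rintegral mu `]0, +oo[%classic (exponential_pdf (1 : R)).
  apply: eq_Rintegral => t; rewrite mem_setE in_itv andbT => t0.
  rewrite -[RHS]/(exponential_pdf 1 t) exponential_pdfE ?ltW//.
  by rewrite subrr powRr0 mulN1r !mul1r.
rewrite /Rintegral integral_itv_obnd_cbnd; last first.
  apply: measurable_funTS; apply/measurable_EFinP; exact: measurable_exponential_pdf.
suff -> : (\int[mu]_(x in `[0%R, +oo[) (exponential_pdf 1 x)%:E = 1)%E by [].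
rewrite -[RHS](@integral_exponential_pdf R 1)// integral_mkcond; apply: eq_integral => t _.
rewrite patchE mem_setE in_itv/= andbT; case: ifPn => //.
by rewrite -ltNge => t0; rewrite lt0_exponential_pdf.
Qed.

End gamma_function.

(** * Euler integrals and the weight t^(-dl-1) on ]0, 1[ *)

Section hypergeometric.
Context {R : realType}.
Local Notation mu := (@lebesgue_measure R).
Local Notation I01 := (`]0, 1[%classic : set R).

(** All the functions 2F1 of the formula have c = b + 1. Then the factor (1 - t) of Euler's integral
    has exponent 0, and the Gamma quotient in front reduces to b. *)
Lemma hyp2F1_succ (a b z : R) : 0 < b ->
  hyp2F1 a b (b + 1) z =
  b * Rintegral mu I01 (fun t => t `^ (b - 1) * (1 - z * t) `^ (- a)).
Proof.
move=> b0; rewrite /hyp2F1 Gammaf_rec// (_ : b + 1 - b = 1); last by ring.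
rewrite Gammaf1 mulr1 mulfK ?gt_eqF ?Gammaf_gt0//; congr (_ * _).
by apply: eq_Rintegral => t _; rewrite subrr powRr0 mulr1.
Qed.

(** The inverse is the measurable power of exponent -1 on nonnegative reals, with the same value 0
    at 0, and is extended by oddness. *)
Lemma measurable_inv : measurable_fun setT (fun x : R => x^-1).
Proof.
have -> : (fun x : R => x^-1) = (fun x => if 0 <= x then x `^ (-1) else - ((- x) `^ (-1))).
  apply/funext => x; case: leP => x0; first by rewrite powR_inv1.
  by rewrite powR_inv1 ?invrN ?opprK// oppr_ge0 ltW.
apply: measurable_fun_ifT => //; first exact: measurable_fun_ler.
apply: measurableT_comp => //.
rewrite (_ : (fun x => _) = (fun x : R => x `^ (-1)) \o -%R)//.
by apply: measurableT_comp.
Qed.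

Section weighted.
Variable dl : R.
Hypothesis dl01 : 0 < dl < 1.

(** The weight t^(-dl-1) alone is not integrable at 0; the linear bound on F lowers the singularity
    to t^(-dl), integrable because dl < 1, that is, because the path-loss exponent exceeds 2. *)
Lemma integrable_weight (F : R -> R) (C : R) : measurable_fun setT F ->
  (forall t, 0 < t < 1 -> `|F t| <= C * t) ->
  mu.-integrable I01 (EFin \o (fun t => dl * F t * t `^ (- dl - 1))).
Proof.
move=> mF FC.
have mw p (D : set R) : measurable_fun D (fun t : R => t `^ p) by exact: measurable_funTS.
have /andP[dl0 ltdl1] := dl01; have dl1 : 0 < 1 - dl by rewrite subr_gt0.
have ib : mu.-integrable I01 (fun t => (t `^ (1 - dl - 1))%:E).
  apply/integrableP; split; first by apply/measurable_EFinP; exact: mw.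
  apply: le_lt_trans (integral_powR_lt_pinfty _ dl1).
  rewrite -integral_itv_bndo_bndc//; last by apply/measurable_EFinP; exact: mw.
  apply: ge0_le_integral => //.
  - by apply: measurableT_comp => //; apply/measurable_EFinP; exact: mw.
  - by apply/measurable_EFinP; exact: mw.
  - by move=> t _; rewrite gee0_abs// lee_fin powR_ge0.
have := @integrableZl _ _ _ mu _ (measurable_itv _) (dl * C) _ ib.
apply: le_integrable => //.
  apply/measurable_EFinP; apply: measurable_funTS; apply: measurable_funM => //.
  exact: measurable_funM.
move=> t; rewrite /= in_itv/= => t01; have /andP[t0 t1] := t01.
have C0 : 0 <= C.
  by rewrite -(pmulr_lge0 _ t0); exact: le_trans (normr_ge0 _) (FC t t01).
rewrite lee_fin !normrM !(ger0_norm (powR_ge0 _ _)) (gtr0_norm dl0) (ger0_norm C0).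
have -> : t `^ (1 - dl - 1) = t * t `^ (- dl - 1).
  rewrite -[X in X * _](@powRr1 _ t) ?ltW// -powRD ?(gt_eqF t0) ?implybT//; congr (_ `^ _); ring.
by rewrite [X in _ <= X]mulrA ler_wpM2r ?powR_ge0// -mulrA ler_wpM2l ?(ltW dl0) ?FC.
Qed.

(** Up to the factor pi r^2, this is planar area outside the disc of radius r, read in the variable
    t = (r/|y|)^a with dl = 2/a. Its mass is infinite near t = 0, the far field, whence the
    condition [linear_at0]. *)
Definition weighted_integral (F : R -> R) : R :=
  Rintegral mu I01 (fun t => dl * F t * t `^ (- dl - 1)).

Definition linear_at0 (F : R -> R) := measurable_fun setT F /\
  exists C, forall t, 0 < t < 1 -> `|F t| <= C * t.

Let Wi F : linear_at0 F -> mu.-integrable I01 (EFin \o (fun t => dl * F t * t `^ (- dl - 1))).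
Proof. by move=> [mF [C FC]]; exact: (integrable_weight _ _ mF FC). Qed.

Lemma eq_weighted_integral F G : (forall t, 0 < t < 1 -> F t = G t) ->
  weighted_integral F = weighted_integral G.
Proof.
by move=> FG; apply: eq_Rintegral => t; rewrite inE/= in_itv/= => t01; rewrite FG.
Qed.

Lemma weighted_integralD F G : linear_at0 F -> linear_at0 G ->
  weighted_integral (fun t => F t + G t) = weighted_integral F + weighted_integral G.
Proof.
move=> /Wi iF /Wi iG; rewrite /weighted_integral -RintegralD//.
by apply: eq_Rintegral => t _; rewrite mulrDr mulrDl.
Qed.

Lemma weighted_integralZ c F : linear_at0 F ->
  weighted_integral (fun t => c * F t) = c * weighted_integral F.
Proof.
move=> /Wi iF; rewrite /weighted_integral -RintegralZl//.
by apply: eq_Rintegral => t _; ring.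
Qed.

Lemma linear_at0Z c F : linear_at0 F -> linear_at0 (fun t => c * F t).
Proof.
move=> [mF [C FC]]; split; first exact: measurable_funM.
by exists (`|c| * C) => t /FC t01; rewrite normrM -mulrA ler_wpM2l.
Qed.

Lemma weighted_integral_ge0 F : (forall t, 0 < t < 1 -> 0 <= F t) -> 0 <= weighted_integral F.
Proof.
move=> F0; apply: Rintegral_ge0 => t; rewrite /= in_itv/= => t01.
by rewrite mulr_ge0 ?powR_ge0// mulr_ge0 ?F0//; case/andP: dl01 => /ltW.
Qed.

Lemma le_weighted_integral F G : linear_at0 F -> linear_at0 G ->
  (forall t, 0 < t < 1 -> F t <= G t) -> weighted_integral F <= weighted_integral G.
Proof.
move=> /Wi iF /Wi iG FG; apply: le_Rintegral => // t; rewrite /= in_itv/= => t01.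
by rewrite ler_wpM2r ?powR_ge0// ler_wpM2l ?FG//; case/andP: dl01 => /ltW.
Qed.

Variable tau : R.
Hypothesis tau0 : 0 < tau.

(** With c = tau t, the geometric series gives (1-s)c/(1+(1-s)c) = c/(1+c) - sum over n >= 1 of s^n
    c^n/(1+c)^(n+1). These are its coefficients, with the sign dropped for n >= 1. *)
Definition tier_coef (n : nat) (t : R) : R :=
  if n == 0%N then tau * t / (1 + tau * t)
  else (tau * t) ^+ n / (1 + tau * t) ^+ n.+1.

Let c0 t : 0 < t -> 0 < tau * t. Proof. by move=> t0; rewrite mulr_gt0. Qed.

Let p0 t : 0 < t -> 0 < 1 + tau * t. Proof. by move=> t0; rewrite addr_gt0// mulr_gt0. Qed.

Let mc : measurable_fun setT (fun t => tau * t). Proof. exact: measurable_funM. Qed.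

Let m1c (v : R) : measurable_fun setT (fun t => (1 + v * (tau * t))^-1).
Proof.
apply: (measurableT_comp measurable_inv); apply: measurable_funD => //.
exact: measurable_funM.
Qed.

Let lin k a : (0 < k)%N -> linear_at0 (fun t => t ^+ k / (1 + tau * t) ^+ a).
Proof.
move=> k0; split.
  have -> : (fun t => t ^+ k / (1 + tau * t) ^+ a) =
      (fun t => t ^+ k * (1 + 1 * (tau * t))^-1 ^+ a).
    by apply/funext => t; rewrite mul1r exprVn.
  by apply: measurable_funM; [exact: measurable_funX|apply: measurable_funX; exact: m1c].
exists 1 => t /andP[t0 t1]; have pp := p0 t t0.
rewrite ger0_norm; last by rewrite divr_ge0 ?exprn_ge0// ltW.
rewrite mul1r ler_pdivrMr ?exprn_gt0//.
apply: (@le_trans _ _ t); first by rewrite -[X in _ <= X]expr1 ler_wiXn2l// ltW.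
by rewrite ler_peMr ?(ltW t0)// exprn_ege1// lerDl ltW// mulr_gt0.
Qed.

(** Euler's integral with b = k - dl: its factor t^(b-1) is t^k times the weight, and the factor b
    cancels the denominator k - dl. The coefficient of rank n >= 1 is the case k = n, a = n + 1,
    whereas rank 0 is the case k = a = 1; hence the separate formula for [phi] at 0. *)
Let hypE k a : (0 < k)%N ->
  dl * tau ^+ k * hyp2F1 a%:R (k%:R - dl) (k%:R - dl + 1) (- tau) / (k%:R - dl) =
  weighted_integral (fun t => (tau * t) ^+ k / (1 + tau * t) ^+ a).
Proof.
move=> k0; have /andP[dl0 dl1] := dl01.
have b0 : 0 < k%:R - dl by rewrite subr_gt0 (lt_le_trans dl1)// ler1n.
rewrite hyp2F1_succ// [(k%:R - dl) * _]mulrC mulrA mulfK ?gt_eqF//.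
rewrite (@eq_weighted_integral _ (fun t => tau ^+ k * (t ^+ k / (1 + tau * t) ^+ a))); last first.
  by move=> t _; rewrite exprMn mulrA.
have L := lin k a k0; rewrite (weighted_integralZ _ _ L) [dl * _]mulrC -mulrA; congr (_ * _).
have -> : Rintegral mu I01 (fun t => t `^ (k%:R - dl - 1) * (1 - - tau * t) `^ (- a%:R)) =
    weighted_integral (fun t => dl^-1 * (t ^+ k / (1 + tau * t) ^+ a)).
  apply: eq_Rintegral => t; rewrite inE/= in_itv/= => /andP[t0 t1].
  rewrite mulVKf ?gt_eqF// mulNr opprK powR_invn ?(ltW (p0 t t0))//.
  have -> : t `^ (k%:R - dl - 1) = t ^+ k * t `^ (- dl - 1).
    by rewrite -powR_mulrn ?ltW// -powRD ?addrA// (gt_eqF t0) implybT.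
  by rewrite mulrAC.
by rewrite (weighted_integralZ _ _ L) mulVKf// gt_eqF.
Qed.

Lemma weighted_integral_hyp2F1_0 :
  dl * tau * hyp2F1 1 (1 - dl) (2 - dl) (- tau) / (1 - dl) =
  weighted_integral (tier_coef 0).
Proof.
have := hypE 1 1 isT; rewrite expr1 (_ : 1%:R - dl + 1 = 2 - dl); last by ring.
by move=> ->.
Qed.

Lemma weighted_integral_hyp2F1 n : (0 < n)%N ->
  dl * tau ^+ n * hyp2F1 n.+1%:R (n%:R - dl) (n.+1%:R - dl) (- tau) / (n%:R - dl) =
  weighted_integral (tier_coef n).
Proof.
move=> n0; have := hypE n n.+1 n0.
rewrite (_ : n%:R - dl + 1 = n.+1%:R - dl); last by rewrite -natr1; ring.
by move=> ->; apply: eq_weighted_integral => t _; rewrite /tier_coef gtn_eqF.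
Qed.

Let lin_coef n : linear_at0 (tier_coef n).
Proof.
have H k a : (0 < k)%N -> linear_at0 (fun t => (tau * t) ^+ k / (1 + tau * t) ^+ a).
  move=> k0; have -> : (fun t => (tau * t) ^+ k / (1 + tau * t) ^+ a) =
    (fun t => tau ^+ k * (t ^+ k / (1 + tau * t) ^+ a)) by apply/funext => t; rewrite exprMn mulrA.
  by apply: linear_at0Z; exact: lin.
case: n => [|n]; last exact: (H n.+1 n.+2).
have := H 1%N 1%N isT; rewrite (_ : (fun t => _ / _) = tier_coef 0)//.
Qed.

(** The geometric series is stopped with an exact remainder. With q = c/(1+c), the function [Rem n]
    = s^n q^n/(1+(1-s)c) satisfies [Rem n] = s^n [tier_coef n] + [Rem n.+1], and q <= 1, q <= c
    bound it by s^n c. Only finite sums are integrated. *)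
Lemma weighted_integral_expansion (s : R) (M : nat) : 0 <= s <= 1 -> (0 < M)%N ->
  exists2 rho : R, 0 <= rho <= s ^+ M * weighted_integral (fun t => tau * t) &
  weighted_integral (fun t => (1 - s) * (tau * t) / (1 + (1 - s) * (tau * t))) =
  weighted_integral (tier_coef 0) -
    \sum_(1 <= n < M) s ^+ n * weighted_integral (tier_coef n) - rho.
Proof.
move=> /andP[s0 s1] M0.
pose q t := tau * t / (1 + tau * t).
pose Rem n t := s ^+ n * (q t ^+ n * (1 + (1 - s) * (tau * t))^-1).
have d0 t : 0 < t -> 0 < 1 + (1 - s) * (tau * t).
  by move=> t0; have := c0 t t0; nra.
have Remb n t : (0 < n)%N -> 0 < t < 1 -> 0 <= Rem n t <= s ^+ n * (tau * t).
  move=> n0 /andP[t0 t1]; have c := c0 t t0; have p := p0 t t0; have dd := d0 t t0.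
  have q0 : 0 <= q t by rewrite divr_ge0// ltW.
  have q1 : q t <= 1 by rewrite ler_pdivrMr// mul1r lerDr.
  have qc : q t <= tau * t by rewrite ler_pdivrMr// ler_peMr ?(ltW c)// lerDl ltW.
  have i1 : (1 + (1 - s) * (tau * t))^-1 <= 1.
    by rewrite invf_le1// lerDl mulr_ge0 ?subr_ge0// ltW.
  have i0 : 0 <= (1 + (1 - s) * (tau * t))^-1 by rewrite invr_ge0 ltW.
  rewrite !mulr_ge0 ?exprn_ge0//= ler_wpM2l ?exprn_ge0//.
  apply: le_trans (_ : q t ^+ n * 1 <= _); first by rewrite ler_wpM2l ?exprn_ge0.
  rewrite mulr1; apply: le_trans qc; rewrite -[X in _ <= X]expr1.
  by apply: ler_wiXn2l.
have mq : measurable_fun setT q.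
  apply: measurable_funM => //.
  by have := m1c 1; under eq_fun do rewrite mul1r.
have linR n : (0 < n)%N -> linear_at0 (Rem n).
  move=> n0; split.
    apply: measurable_funM => //; apply: measurable_funM; last exact: m1c.
    exact: measurable_funX.
  exists (s ^+ n * tau) => t t01; have /andP[R0 R1] := Remb n t n0 t01.
  by rewrite ger0_norm// -mulrA.
have lint : linear_at0 (fun t => tau * t).
  split=> //; exists tau => t /andP[t0 _]; by rewrite gtr0_norm// c0.
have E0 : weighted_integral (fun t => (1 - s) * (tau * t) / (1 + (1 - s) * (tau * t))) =
    weighted_integral (tier_coef 0) - weighted_integral (Rem 1%N).
  rewrite -[X in _ = _ + X]mulN1r -(weighted_integralZ _ _ (linR 1%N isT)) -weighted_integralD//; last first.
    by apply: linear_at0Z; exact: linR.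
  apply: eq_weighted_integral => t /andP[t0 _]; rewrite /tier_coef/= /Rem /q.
  by field; rewrite (gt_eqF (p0 t t0)) (gt_eqF (d0 t t0)).
have ES n : (0 < n)%N -> weighted_integral (Rem n) =
    s ^+ n * weighted_integral (tier_coef n) + weighted_integral (Rem n.+1).
  move=> n0; rewrite -(weighted_integralZ _ _ (lin_coef n)).
  rewrite -(weighted_integralD _ _ (linear_at0Z _ _ (lin_coef n)) (linR n.+1 isT)).
  apply: eq_weighted_integral => t /andP[t0 _]; rewrite /tier_coef gtn_eqF// /Rem /q.
  rewrite !expr_div_n !exprS.
  field; rewrite (gt_eqF (p0 t t0)) (gt_eqF (d0 t t0))/=.
  by rewrite expf_neq0// gt_eqF// p0.
exists (weighted_integral (Rem M)).
  apply/andP; split; first by apply: weighted_integral_ge0 => t /(Remb _ _ M0)/andP[].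
  rewrite -weighted_integralZ//; apply: le_weighted_integral => //; first exact: linR.
    exact: linear_at0Z.
  by move=> t /(Remb _ _ M0)/andP[].
rewrite E0 -addrA; congr (_ + _); rewrite -opprD; congr (- _).
elim: M M0 => // -[|M] IH _; first by rewrite big_geq// add0r.
by rewrite IH// [in RHS]big_nat_recr//= -[RHS]addrA -ES.
Qed.
End weighted.
End hypergeometric.

(** * Toeplitz matrices and power series *)

Section toeplitz.
Context {R : realType}.

Lemma mxentryE n (A : 'M[R]_n) p q (hp : (p < n)%N) (hq : (q < n)%N) :
  mxentry A p q = A (Ordinal hp) (Ordinal hq).
Proof. by rewrite /mxentry !insubT. Qed.

Definition toeplitz M (g : nat -> R) : 'M[R]_M :=
  \matrix_(p, q) (if (q < p)%N then g (p - q)%N else 0).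

(** The constant coefficient is forced to 0, like the diagonal of the matrix; [g 0] is thus free to
    hold the constant term of the expansion, which goes into the exponential factor instead. *)
Definition symbol M (g : nat -> R) : {poly R} :=
  \poly_(n < M) (if n == 0%N then 0 else g n).

(** A lower triangular Toeplitz matrix represents multiplication by its symbol modulo X^M, and its
    first column is the image of 1; the first column of the i-th power thus lists the coefficients
    of the i-th power of the symbol. *)
Lemma toeplitz_pow_coef M (g : nat -> R) i n : (n < M)%N ->
  mxentry (toeplitz M g ^+ i) n 0 = (symbol M g ^+ i)`_n.
Proof.
move=> nM; have M0 : (0 < M)%N by exact: leq_ltn_trans nM.
rewrite (mxentryE _ _ _ _ nM M0); set p := Ordinal nM; set z := Ordinal M0.
rewrite -[n in RHS]/(val p); move: p => {nM n} p.
elim: i p => [|i IH] p; first by rewrite !expr0 coef1 mxE -val_eqE/=.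
rewrite exprS exprSr coefM -[toeplitz M g * _]/(toeplitz M g *m _) mxE.
rewrite (bigID (fun k : 'I_M => (k < p)%N))/= [X in _ + X]big1 ?addr0; last first.
  by move=> k kp; rewrite mxE (negbTE kp) mul0r.
(* The last term of the convolution contains the constant coefficient of the symbol, which is 0, so
   only indices below p remain, as in the matrix product. *)
rewrite big_ord_recr/= subnn [X in _ + X]mulrC /symbol coef_poly M0/= mul0r addr0.
rewrite (big_ord_widen_cond M xpredT (fun k => (symbol M g ^+ i)`_k * (symbol M g)`_(p - k)) (ltnW (ltn_ord p))).
apply: eq_bigr => k kp; rewrite mxE kp IH mulrC; congr (_ * _).
by rewrite coef_poly (leq_ltn_trans (leq_subr _ _))// subn_eq0 leqNgt kp.
Qed.

End toeplitz.

(** * Comparison of functions up to O(s^M) *)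

Section order_comparison.
Context {R : realType}.
Variable M : nat.

(** The relation f = h + O(s^M) as s tends to 0 from the right, with an explicit range on which 1 -
    s stays positive. *)
Definition eqO (f h : R -> R) :=
  exists C, forall s, 0 < s <= 2^-1 -> `|f s - h s| <= C * s ^+ M.

Definition bounded_half (f : R -> R) :=
  exists C, forall s, 0 < s <= 2^-1 -> `|f s| <= C.

Lemma eqO_trans f h l : eqO f h -> eqO h l -> eqO f l.
Proof.
move=> [C HC] [D HD]; exists (C + D) => s s01.
by rewrite mulrDl (le_trans (ler_distD (h s) _ _))// lerD ?HC ?HD.
Qed.

Lemma eqO_mul f f' h h' : bounded_half f -> bounded_half h' ->
  eqO f f' -> eqO h h' -> eqO (fun s => f s * h s) (fun s => f' s * h' s).
Proof.
move=> [B HB] [B' HB'] [C HC] [D HD]; exists (B * D + C * B') => s s01.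
have s0 : 0 <= s ^+ M by case/andP: s01 => s0 _; rewrite exprn_ge0// ltW.
have -> : f s * h s - f' s * h' s = f s * (h s - h' s) + (f s - f' s) * h' s by ring.
apply: le_trans (ler_normD _ _) _; rewrite [X in _ <= X]mulrDl !normrM lerD//.
  by rewrite -mulrA ler_pM ?HB ?HD.
by rewrite mulrAC ler_pM ?HC ?HB'.
Qed.

Lemma bounded_half_poly (p : {poly R}) : bounded_half (fun s => p.[s]).
Proof.
exists (\sum_(i < size p) `|p`_i|) => s /andP[s0 s1].
rewrite horner_coef; apply: le_trans (ler_norm_sum _ _ _) _; apply: ler_sum => i _.
rewrite normrM ler_piMr// normrX gtr0_norm// exprn_ile1 ?ltW//.
by rewrite (le_lt_trans s1)// invf_lt1// ltr1n.
Qed.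

Lemma bounded_half_mul f h : bounded_half f -> bounded_half h ->
  bounded_half (fun s => f s * h s).
Proof.
by move=> [B HB] [C HC]; exists (B * C) => s s01; rewrite normrM ler_pM ?HB ?HC.
Qed.

Lemma eqO_bounded f h : eqO f h -> bounded_half h -> bounded_half f.
Proof.
move=> [C HC] [B HB]; exists (`|C| + B) => s s01.
rewrite -[f s](subrK (h s)); apply: le_trans (ler_normD _ _) _; rewrite lerD ?HB//.
apply: le_trans (HC s s01) _; case/andP: s01 => s0 s1.
have sM : s ^+ M <= 1.
  by rewrite exprn_ile1 ?ltW// (le_lt_trans s1)// invf_lt1// ltr1n.
apply: le_trans (ler_norm _) _; rewrite normrM ler_piMr//.
by rewrite ger0_norm// exprn_ge0// ltW.
Qed.

Lemma eqO_take_poly (p : {poly R}) : eqO (fun s => p.[s]) (fun s => (take_poly M p).[s]).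
Proof.
have [C HC] := bounded_half_poly (drop_poly M p); exists C => s s01.
have -> : p.[s] - (take_poly M p).[s] = (drop_poly M p).[s] * s ^+ M.
  by rewrite -{1}(poly_take_drop M p) hornerD hornerM hornerXn addrAC subrr add0r.
rewrite normrM ler_pM ?HC// normrX ger0_norm//; by case/andP: s01 => /ltW.
Qed.

End order_comparison.

Section coefficients.
Context {R : realType}.

(** Letting s tend to 0 kills the constant coefficient; dividing by X then lowers both the size and
    the order by one. *)
Lemma eqO0_poly M (p : {poly R}) : (size p <= M)%N -> eqO M (fun s => p.[s]) (fun=> 0) -> p = 0.
Proof.
elim: M p => [p|M IH p sp [C HC]]; first by rewrite leqn0 size_poly_eq0 => /eqP.
have pE : p = drop_poly 1 p * 'X + (p`_0)%:P.
  rewrite -[LHS](poly_take_drop 1) expr1 addrC; congr (_ + _).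
  by apply/polyP => i; rewrite coef_take_poly coefC; case: i.
have [B HB] := bounded_half_poly (drop_poly 1 p).
have p0 : p`_0 = 0.
  apply/eqP; rewrite -normr_le0; apply/ler_addgt0Pr => eps eps0; rewrite add0r.
  (* The constant coefficient is at most (|B| + |C|) s in absolute value: |B| s bounds the higher
     terms and |C| s the assumed O(s^(M+1)). The added 1 makes [D] a legitimate divisor. *)
  pose D := `|B| + `|C| + 1.
  have D0 : 0 < D by rewrite ltr_wpDl// addr_ge0.
  pose s := Num.min 2^-1 (eps / D).
  have s01 : 0 < s <= 2^-1 by rewrite lt_min divr_gt0// invr_gt0 ltr0n/= ge_min lexx.
  have /andP[s0 s1] := s01.
  have sD : s * D <= eps by rewrite -ler_pdivlMr// ge_min lexx orbT.
  have := HC s s01; have := HB s s01; rewrite subr0 [in X in _ -> X -> _]pE !hornerE => h1 h2.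
  have -> : p`_0 = ((drop_poly 1 p).[s] * s + p`_0) - (drop_poly 1 p).[s] * s by ring.
  apply: le_trans (ler_normB _ _) _; apply: le_trans sD.
  have sM : C * s ^+ M.+1 <= `|C| * s.
    apply: le_trans (ler_norm _) _; rewrite normrM ler_wpM2l// ger0_norm ?exprn_ge0 ?(ltW s0)//.
    rewrite exprS ler_piMr ?(ltW s0)// exprn_ile1 ?(ltW s0)//.
    by apply: (le_trans s1); lra.
  have h3 : `|(drop_poly 1 p).[s] * s| <= `|B| * s.
    by rewrite normrM (gtr0_norm s0) ler_wpM2r ?(ltW s0)// (le_trans h1 (ler_norm _)).
  by rewrite /D; nra.
have d0 : drop_poly 1 p = 0.
  apply: IH; first by rewrite size_drop_poly leq_subLR add1n.
  exists C => s s01; have := HC s s01; rewrite !subr0 [in X in X -> _]pE p0 !hornerE.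
  have /andP[s0 _] := s01.
  by rewrite normrM (gtr0_norm s0) exprSr mulrA ler_pM2r.
by rewrite pE d0 p0 mul0r add0r.
Qed.

Variables (M : nat) (g p : nat -> R) (sg g0 : R) (rho : R -> R).
Hypotheses (M0 : (0 < M)%N) (sg0 : 0 <= sg) (gn0 : forall n, (0 < n)%N -> 0 <= g n).
Hypothesis rhoO : exists C : R, forall s : R, 0 < s <= 2^-1 -> 0 <= rho s <= C * s ^+ M.
Hypothesis pO : eqO M (fun s => \sum_(m < M) s ^+ m * p m)
  (fun s => expR (- ((1 - s) * sg) - (g0 - \sum_(1 <= n < M) s ^+ n * g n - rho s))).

Let half1 (s : R) : 0 < s <= 2^-1 -> 0 <= s <= 1.
Proof.
move=> /andP[s0 s1]; rewrite ltW//= (le_trans s1)//; lra.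
Qed.

Let P1 : {poly R} := \poly_(a < M) (sg ^+ a / a`!%:R).
(** The exponential of the symbol, cut at exponent M: the symbol being divisible by X, its powers
    from the M-th on contribute only O(s^M). This is where the sum over i in the formula comes
    from. *)
Let P2 : {poly R} := \sum_(i < M) (i`!%:R)^-1 *: symbol M g ^+ i.

Let eqO1 : eqO M (fun s => expR (s * sg)) (fun s => P1.[s]).
Proof.
exists (expR sg) => s /half1 s01; have := expR_taylor_bound s sg M s01 sg0.
have -> : P1.[s] = \sum_(m < M) (s * sg) ^+ m / m`!%:R.
  by rewrite horner_poly; apply: eq_bigr => i _; rewrite exprMn; ring.
by move=> /andP[h1 h2]; rewrite ger0_norm// [X in _ <= X]mulrC.
Qed.

Let eqO2 : eqO M (fun s => expR (\sum_(1 <= n < M) s ^+ n * g n)) (fun s => P2.[s]).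
Proof.
(* One factor s is taken out of the exponent, which becomes s b(s) with 0 <= b(s) <= g_1 + ... +
   g_(M-1); the Taylor bound then applies with a constant independent of s. *)
pose b s := \sum_(1 <= n < M) s ^+ n.-1 * g n.
have bE s : \sum_(1 <= n < M) s ^+ n * g n = s * b s.
  rewrite /b mulr_sumr; apply: eq_big_nat => n /andP[n0 _].
  by rewrite mulrA -exprS prednK.
have symE s : (symbol M g).[s] = s * b s.
  rewrite -bE horner_poly; case: M M0 => // M' _.
  rewrite big_ord_recl/= mul0r add0r big_add1/= big_mkord; apply: eq_bigr => i _.
  by rewrite mulrC.
have b0 s : 0 <= s -> 0 <= b s.
  move=> s0; rewrite /b big_nat; apply: sumr_ge0 => n /andP[n0 _].
  by rewrite mulr_ge0 ?exprn_ge0 ?gn0.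
have bB s : 0 <= s <= 1 -> b s <= \sum_(1 <= n < M) g n.
  move=> /andP[s0 s1]; apply: ler_sum_nat => n /andP[n0 _].
  by rewrite ler_piMl ?gn0// exprn_ile1.
exists (expR (\sum_(1 <= n < M) g n)) => s /half1 s01; have /andP[s0 s1] := s01.
have := expR_taylor_bound s (b s) M s01 (b0 s s0).
have -> : P2.[s] = \sum_(m < M) (s * b s) ^+ m / m`!%:R.
  rewrite /P2 horner_sum; apply: eq_bigr => i _.
  by rewrite hornerZ horner_exp symE mulrC.
rewrite -bE => /andP[h1 h2]; rewrite ger0_norm// [X in _ <= X]mulrC (le_trans h2)//.
by rewrite ler_wpM2l ?exprn_ge0// ler_expR bB.
Qed.

Let eqO3 : eqO M (fun s => expR (rho s)) (fun=> 1).
Proof.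
have [C HC] := rhoO; exists (C * expR C) => s s01; have /andP[r0 r1] := HC s s01.
have /half1/andP[s0 s1] := s01.
have C0 : 0 <= C.
  have : 0 < s ^+ M by case/andP: s01 => s0' _; rewrite exprn_gt0.
  by move=> sM; rewrite -(pmulr_lge0 _ sM) (le_trans r0).
have rC : rho s <= C by rewrite (le_trans r1)// ler_piMr// exprn_ile1.
rewrite ger0_norm; last by rewrite subr_ge0 -expR0 ler_expR.
(* This is 1 - rho <= e^(-rho) multiplied by e^rho. *)
have h : expR (rho s) - 1 <= rho s * expR (rho s).
  have e0 := expR_gt0 (rho s).
  have := ler_wpM2r (ltW e0) (expR_ge1Dx (- rho s)).
  by rewrite expRN mulVf ?gt_eqF//; lra.
apply: le_trans h _; rewrite mulrAC ler_pM ?expR_ge0//.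
by rewrite ler_expR.
Qed.

(** The right-hand side of [pO] factors as the constant e^(-sg-g0) times e^(s sg), the exponential
    of the symbol, and e^rho = 1 + O(s^M). After truncation both sides are polynomials of size at
    most M that differ by O(s^M), hence are equal; the sum over n is the Cauchy product of the first
    two series. *)
Lemma outage_coefficients m : (m < M)%N ->
  p m = expR (- sg - g0) * \sum_(n < m.+1) sg ^+ (m - n) / (m - n)`!%:R *
    \sum_(i < M) (i`!%:R)^-1 * mxentry (toeplitz M g ^+ i) n 0.
Proof.
move=> mM.
pose K0 := expR (- sg - g0).
pose Pp : {poly R} := \poly_(m < M) p m.
have b1 : bounded_half (fun=> 1 : R) by exists 1 => s _; rewrite normr1.
have bP1 := eqO_bounded M _ _ eqO1 (bounded_half_poly P1).
have bP2 := eqO_bounded M _ _ eqO2 (bounded_half_poly P2).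
have b3 := eqO_bounded M _ _ eqO3 b1.
have PpE : eqO M (fun s => Pp.[s]) (fun s => ((K0 *: (P1 * P2))).[s]).
  apply: (eqO_trans _ _ (fun s => \sum_(m < M) s ^+ m * p m)).
    exists 0 => s _; rewrite horner_poly mul0r.
    by rewrite (eq_bigr (fun m : 'I_M => s ^+ m * p m)) ?subrr ?normr0// => i _; rewrite mulrC.
  apply: (eqO_trans _ _ _ _ pO).
  have E12 := eqO_mul M _ _ _ _ bP1 (bounded_half_poly P2) eqO1 eqO2.
  have E123 := eqO_mul M _ _ _ _ (bounded_half_mul _ _ bP1 bP2) b1 E12 eqO3.
  have [C HC] := E123; exists (`|K0| * C) => s s01.
  have -> : expR (- ((1 - s) * sg) - (g0 - \sum_(1 <= n < M) s ^+ n * g n - rho s)) =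
      K0 * (expR (s * sg) * expR (\sum_(1 <= n < M) s ^+ n * g n) * expR (rho s)).
    by rewrite /K0 -!expRD; congr expR; ring.
  rewrite hornerZ hornerM -mulrBr normrM -[X in _ <= X]mulrA ler_wpM2l//.
  by have := HC s s01; rewrite mulr1.
have : Pp = take_poly M (K0 *: (P1 * P2)).
  apply/eqP; rewrite -subr_eq0; apply/eqP; apply: (eqO0_poly M).
    rewrite (leq_trans (size_polyD _ _))// geq_max size_poly size_polyN size_take_poly.
    by [].
  have [C HC] := eqO_trans _ _ _ _ PpE (eqO_take_poly M (K0 *: (P1 * P2))).
  by exists C => s /HC; rewrite hornerD hornerN subr0.
move=> /polyP/(_ m); rewrite coef_poly mM coef_take_poly mM coefZ => ->; congr (_ * _).
rewrite coefMr; apply: eq_bigr => n _.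
rewrite coef_poly (leq_ltn_trans (leq_subr _ _) mM); congr (_ * _).
rewrite /P2 coef_sum; apply: eq_bigr => i _; rewrite coefZ toeplitz_pow_coef//.
by rewrite (leq_trans _ mM)// ltnS -ltnS.
Qed.

End coefficients.

(** * Laplace transform of the interference *)

Section density.
Context {R : realType} {d : measure_display} {Om : measurableType d}.
Variables (P : probability Om R) (X : Om -> R) (f : R -> R).
Hypotheses (mX : measurable_fun setT X) (mf : measurable_fun setT f).
Hypotheses (f0 : forall x, 0 <= f x) (hX : has_density P X f).
Local Notation mu := (@lebesgue_measure R).

Let density_nnsfun (g : {nnsfun R >-> R}) :
  (\int[P]_w (g (X w))%:E = \int[mu]_x ((g x)%:E * (f x)%:E))%E.
Proof.
have g0 r x : (0%R <= r%:E * (\1_(g @^-1` [set r]) x)%:E)%E.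
  by rewrite -EFinM; exact: nnfun_muleindic_ge0.
have mg r : measurable_fun setT (\1_(g @^-1` [set r]) : R -> R) by exact: measurable_indic.
have mgX r : measurable_fun setT (fun w => \1_(g @^-1` [set r]) (X w) : R).
  exact: (measurableT_comp (mg r) mX).
under [LHS]eq_integral do rewrite fimfunE -fsumEFin//.
rewrite [LHS]ge0_integral_fsum//; last 2 first.
- move=> r; apply/measurable_EFinP; exact: measurable_funM.
- by move=> r x _; rewrite EFinM.
under [RHS]eq_integral.
  move=> x _; rewrite fimfunE -fsumEFin// ge0_mule_fsuml; last by move=> r; rewrite EFinM.
  over.
rewrite [RHS]ge0_integral_fsum//; last 2 first.
- move=> r; apply: emeasurable_funM; last exact/measurable_EFinP.
  by apply/measurable_EFinP; apply: measurable_funM => //; exact: mg.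
- move=> r x _; apply: mule_ge0; last by rewrite lee_fin.
  by rewrite EFinM; exact: g0.
apply: eq_fsbigr => r; rewrite inE => -[x0 _ gr].
have r0 : 0 <= r by rewrite -gr fun_ge0.
transitivity (r%:E * P (X @^-1` (g @^-1` [set r])))%E.
  under eq_integral do rewrite EFinM.
  rewrite ge0_integralZl_EFin//; last first.
    by apply/measurable_EFinP; exact: mgX.
  have mXr : measurable (X @^-1` (g @^-1` [set r])).
    by rewrite -[X in measurable X]setTI; apply: mX.
  congr (_ * _)%E; transitivity (\int[P]_w (\1_(X @^-1` (g @^-1` [set r])) w)%:E)%E => //.
  by rewrite integral_indic// setIT.
rewrite hX//.
transitivity (r%:E * \int[mu]_x ((\1_(g @^-1` [set r]) x)%:E * (f x)%:E))%E.
  congr (_ * _)%E; rewrite integral_mkcond; apply: eq_integral => x _.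
  by rewrite patchE indicE; case: ifPn => _; rewrite ?mul1e ?mul0e.
rewrite -ge0_integralZl_EFin//.
- by apply: eq_integral => x _; rewrite EFinM muleA.
- by move=> x _; rewrite mule_ge0 ?lee_fin.
- by apply: emeasurable_funM; apply/measurable_EFinP; [exact: mg|].
Qed.

(** Simple functions first, one level set at a time, then monotone convergence on both sides. *)
Lemma has_density_integral (h : R -> \bar R) : measurable_fun setT h ->
  (forall x, (0 <= h x)%E) ->
  (\int[P]_w h (X w) = \int[mu]_x (h x * (f x)%:E))%E.
Proof.
move=> mh h0.
pose g := nnsfun_approx measurableT mh.
have h0' x : setT x -> (0 <= h x)%E by [].
have cg x : (g n x)%:E @[n --> \oo] --> h x by exact: (@cvg_nnsfun_approx _ _ _ _ measurableT _ mh h0' x I).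
have ndg x : nondecreasing_seq (g ^~ x) by move=> a b ab; exact/lefP/nd_nnsfun_approx.
have mg n : measurable_fun setT (g n : R -> R) by [].
have c1 : (\int[P]_w (g n (X w))%:E @[n --> \oo] --> \int[P]_w h (X w))%E.
  have -> : (\int[P]_w h (X w) = \int[P]_w limn (fun n => (g n (X w))%:E))%E.
    by apply: eq_integral => w _; apply/esym/cvg_lim.
  apply: (@cvg_monotone_convergence _ _ _ P _ measurableT (fun n w => (g n (X w))%:E)).
  - by move=> n; apply/measurable_EFinP; exact: measurableT_comp.
  - by move=> n w _; rewrite lee_fin fun_ge0.
  - by move=> w _ a b ab; rewrite lee_fin ndg.
have c2 : (\int[mu]_x ((g n x)%:E * (f x)%:E) @[n --> \oo] --> \int[mu]_x (h x * (f x)%:E))%E.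
  have -> : (\int[mu]_x (h x * (f x)%:E) = \int[mu]_x limn (fun n => (g n x)%:E * (f x)%:E))%E.
    apply: eq_integral => x _; apply/esym/cvg_lim => //.
    by apply: cvgeZr.
  apply: (@cvg_monotone_convergence _ _ _ mu _ measurableT (fun n x => (g n x)%:E * (f x)%:E)%E).
  - by move=> n; apply: emeasurable_funM; apply/measurable_EFinP; [exact: mg|].
  - by move=> n x _; rewrite mule_ge0 ?lee_fin ?fun_ge0.
  - by move=> x _ a b ab; rewrite lee_wpmul2r ?lee_fin// ndg.
have E : (fun n => \int[P]_w (g n (X w))%:E)%E = (fun n => \int[mu]_x ((g n x)%:E * (f x)%:E))%E.
  by apply/funext => n; exact: density_nnsfun.
by rewrite -(cvg_lim _ c1)// E (cvg_lim _ c2).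
Qed.

End density.

Section measurable_limn.
Context {R : realType} {d : measure_display} {T : measurableType d}.

(** The interference in the statement sums marks that may be negative on a null set, where its
    partial sums need not be monotone or even convergent. Measurability must therefore hold for the
    limit operator itself, including its default value: the limit is the limsup where liminf and
    limsup agree, and a constant elsewhere. *)
Lemma measurable_limn (u : nat -> T -> \bar R) :
  (forall n, measurable_fun setT (u n)) ->
  measurable_fun setT (fun x => limn (u ^~ x)).
Proof.
move=> mu.
have ms : measurable_fun setT (fun x => limn_esup (u ^~ x)) by exact: measurable_fun_limn_esup.
have mi : measurable_fun setT (fun x => limn_einf (u ^~ x)).
  have -> : (fun x => limn_einf (u ^~ x)) = (fun x => - limn_esup (fun n => - u n x))%E.
    apply/funext => x; rewrite -limn_einfN; congr limn_einf.
    by apply/funext => n /=; rewrite oppeK.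
  apply: measurableT_comp => //; apply: measurable_fun_limn_esup => n.
  exact: measurableT_comp.
have -> : (fun x => limn (u ^~ x)) = (fun x =>
    if limn_einf (u ^~ x) == limn_esup (u ^~ x) then limn_esup (u ^~ x) else point).
  apply/funext => x; case: eqP => E; last first.
    (* Where liminf and limsup differ there is no limit, and [limn] returns [point]. *)
    apply: dvgP => cu; apply: E.
    by rewrite is_cvg_limn_einfE// is_cvg_limn_esupE.
  apply/cvg_lim => //.
  apply: (@squeeze_cvge _ _ _ _ (einfs (u ^~ x)) _ (esups (u ^~ x))).
  - apply: nearW => n; rewrite /einfs /esups /=; apply/andP; split.
      by apply: ereal_inf_lbound; exists n => /=.
    by apply: ereal_sup_ubound; exists n => /=.
  - rewrite -E limn_einf_lim; exact: is_cvg_einfs.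
  - rewrite limn_esup_lim; exact: is_cvg_esups.
apply: measurable_fun_ifT => //.
apply: (measurable_fun_bool true).
rewrite (_ : _ @^-1` _ = [set x | limn_einf (u ^~ x) = limn_esup (u ^~ x)]); last first.
  by apply/seteqP; split => x /= /eqP.
exact: measurable_eqe.
Qed.

End measurable_limn.

(** * Measurability and integration with respect to sub-sigma-algebras *)

Section adapted.
Context {T : pointedType}.

(** Measurability for the sigma-algebra generated by [G] is expressed by retyping the domain of f,
    so that the usual closure lemmas apply unchanged. *)
Definition adapted {d'} {T' : measurableType d'} (G : set (set T)) (f : T -> T') :=
  measurable_fun setT (f : g_sigma_algebraType G -> T').

Lemma adapted_sub {d'} {T' : measurableType d'} (G G' : set (set T)) (f : T -> T') :
  G `<=` <<s G'>> -> adapted G f -> adapted G' f.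
Proof.
move=> GG' mf mT B mB; have := mf measurableT B mB.
apply: smallest_sub => //; exact: smallest_sigma_algebra.
Qed.

Lemma adapted_generator {d'} {T' : measurableType d'} (G : set (set T)) (f : T -> T') :
  (forall B, measurable B -> G (f @^-1` B)) -> adapted G f.
Proof. by move=> Gf mT B mB; rewrite setTI; apply: sub_sigma_algebra; exact: Gf. Qed.

End adapted.

Section independent_family.
Context {R : realType} {d : measure_display} {Om : measurableType d}.
Variable P : probability Om R.
Context {I : eqType} (F : I -> set (set Om)).
Hypothesis sF : forall i, sigma_algebra setT (F i).
Hypothesis mF : forall i, F i `<=` measurable.
Hypothesis indF : mutually_independent P F.

Lemma sub_others i j : j != i -> F j `<=` others F i.
Proof. by move=> ji A FA; exists j. Qed.

Lemma adapted_others {d'} {T' : measurableType d'} i j (f : Om -> T') : j != i ->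
  (forall B, measurable B -> F j (f @^-1` B)) -> adapted (others F i) f.
Proof. by move=> ji Ff; apply: adapted_generator => B mB; apply: sub_others (Ff B mB). Qed.

(** Separates component i from everything else without a product model: the second variable is the
    sample point itself, in Om with the sigma-algebra of the other components, and the identity map
    into that space is independent of [U]. *)
Lemma fubini_others {d1} {T1 : measurableType d1} i (U : Om -> T1)
    (f : T1 * g_sigma_algebraType (others F i) -> \bar R) :
  (forall B, measurable B -> F i (U @^-1` B)) ->
  measurable_fun setT f -> (forall z, (0 <= f z)%E) ->
  (\int[P]_w f (U w, w) = \int[P]_w \int[P]_w' f (U w, w'))%E /\
  (\int[P]_w f (U w, w) = \int[P]_w' \int[P]_w f (U w, w'))%E.
Proof.
move=> FU mf f0.
have so : <<s others F i>> `<=` measurable.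
  apply: smallest_sub; last by move=> A [j _ /mF].
  exact: sigma_algebra_measurable.
have mU : measurable_fun setT U by move=> _ B mB; rewrite setTI; exact/mF/FU.
pose V : Om -> g_sigma_algebraType (others F i) := id.
have mV : measurable_fun setT V by move=> _ B mB; rewrite setTI; exact: so.
apply: (independent_fubini P U V mU mV _ f) => // A B mA mB.
exact: (independent_others P F sF mF indF i _ B (FU A mA) mB).
Qed.

Lemma expectation_others i (U W : Om -> R) : rv01 U -> rv01 W ->
  (forall B, measurable B -> F i (U @^-1` B)) -> adapted (others F i) W ->
  Rintegral P setT (fun w => U w * W w) = Rintegral P setT U * Rintegral P setT W.
Proof.
move=> rU rW FU aW.
(* The first variable ranges over all reals, so absolute values are needed to make the integrand
   nonnegative; they disappear on the actual values of [U] and [W]. *)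
pose f (z : R * g_sigma_algebraType (others F i)) : \bar R := (`|z.1| * `|W z.2|)%:E.
have aW2 : measurable_fun setT
  (fun z : R * g_sigma_algebraType (others F i) => W z.2).
  exact: (measurableT_comp aW measurable_snd).
have mf : measurable_fun setT f.
  by apply/measurable_EFinP; apply: measurable_funM; apply: measurableT_comp.
have f0 z : (0 <= f z)%E by rewrite lee_fin mulr_ge0.
have [E _] := fubini_others i U f FU mf f0.
have U0 w : 0 <= U w by have [_ /(_ w)/andP[]] := rU.
have W0 w : 0 <= W w by have [_ /(_ w)/andP[]] := rW.
apply/EFin_inj; rewrite EFinM -!rv01_integral//; last exact: rv01M.
transitivity (\int[P]_w f (U w, w))%E.
  by apply: eq_integral => w _; rewrite /f/= !ger0_norm.
rewrite E.
have mWE : measurable_fun setT (EFin \o W) by apply/measurable_EFinP; have [] := rW.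
have mUE : measurable_fun setT (EFin \o U) by apply/measurable_EFinP; have [] := rU.
transitivity (\int[P]_w ((U w)%:E * (Rintegral P setT W)%:E))%E.
  apply: eq_integral => w _; rewrite -rv01_integral// -ge0_integralZl_EFin//.
    by apply: eq_integral => w' _; rewrite /f/= !ger0_norm// EFinM.
  by move=> w' _; rewrite lee_fin.
rewrite ge0_integralZr//.
- by congr (_ * _)%E; rewrite -rv01_integral.
- by move=> w _; rewrite lee_fin.
- by rewrite lee_fin; exact: Rintegral_ge0.
Qed.

Lemma expectation_prod (s : seq I) (U : I -> Om -> R) : uniq s ->
  (forall i, rv01 (U i)) -> (forall i B, i \in s -> measurable B -> F i (U i @^-1` B)) ->
  Rintegral P setT (fun w => \prod_(i <- s) U i w) = \prod_(i <- s) Rintegral P setT (U i).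
Proof.
elim: s => [_ _ _|i s IH].
  under eq_Rintegral do rewrite big_nil.
  by rewrite big_nil Rintegral_cst// mul1r -[RHS]/(fine 1%E); congr fine; exact: probability_setT.
move=> /= /andP[ins us] rU FU.
under eq_Rintegral do rewrite big_cons.
rewrite (expectation_others i)//.
- rewrite big_cons IH// => j B js; apply: FU; by rewrite inE js orbT.
- exact: rv01_prod.
- by move=> B; apply: FU; rewrite inE eqxx.
- apply: measurable_prod => j js; apply: (adapted_others _ j).
    by apply: contraNneq ins => <-.
  by move=> B; apply: FU; rewrite inE js orbT.
Qed.

(** Multiplying the exponential density of rate 1 by e^(-av) gives 1/(1+a) times the density of rate
    1 + a. The positive part changes nothing where the density is nonzero. *)
Lemma exponential_laplace (V : Om -> R) (a : R) : measurable_fun setT V ->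
  has_density P V (exponential_pdf 1) -> 0 <= a ->
  (\int[P]_w (expR (- (a * Num.max (V w) 0)))%:E = ((1 + a)^-1)%:E)%E.
Proof.
move=> mV hV a0; have a1 : 0 < 1 + a by rewrite ltr_pwDl.
have mh : measurable_fun setT (fun v : R => (expR (- (a * Num.max v 0)))%:E).
  apply/measurable_EFinP; apply: measurableT_comp => //; apply: measurableT_comp => //.
  by apply: measurable_funM => //; exact: measurable_maxr.
rewrite (has_density_integral P V (exponential_pdf 1) mV _ _ hV
  (fun v => (expR (- (a * Num.max v 0)))%:E) mh)//; last 2 first.
- exact: measurable_exponential_pdf.
- by move=> x; exact: exponential_pdf_ge0.
transitivity (\int[lebesgue_measure]_x (((1 + a)^-1)%:E * (exponential_pdf (1 + a) x)%:E))%E.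
  apply: eq_integral => x _; rewrite -!EFinM; congr EFin.
  have [x0|x0] := leP 0 x.
    rewrite !exponential_pdfE// mul1r [RHS]mulrA mulVf ?gt_eqF// mul1r -expRD.
    by congr expR; ring.
  by rewrite !lt0_exponential_pdf// !mulr0.
rewrite ge0_integralZl_EFin ?invr_ge0 ?ltW//.
- by rewrite integral_exponential_pdf// mule1.
- by move=> x _; rewrite lee_fin exponential_pdf_ge0// ltW.
- by apply/measurable_EFinP; exact: measurable_exponential_pdf.
Qed.

Lemma expectation_mark i (V a W : Om -> R) :
  (forall B, measurable B -> F i (V @^-1` B)) ->
  has_density P V (exponential_pdf 1) ->
  adapted (others F i) a -> (forall w, 0 <= a w) ->
  adapted (others F i) W -> rv01 W -> 
  Rintegral P setT (fun w => expR (- (a w * Num.max (V w) 0)) * W w) =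
  Rintegral P setT (fun w => (1 + a w)^-1 * W w).
Proof.
move=> FV hV aa a0 aW rW.
pose f (z : R * g_sigma_algebraType (others F i)) : \bar R :=
  ((expR (- (a z.2 * Num.max z.1 0)))%:E * (`|W z.2|)%:E)%E.
have aW2 : measurable_fun setT
  (fun z : R * g_sigma_algebraType (others F i) => W z.2).
  exact: (measurableT_comp aW measurable_snd).
have aa2 : measurable_fun setT
  (fun z : R * g_sigma_algebraType (others F i) => a z.2).
  exact: (measurableT_comp aa measurable_snd).
have mf : measurable_fun setT f.
  apply: emeasurable_funM; apply/measurable_EFinP; last exact: measurableT_comp.
  apply: measurableT_comp => //; apply: measurableT_comp => //.
  by apply: measurable_funM => //; exact: measurable_maxr.
have f0 z : (0 <= f z)%E by rewrite mule_ge0 ?lee_fin ?expR_ge0.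
have W0 w : 0 <= W w by have [_ /(_ w)/andP[]] := rW.
have mV : measurable_fun setT V by move=> _ B mB; rewrite setTI; exact/mF/FV.
have [_ E] := fubini_others i V f FV mf f0.
congr fine; transitivity (\int[P]_w f (V w, w))%E.
  by apply: eq_integral => w _; rewrite /f/= ger0_norm// EFinM.
rewrite E; apply: eq_integral => w _; rewrite /f/= ger0_norm//.
rewrite ge0_integralZr//; last 2 first.
- apply/measurable_EFinP; apply: measurableT_comp => //; apply: measurableT_comp => //.
  by apply: measurable_funM => //; apply: measurable_maxr.
- by rewrite lee_fin.
by rewrite exponential_laplace// EFinM.
Qed.

Let measurable_mark {d'} {T' : measurableType d'} (a V : T' -> R) :
  measurable_fun setT a -> measurable_fun setT V ->
  measurable_fun setT (fun w => expR (- (a w * Num.max (V w) 0))).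
Proof.
move=> ma mV; apply: measurableT_comp => //; apply: measurableT_comp => //.
by apply: measurable_funM => //; exact: measurable_maxr.
Qed.

(** Marks are integrated out one at a time with all else frozen, each leaving the factor 1/(1 +
    a_i). [G] holds the information carried by the positions, common to all coefficients a_i and
    independent of each mark; [W] accumulates the factors already treated. *)
Lemma expectation_marks (s : seq I) (G : set (set Om)) (V a : I -> Om -> R) (W : Om -> R) :
  G `<=` measurable ->
  uniq s -> (forall i B, i \in s -> measurable B -> F i (V i @^-1` B)) ->
  (forall i, i \in s -> has_density P (V i) (exponential_pdf 1)) ->
  (forall i, i \in s -> G `<=` others F i) ->
  (forall i, adapted G (a i)) -> (forall i w, 0 <= a i w) ->
  adapted G W -> rv01 W ->
  Rintegral P setT (fun w => W w * \prod_(i <- s) expR (- (a i w * Num.max (V i w) 0))) =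
  Rintegral P setT (fun w => W w * \prod_(i <- s) (1 + a i w)^-1).
Proof.
move=> mG us FV hV GF aa a0.
have sG : <<s G>> `<=` measurable.
  apply: smallest_sub => //; exact: sigma_algebra_measurable.
have am f : adapted G f -> measurable_fun setT (f : Om -> R).
  by move=> af _ B mB; apply: sG; exact: (af measurableT B mB).
elim: s us FV hV GF W => [|i s IH].
  by move=> *; congr fine; apply: eq_integral => w _; rewrite !big_nil.
move=> /= /andP[ins us] FV hV GF W aW rW.
have Fs j B : j \in s -> measurable B -> F j (V j @^-1` B).
  by move=> js; apply: FV; rewrite inE js orbT.
have ii : i \in i :: s by rewrite inE eqxx.
have Gi : G `<=` <<s others F i>>.
  by move=> A /(GF i ii); exact: sub_sigma_algebra.
have e01 j : j \in s -> rv01 (fun w => expR (- (a j w * Num.max (V j w) 0))).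
  move=> js; split.
    apply: measurable_mark; first exact: am.
    by move=> _ B mB; rewrite setTI; apply: (mF _ _ (Fs j B js mB)).
  move=> w; rewrite expR_ge0 -expR0 ler_expR oppr_le0 mulr_ge0//.
  by rewrite le_max lexx orbT.
pose W' w := W w * \prod_(j <- s) expR (- (a j w * Num.max (V j w) 0)).
have rW' : rv01 W'.
  apply: rv01M => //; rewrite (_ : (fun w => _) = (fun w =>
    \prod_(j <- s) (if j \in s then expR (- (a j w * Num.max (V j w) 0)) else 1))).
    apply: rv01_prod => j; case: (boolP (j \in s)) => [/e01//|_].
    by apply: rv01_cst; rewrite ler01 lexx.
  by apply/funext => w; rewrite big_seq [RHS]big_seq; apply: eq_bigr => j ->.
have aW' : adapted (others F i) W'.
  apply: measurable_funM; first exact: (adapted_sub _ _ _ Gi aW).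
  apply: measurable_prod => j js; apply: measurable_mark.
    exact: (adapted_sub _ _ _ Gi (aa j)).
  apply: (adapted_others i j) => [|B]; last exact: Fs.
  by apply: contraNneq ins => <-.
have W0 : rv01 (fun w => (1 + a i w)^-1).
  split; first by apply: (measurableT_comp measurable_inv); apply: measurable_funD => //; exact: am.
  move=> w; have h : 1 <= 1 + a i w by rewrite lerDl.
  by rewrite invr_ge0 (le_trans ler01 h) invf_le1// (lt_le_trans ltr01).
transitivity (Rintegral P setT (fun w => expR (- (a i w * Num.max (V i w) 0)) * W' w)).
  by congr fine; apply: eq_integral => w _; rewrite big_cons /W' mulrCA.
rewrite (expectation_mark i)//; last 3 first.
- by move=> B; exact: FV.
- exact: hV.
- exact: (adapted_sub _ _ _ Gi (aa i)).
transitivity (Rintegral P setT (fun w => (W w * (1 + a i w)^-1) *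
    \prod_(j <- s) expR (- (a j w * Num.max (V j w) 0)))).
  by congr fine; apply: eq_integral => w _; rewrite /W' mulrCA mulrA.
rewrite IH//.
- by congr fine; apply: eq_integral => w _; rewrite big_cons mulrA.
- by move=> j js; apply: hV; rewrite inE js orbT.
- by move=> j js; apply: GF; rewrite inE js orbT.
- apply: measurable_funM => //; apply: (measurableT_comp measurable_inv).
  by apply: measurable_funD => //; exact: aa.
- exact: rv01M.
Qed.

End independent_family.

Section model.
Context {R : realType} {K : nat} {d : measure_display} {Om : measurableType d}.
Variables (P : probability Om R) (X Gs : Om -> R) (Y : 'I_K -> nat -> Om -> R * R)
  (V : 'I_K -> nat -> Om -> R).
Hypotheses (mX : measurable_fun setT X) (mGs : measurable_fun setT Gs)
  (mY : forall j n, measurable_fun setT (Y j n))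
  (mV : forall j n, measurable_fun setT (V j n)).
Hypothesis hV : forall j n B, measurable B ->
  P (V j n @^-1` B) = exponential_prob (1 : R) B.
Variable ell : 'I_K -> R.
Hypothesis hY : forall j, is_hPPP P (Y j) (ell j).

Definition components (c : comp_index K) : set (set Om) :=
  match c with
  | inl true => sigma_gen (fun _ : unit => X)
  | inl false => sigma_gen (fun _ : unit => Gs)
  | inr (inl j) => sigma_gen (Y j)
  | inr (inr (j, n)) => sigma_gen (fun _ : unit => V j n)
  end.

Hypothesis hind : mutually_independent P components.

Lemma sigma_algebra_components c : sigma_algebra setT (components c).
Proof. by case: c => [[]|[j|[j n]]]; exact: smallest_sigma_algebra. Qed.

Let sigma_gen_measurable {d'} {T' : measurableType d'} {I : Type} (Z : I -> Om -> T') :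
  (forall i, measurable_fun setT (Z i)) -> sigma_gen Z `<=` measurable.
Proof.
move=> mZ; apply: smallest_sub; first exact: sigma_algebra_measurable.
by move=> _ [i [B [mB ->]]]; rewrite -[X in measurable X]setTI; exact: mZ.
Qed.

Lemma measurable_components c : components c `<=` measurable.
Proof. by case: c => [[]|[j|[j n]]]; exact: sigma_gen_measurable. Qed.

Let gen {d'} {T' : measurableType d'} {I : Type} (Z : I -> Om -> T') i B :
  measurable B -> sigma_gen Z (Z i @^-1` B).
Proof. by move=> mB; apply: sub_sigma_algebra; exists i, B. Qed.

Lemma components_X B : measurable B -> components (inl true) (X @^-1` B).
Proof. exact: (gen (fun _ : unit => X) tt). Qed.

Lemma components_G B : measurable B -> components (inl false) (Gs @^-1` B).
Proof. exact: (gen (fun _ : unit => Gs) tt). Qed.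

Lemma components_Y j n B : measurable B -> components (inr (inl j)) (Y j n @^-1` B).
Proof. exact: (gen (Y j) n). Qed.

Lemma components_V j n B : measurable B -> components (inr (inr (j, n))) (V j n @^-1` B).
Proof. exact: (gen (fun _ : unit => V j n) tt). Qed.

Section weighted_points.
Variable c : 'I_K -> R * R -> R.
Hypotheses (mc : forall j, measurable_fun setT (c j)) (c0 : forall j y, 0 <= c j y).

Let mark j n w := c j (Y j n w) * Num.max (V j n w) 0.
Let mark0 j n w : 0 <= mark j n w.
Proof. by rewrite mulr_ge0// le_max lexx orbT. Qed.

(* The marks are nonnegative only almost surely; the positive part makes the series a sum of
   nonnegative terms everywhere. *)
Definition interference (w : Om) : \bar R :=
  (\sum_(j < K) \sum_(n <oo) (c j (Y j n w) * Num.max (V j n w) 0)%:E)%E.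

Lemma interference_ge0 w : (0 <= interference w)%E.
Proof. by apply: sume_ge0 => j _; apply: nneseries_ge0 => n _ _; rewrite lee_fin mark0. Qed.

Lemma adapted_interference b : adapted (others components (inl b)) interference.
Proof.
apply: emeasurable_sum => j; apply: ge0_emeasurable_sum => [n w _ _|n _].
  by rewrite lee_fin mark0.
apply/measurable_EFinP; apply: measurable_funM.
  apply: (measurableT_comp (mc j)).
  exact: (adapted_others components (inl b) (inr (inl j)) (Y j n) isT (components_Y j n)).
apply: measurable_maxr => //.
exact: (adapted_others components (inl b) (inr (inr (j, n))) (V j n) isT (components_V j n)).
Qed.

Lemma measurable_interference : measurable_fun setT interference.
Proof.
move=> _ B mB; have := @adapted_interference true measurableT B mB.
apply: smallest_sub; first exact: sigma_algebra_measurable.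
by apply: others_measurable; exact: measurable_components.
Qed.

Variable u : R.
Hypothesis u0 : 0 < u.
Local Notation mu := (@lebesgue_measure R).
Local Notation mu2 := (mu \x mu)%E.
Let f j y := u * c j y / (1 + u * c j y).
Let cu0 j y : 0 <= u * c j y. Proof. by rewrite mulr_ge0// ltW. Qed.
Let p0 j y : 0 < 1 + u * c j y. Proof. by rewrite ltr_pwDl. Qed.
Hypothesis foo : forall j, (\int[mu2]_y (f j y)%:E < +oo)%E.

Let mf j : measurable_fun setT (f j).
Proof.
apply: measurable_funM; first exact: measurable_funM.
apply: (measurableT_comp measurable_inv); apply: measurable_funD => //.
exact: measurable_funM.
Qed.

Let f01 j y : 0 <= f j y <= 1.
Proof.
apply/andP; split; first by apply: divr_ge0 => //; exact: ltW.
by rewrite /f ler_pdivrMr// mul1r lerDr.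
Qed.

Let partial N w := \sum_(j < K) \sum_(n < N) mark j n w.

(** Integrating out the marks turns each point into the factor 1/(1 + u c) = 1 - f; what remains
    depends on the positions alone, and the independence of the tiers splits the expectation. *)
Let laplace_partial N :
  Rintegral P setT (fun w => expR (- (u * partial N w))) =
  \prod_(j < K) Rintegral P setT (fun w => \prod_(n < N) (1 - f j (Y j n w))).
Proof.
have one01 : rv01 (fun _ : Om => 1 : R) by split=> // w; rewrite ler01 lexx.
pose s : seq (comp_index K) :=
  [seq inr (inr (j, val n)) | j <- enum 'I_K, n <- enum 'I_N].
have us : uniq s.
  apply: allpairs_uniq; rewrite ?enum_uniq// => -[j n] [j' n'] _ _ /= [-> nn].
  by congr (_, _); exact: val_inj.
(* The general lemma is indexed by all components of the model; outside the marks the families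
   receive dummy values. *)
pose Vc (i : comp_index K) := if i is inr (inr (j, n)) then V j n else (fun=> 0).
pose ac (i : comp_index K) w := if i is inr (inr (j, n)) then u * c j (Y j n w) else 0.
pose GY := [set A | exists j, components (inr (inl j)) A].
have aY j n : adapted GY (Y j n).
  by apply: adapted_generator => B mB; exists j; exact: components_Y.
have sP i : i \in s -> exists j n, i = inr (inr (j, n)).
  by move=> /allpairsP[[j n] [_ _ ->]]; exists j, (val n).
have H := expectation_marks P components sigma_algebra_components measurable_components hind
  s GY Vc ac (fun=> 1).
transitivity (Rintegral P setT
    (fun w => 1 * \prod_(i <- s) expR (- (ac i w * Num.max (Vc i w) 0)))).
  congr fine; apply: eq_integral => w _; congr EFin.
  rewrite mul1r big_allpairs_dep/= !big_enum/= mulr_sumr -sumrN expR_sum; apply: eq_bigr => j _.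
  rewrite mulr_sumr -sumrN expR_sum big_enum/=; apply: eq_bigr => n _.
  by rewrite /mark mulrA.
rewrite {}H//.
- pose U (i : comp_index K) w :=
    if i is inr (inl j) then \prod_(n < N) (1 - f j (Y j n w)) else 1.
  have H := expectation_prod P components sigma_algebra_components measurable_components hind
    [seq inr (inl j) | j <- enum 'I_K] U.
  transitivity (Rintegral P setT (fun w => \prod_(i <- [seq inr (inl j) | j <- enum 'I_K]) U i w)).
    congr fine; apply: eq_integral => w _; congr EFin.
    rewrite mul1r big_allpairs_dep/= big_map !big_enum/=; apply: eq_bigr => j _.
    rewrite big_enum/=; apply: eq_bigr => n _; rewrite /f.
    by field; rewrite gt_eqF.
  rewrite {}H//.
  + by rewrite big_map big_enum.
  + by rewrite map_inj_uniq ?enum_uniq// => j j' [].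
  + case=> [b|[j|jn]]; try exact: one01.
    apply: rv01_prod => n; apply: rv01_onem; split => //.
    exact: (measurableT_comp (mf j) (mY j n)).
  + move=> i B /mapP[j _ ->] mB.
    pose T : measurableType _ := g_sigma_algebraType (components (inr (inl j))).
    have mU : measurable_fun setT (fun w : T => \prod_(n < N) (1 - f j (Y j n w))).
      apply: measurable_prod => n _; apply: measurable_funB => //.
      apply: (measurableT_comp (mf j)).
      by apply: adapted_generator => B' mB'; exact: components_Y.
    have := mU measurableT B mB; rewrite setTI => h.
    have : <<s components (inr (inl j)) >> (U (inr (inl j)) @^-1` B) by exact: h.
    by rewrite sigma_algebra_id//; exact: sigma_algebra_components.
- by move=> A [j]; exact: measurable_components.
- by move=> i B /sP[j [n ->]] mB; exact: components_V.
- by move=> i /sP[j [n ->]] B mB; exact: hV.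
- by move=> i /sP[j [n ->]] A [j' FA]; exists (inr (inl j')).
- case=> [b|[j|[j n]]]; rewrite /adapted/ac//.
  by apply: measurable_funM => //; exact: (measurableT_comp (mc j) (aY j n)).
- by case=> [b|[j|[j n]]] w //=.
- exact: measurable_cst.
Qed.

(** The exponential e^(-uz) on [0, +oo], with its limit 0 as value at +oo: sample points of infinite
    interference need no separate treatment. *)
Definition expRe (z : \bar R) : R := if z is r%:E then expR (- (u * r)) else 0.

Let partialE N w : (\sum_(j < K) \sum_(0 <= n < N) (mark j n w)%:E = (partial N w)%:E)%E.
Proof.
by rewrite /partial -sumEFin; apply: eq_bigr => j _; rewrite big_mkord -sumEFin.
Qed.

Let cvg_partial w : (partial N w)%:E @[N --> \oo] --> interference w.
Proof.
under eq_fun do rewrite -partialE.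
apply: cvg_nnesum => j _.
  by apply: nearW => N; apply: sume_ge0 => n _; rewrite lee_fin.
by apply: is_cvg_nneseries => n _ _; rewrite lee_fin.
Qed.

Let cvg_expRe w : expR (- (u * partial N w)) @[N --> \oo] --> expRe (interference w).
Proof.
have := cvg_partial w; have := interference_ge0 w.
case: (interference w) => [r _|_|//] /=.
  move=> /fine_cvg/= h.
  apply: (@continuous_cvg _ _ _ _ _ (fun N => - (u * partial N w)) expR).
    exact: continuous_expR.
  by apply: cvgN; apply: cvgMr.
move=> /cvgeyPge h; apply/cvgrPdist_le => eps eps0.
(* Beyond this threshold the exponent u S is at least 1/eps, and e^x >= 1 + x yields e^(-uS) <=
   eps. *)
have := h (u^-1 * eps^-1); apply: filterS => N; rewrite lee_fin => hN.
rewrite sub0r normrN ger0_norm ?expR_ge0// expRN.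
rewrite -[eps]invrK lef_pV2 ?posrE ?expR_gt0 ?invr_gt0//.
apply: le_trans (expR_ge1Dx _); apply: ler_wpDl => //.
by rewrite -ler_pdivrMl.
Qed.

Let rv01_partial N : rv01 (fun w => expR (- (u * partial N w))).
Proof.
split.
  apply: measurableT_comp => //; apply: measurableT_comp => //; apply: measurable_funM => //.
  apply: measurable_sum => j; apply: measurable_sum => n.
  apply: measurable_funM; first exact: (measurableT_comp (mc j) (mY j n)).
  exact: measurable_maxr.
move=> w; rewrite expR_ge0 -expR0 ler_expR oppr_le0 mulr_ge0 ?(ltW u0)//.
by apply: sumr_ge0 => j _; apply: sumr_ge0.
Qed.

Lemma rv01_expRe : rv01 (fun w => expRe (interference w)).
Proof. by have [] := rv01_cvg P _ _ rv01_partial cvg_expRe. Qed.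

(** The same sequence has two limits: dominated convergence gives the left-hand side, and the
    Laplace functional of each Poisson process the right-hand side. *)
Lemma interference_laplace :
  Rintegral P setT (fun w => expRe (interference w)) =
  expR (- \sum_(j < K) ell j * fine (\int[mu2]_y (f j y)%:E)).
Proof.
have [_ c1] := rv01_cvg P _ _ rv01_partial cvg_expRe.
have c2 : Rintegral P setT (fun w => expR (- (u * partial N w))) @[N --> \oo] -->
   expR (- \sum_(j < K) ell j * fine (\int[mu2]_y (f j y)%:E)).
  under eq_fun do rewrite laplace_partial.
  rewrite -sumrN expR_sum; apply: cvg_big => [|j _]; first exact: mul_continuous.
  exact: (cvg_poisson_laplace P (Y j) (ell j) (mY j) (hY j) (f j) (mf j) (f01 j) (foo j)).
by rewrite -(cvg_lim _ c1)// (cvg_lim _ c2).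
Qed.

End weighted_points.
End model.

(** * Outage at a fixed serving distance *)

Section gamma_cdf.
Context {R : realType} {d : measure_display} {Om : measurableType d}.
Variables (P : probability Om R) (G : Om -> R) (M : nat).
Hypotheses (M0 : (0 < M)%N) (hG : has_density P G (gamma_pdf M)).
Local Notation mu := (@lebesgue_measure R).

(** The derivative of e^(-x) x^m / m! is a difference of two consecutive such terms, so the sum
    telescopes to the Gamma density of shape N + 1. *)
Lemma is_derive_poisson_sum (N : nat) (x : R) :
  is_derive x (1 : R) (fun x => - (expR (- x) * \sum_(m < N.+1) x ^+ m / m`!%:R))
    (x ^+ N * expR (- x) / N`!%:R).
Proof.
elim: N x => [|N IH] x.
  rewrite (_ : (fun _ => _) = (fun x => - expR (- x))); last first.
    by apply/funext => y; rewrite big_ord_recl big_ord0 /= fact0 divr1 expr0 addr0 mulr1.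
  apply: is_derive_eq; rewrite fact0 /GRing.scale/= expr0 divr1; ring.
rewrite (_ : (fun _ => _) = (fun x => - (expR (- x) * \sum_(m < N.+1) x ^+ m / m`!%:R) -
    expR (- x) * (N.+1`!%:R^-1 * x ^+ N.+1))); last first.
  by apply/funext => y; rewrite big_ord_recr/=; ring.
have H := IH x.
have f0 : N`!%:R != 0 :> R by rewrite pnatr_eq0 -lt0n fact_gt0.
have n0 : N%:R + 1 != 0 :> R by rewrite natr1 pnatr_eq0.
have D : is_derive x (1 : R) (fun x => expR (- x) * (N.+1`!%:R^-1 * x ^+ N.+1))
    (x ^+ N * expR (- x) / N`!%:R - x ^+ N.+1 * expR (- x) / N.+1`!%:R).
  have D1 : is_derive x (1 : R) (fun x => expR (- x)) (- expR (- x)).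
    by apply: is_derive_eq; rewrite /GRing.scale/=; ring.
  have D2 : is_derive x (1 : R) (fun x => x ^+ N.+1) (N.+1%:R * x ^+ N).
    have := @is_deriveX R R id N.+1 x 1 1 (is_derive_id _ _).
    by rewrite /GRing.scale/= mulr1 (_ : id ^+ N.+1 = (fun x => x ^+ N.+1))//; apply/funext => y; rewrite exprfctE.
  have := is_deriveZ (N.+1`!%:R^-1) (is_deriveM D1 D2).
  rewrite (_ : _ \*: _ = (fun x => expR (- x) * (N.+1`!%:R^-1 * x ^+ N.+1))); last first.
    by apply/funext => y; rewrite !fctE; exact: mulrCA.
  move=> D; apply: is_derive_eq.
  transitivity (N.+1`!%:R^-1 *
    (expR (- x) * (N.+1%:R * x ^+ N) + x ^+ N.+1 * - expR (- x))) => //.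
  rewrite factS natrM -natr1 exprS.
  by field; rewrite f0 n0.
by have := is_deriveB H D; rewrite subKr.
Qed.

Lemma gamma_cdf (r : R) : 0 <= r ->
  P [set w | G w < r] = (1 - \sum_(m < M) expR (- r) * r ^+ m / m`!%:R)%:E.
Proof.
move=> r0.
have -> : [set w | G w < r] = G @^-1` `]-oo, r[%classic.
  by apply/seteqP; split => w /=; rewrite in_itv.
rewrite hG//.
pose g (x : R) := x ^+ M.-1 * expR (- x) / (M.-1)`!%:R.
have cg : continuous g.
  move=> x; apply: cvgMl; apply: cvgM; first exact: exprn_continuous.
  by apply: (continuous_comp (f := -%R) (g := expR)); [exact: oppr_continuous|exact: continuous_expR].
transitivity (\int[mu]_(x in `]0%R, r[) (g x)%:E)%E.
  rewrite integral_mkcond [RHS]integral_mkcond; apply: eq_integral => x _.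
  rewrite !patchE !mem_setE !in_itv/= /gamma_pdf /g.
  by case: (ltP 0 x) => x0; case: (ltP x r).
rewrite -(@integral_itv_bndoo _ _ _ _ true false); last first.
  by apply/measurable_EFinP; apply: measurable_funTS; exact: continuous_measurable_fun.
have dF (x : R) := is_derive_poisson_sum M.-1 x.
have cS : {within `[0, r], continuous g} by apply: continuous_subspaceT => x; exact: cg.
rewrite (is_derive_FTC2 _ g 0 r r0 (fun x _ => dF x) cS).
rewrite prednK//; congr EFin; rewrite oppr0 expR0 mul1r.
rewrite [X in _ - - X](_ : _ = 1); last first.
  rewrite -(prednK M0) big_ord_recl/= fact0 divr1 expr0 big1 ?addr0// => i _.
  by rewrite /bump/= expr0n/= mul0r.
rewrite opprK addrC; congr (1 - _); rewrite mulr_sumr; apply: eq_bigr => m _.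
by rewrite mulrA.
Qed.

End gamma_cdf.

Section poisson_term.
Context {R : realType}.

(** Given Z = z, the Gamma gain of integer shape M is at least z with probability the sum of these
    terms over m < M. The value 0 at +oo is the limit. *)
Definition poisson_term m (z : \bar R) : R :=
  if z is r%:E then expR (- r) * r ^+ m / m`!%:R else 0.

Lemma rv01_poisson_term {d} {Om : measurableType d} m (Z : Om -> \bar R) :
  measurable_fun setT Z -> (forall w, (0 <= Z w)%E) -> rv01 (fun w => poisson_term m (Z w)).
Proof.
move=> mZ Z0; split; last first.
  move=> w; have := Z0 w; rewrite /poisson_term; case: (Z w) => [r|_|//]; last first.
    by rewrite lexx ler01.
  rewrite lee_fin => r0; rewrite !mulr_ge0 ?expR_ge0 ?exprn_ge0 ?invr_ge0//=.
  have := exp_coeff_le_expR r m r0; rewrite expRN -mulrA => h.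
  by rewrite ler_pdivrMl ?expR_gt0// mulr1.
(* [fine] sends +oo to 0, where the term of order m = 0 equals 1; the indicator restores the value 0
   there. *)
rewrite (_ : (fun w => _) = (fun w => expR (- fine (Z w)) * fine (Z w) ^+ m / m`!%:R *
   \1_(~` (Z @^-1` [set +oo%E])) w)); last first.
  apply/funext => w; rewrite indicE; have := Z0 w; case E : (Z w) => [r||] // _ /=.
    by rewrite mem_set ?mulr1// /= E.
  by rewrite memNset ?mulr0// /= E; apply.
have mf : measurable_fun setT (fun w => fine (Z w)) by exact: measurableT_comp.
have mI : measurable (~` (Z @^-1` [set +oo%E])).
  apply: measurableC; have := mZ measurableT [set +oo%E] (emeasurable_set1 _).
  by rewrite setTI.
apply: measurable_funM; last exact: measurable_indic.
apply: measurable_funM => //; apply: measurable_funM; last exact: measurable_funX.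
by apply: measurableT_comp => //; apply: measurableT_comp.
Qed.

(** Writing e^(-(1-s)z) = e^(-z) e^(sz), the factor e^(-z) cancels the constant e^z of the Taylor
    bound: the remainder is uniform in z, and can be integrated without any moment of the
    interference. *)
Lemma expRe_taylor (s : R) M (z : \bar R) : 0 <= s <= 1 -> (0 <= z)%E ->
  0 <= expRe (1 - s) z - \sum_(m < M) s ^+ m * poisson_term m z <= s ^+ M.
Proof.
move=> s01; case: z => [r|_|//] /=; last first.
  by rewrite big1 ?subr0 ?lexx ?exprn_ge0//; [case/andP: s01|move=> m _; rewrite mulr0].
rewrite lee_fin => r0; have /andP[h1 h2] := expR_taylor_bound s r M s01 r0.
have -> : expR (- ((1 - s) * r)) = expR (- r) * expR (s * r) by rewrite -expRD; congr expR; ring.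
have -> : \sum_(m < M) s ^+ m * (expR (- r) * r ^+ m / m`!%:R) =
    expR (- r) * \sum_(m < M) (s * r) ^+ m / m`!%:R.
  by rewrite mulr_sumr; apply: eq_bigr => m _; rewrite exprMn; ring.
rewrite -mulrBr mulr_ge0 ?expR_ge0//= expRN ler_pdivrMl ?expR_gt0//.
by rewrite [X in _ <= X]mulrC.
Qed.

Lemma Rintegral_lin_comb {d} {Om : measurableType d} (P : probability Om R)
    M (a : nat -> R) (W : nat -> Om -> R) : (forall m, rv01 (W m)) ->
  P.-integrable setT (EFin \o (fun w => \sum_(m < M) a m * W m w)) /\
  Rintegral P setT (fun w => \sum_(m < M) a m * W m w) = \sum_(m < M) a m * Rintegral P setT (W m).
Proof.
move=> rW; elim: M => [|M [iM EM]].
  split.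
    apply: (eq_integrable _ (cst 0%E)) => //; last exact: finite_measure_integrable_cst.
    by move=> w _ /=; rewrite big_ord0.
  by rewrite big_ord0; under eq_Rintegral do rewrite big_ord0; rewrite Rintegral_cst// mul0r.
have iW := rv01_integrable P (W M) (rW M).
have iaW : P.-integrable setT (EFin \o (fun w => a M * W M w)).
  exact: (@integrableZl _ _ _ P setT measurableT (a M) _ iW).
split.
  apply: (eq_integrable _ (fun w => (\sum_(m < M) a m * W m w)%:E + (a M * W M w)%:E)%E) => //; last exact: integrableD.
  by move=> w _ /=; rewrite big_ord_recr/= EFinD.
rewrite big_ord_recr/= -EM -RintegralZl// -RintegralD//.
by apply: eq_Rintegral => w _; rewrite big_ord_recr.
Qed.

End poisson_term.

Section gamma_exceedance.
Context {R : realType} {d : measure_display} {Om : measurableType d}.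
Variable P : probability Om R.
Context {I : eqType} (F : I -> set (set Om)).
Hypothesis sF : forall i, sigma_algebra setT (F i).
Hypothesis mF : forall i, F i `<=` measurable.
Hypothesis indF : mutually_independent P F.

Lemma gamma_exceedance i (G : Om -> R) (Z : Om -> \bar R) M : (0 < M)%N ->
  (forall B, measurable B -> F i (G @^-1` B)) -> has_density P G (gamma_pdf M) ->
  adapted (others F i) Z -> (forall w, (0 <= Z w)%E) ->
  P [set w | ((G w)%:E < Z w)%E] =
  (1 - \sum_(m < M) Rintegral P setT (fun w => poisson_term m (Z w)))%:E.
Proof.
move=> M0 FG hG aZ Z0.
have mG : measurable_fun setT G by move=> _ B mB; rewrite setTI; exact/mF/FG.
have mZ : measurable_fun setT Z.
  move=> _ B mB; have := aZ measurableT B mB.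
  apply: smallest_sub; first exact: sigma_algebra_measurable.
  by apply: others_measurable.
pose f (z : R * g_sigma_algebraType (others F i)) : \bar R :=
  (\1_[set z : R * g_sigma_algebraType (others F i) | (z.1%:E < Z z.2)%E] z)%:E.
have mf : measurable_fun setT f.
  apply/measurable_EFinP; apply: measurable_indic; rewrite -[X in measurable X]setTI.
  apply: measurable_lte => //.
    by apply/measurable_EFinP; exact: measurable_fst.
  exact: (measurableT_comp aZ measurable_snd).
have f0 z : (0 <= f z)%E by rewrite lee_fin.
have [_ E] := fubini_others P F sF mF indF i G f FG mf f0.
have mA : measurable [set w | ((G w)%:E < Z w)%E].
  rewrite -[X in measurable X]setTI; apply: measurable_lte => //.
  exact/measurable_EFinP.
transitivity (\int[P]_w f (G w, w))%E.
  transitivity (P ([set w | ((G w)%:E < Z w)%E] `&` setT)); first by rewrite setIT.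
  by rewrite -integral_indic.
rewrite {}E.
have rp m := rv01_poisson_term m Z mZ Z0.
have [iS ES] := Rintegral_lin_comb P M (fun=> 1) (fun m w => poisson_term m (Z w)) rp.
transitivity (\int[P]_w (1 - \sum_(m < M) 1 * poisson_term m (Z w))%:E)%E.
  apply: eq_integral => w' _.
  transitivity (P [set w | ((G w)%:E < Z w')%E]).
    have mB : measurable [set w | ((G w)%:E < Z w')%E].
      rewrite -[X in measurable X]setTI; apply: measurable_lte => //.
      exact/measurable_EFinP.
    transitivity (P ([set w | ((G w)%:E < Z w')%E] `&` setT)); last by rewrite setIT.
    by rewrite -integral_indic.
  have := Z0 w'; case: (Z w') => [r||] //=.
    rewrite lee_fin => r0; under [in RHS]eq_bigr do rewrite mul1r.
    rewrite -(gamma_cdf P G M M0 hG r r0).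
    by congr (P _); apply/seteqP; split => w /=; rewrite lte_fin.
  (* At Z = +oo the event is certain and all Poisson terms are 0. *)
  move=> _; rewrite big1; last by move=> m _; rewrite mulr0.
  rewrite subr0 -(probability_setT P); congr (P _).
  by apply/seteqP; split => w //= _; rewrite ltry.
rewrite -[LHS]fineK; last first.
  apply: integrable_fin_num => //.
  apply: (eq_integrable _ (fun w => (1 - (\sum_(m < M) 1 * poisson_term m (Z w))%:E)%E)) => //.
  by apply: integrableB => //; exact: finite_measure_integrable_cst.
congr EFin; transitivity (Rintegral P setT (fun w => 1 - \sum_(m < M) 1 * poisson_term m (Z w))).
  by [].
rewrite RintegralB//; last exact: finite_measure_integrable_cst.
rewrite ES; under [in LHS]eq_bigr do rewrite mul1r.
congr (_ - _).
by rewrite Rintegral_cst// mul1r -[RHS]/(fine 1%E); congr fine; exact: probability_setT.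
Qed.

End gamma_exceedance.

Section conditional_outage.
Context {R : realType} {K : nat} {d : measure_display} {Om : measurableType d}.
Variables (P : probability Om R) (X Gs : Om -> R) (Y : 'I_K -> nat -> Om -> R * R)
  (V : 'I_K -> nat -> Om -> R).
Hypotheses (mX : measurable_fun setT X) (mGs : measurable_fun setT Gs)
  (mY : forall j n, measurable_fun setT (Y j n))
  (mV : forall j n, measurable_fun setT (V j n)).
Hypothesis hV : forall j n B, measurable B ->
  P (V j n @^-1` B) = exponential_prob (1 : R) B.
Variable ell : 'I_K -> R.
Hypothesis hY : forall j, is_hPPP P (Y j) (ell j).
Hypothesis hind : mutually_independent P (components X Gs Y V).
Local Notation mu := (@lebesgue_measure R).
Local Notation mu2 := (mu \x mu)%E.

(** Z is interference plus the constant [sg]. The expectation of e^(-(1-s)Z) is computed twice: by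
    the Taylor bound it is the polynomial with coefficients p_m, up to s^M, and by the Laplace
    functional it is the exponential whose exponent [g] and [rho] expand. *)
Lemma interference_outage (M : nat) (c : 'I_K -> R * R -> R) (sg : R) (g : nat -> R) (rho : R -> R) :
  (0 < M)%N -> has_density P Gs (gamma_pdf M) ->
  (forall j, measurable_fun setT (c j)) -> (forall j y, 0 <= c j y) -> 0 <= sg ->
  (forall n, (0 < n)%N -> 0 <= g n) ->
  (exists C : R, forall s, 0 < s <= 2^-1 -> 0 <= rho s <= C * s ^+ M) ->
  (forall u j, 0 < u <= 1 -> (\int[mu2]_y (u * c j y / (1 + u * c j y))%:E < +oo)%E) ->
  (forall s, 0 < s <= 2^-1 ->
    \sum_(j < K) ell j * fine (\int[mu2]_y ((1 - s) * c j y / (1 + (1 - s) * c j y))%:E) =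
    g 0%N - \sum_(1 <= n < M) s ^+ n * g n - rho s) ->
  P [set w | ((Gs w)%:E < interference Y V c w + sg%:E)%E] =
  (1 - \sum_(m < M) expR (- sg - g 0%N) *
     \sum_(n < m.+1) sg ^+ (m - n) / (m - n)`!%:R *
       \sum_(i < M) (i`!%:R)^-1 * mxentry (toeplitz M g ^+ i) n 0)%:E.
Proof.
move=> M0 hGs mc c0 sg0 gn0 rhoO foo hE.
have I0 := interference_ge0 Y V c c0.
pose Z w := (interference Y V c w + sg%:E)%E.
have Z0 w : (0 <= Z w)%E by rewrite adde_ge0// lee_fin.
have mI := measurable_interference X Gs Y V mX mGs mY mV c mc c0.
have mZ : measurable_fun setT Z by exact: emeasurable_funD.
have aZ : adapted (others (components X Gs Y V) (inl false)) Z.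
  apply: emeasurable_funD => //.
  exact: (adapted_interference X Gs Y V c mc c0 false).
rewrite (gamma_exceedance P (components X Gs Y V) (sigma_algebra_components X Gs Y V)
  (measurable_components X Gs Y V mX mGs mY mV) hind (inl false) Gs Z M M0
  (components_G X Gs Y V) hGs aZ Z0).
congr EFin; congr (1 - _); apply: eq_bigr => m _.
pose p m := Rintegral P setT (fun w => poisson_term m (Z w)).
apply: (outage_coefficients M g p sg (g 0%N) rho) => //.
exists 1 => s /andP[s0 s12].
have s1 : s < 1 by apply: le_lt_trans s12 _; rewrite invf_lt1// ltr1n.
have u0 : 0 < 1 - s by rewrite subr_gt0.
have s01 : 0 <= s <= 1 by rewrite !ltW.
have foos j := foo (1 - s) j.
have u01 : 0 < 1 - s <= 1 by rewrite u0 gerBl ltW.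
rewrite -hE ?s0// expRD expRN.
have L := interference_laplace P X Gs Y V mX mGs mY mV hV ell hY hind c mc c0 (1 - s) u0
   (fun j => foos j u01).
have rI := rv01_expRe P Y V mY mV c mc c0 (1 - s) u0.
have ZI w : expRe (1 - s) (Z w) =
    expR (- ((1 - s) * sg)) * expRe (1 - s) (interference Y V c w).
  rewrite /Z; have := I0 w; case: (interference Y V c w) => [r||] //= _; last by rewrite mulr0.
  by rewrite -expRD; congr expR; ring.
have eE : Rintegral P setT (fun w => expRe (1 - s) (Z w)) =
    expR (- ((1 - s) * sg)) * expR (- \sum_(j < K)
      ell j * fine (\int[mu2]_y ((1 - s) * c j y / (1 + (1 - s) * c j y))%:E)).
  under eq_Rintegral do rewrite ZI.
  by rewrite RintegralZl// ?L//; exact: rv01_integrable.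
have iZ : P.-integrable setT (EFin \o (fun w => expRe (1 - s) (Z w))).
  apply: (eq_integrable _ (fun w => (expR (- ((1 - s) * sg)))%:E *
    (expRe (1 - s) (interference Y V c w))%:E)%E) => //.
    by move=> w _ /=; rewrite ZI.
  by apply: integrableZl => //; exact: rv01_integrable.
have rp m' := rv01_poisson_term m' Z mZ Z0.
have [iS ES] := Rintegral_lin_comb P M (fun m => s ^+ m) (fun m w => poisson_term m (Z w)) rp.
rewrite -expRN -eE /p -ES distrC -RintegralB// mul1r.
have T w := expRe_taylor s M (Z w) s01 (Z0 w).
rewrite ger0_norm; last by apply: Rintegral_ge0 => // w _; have /andP[] := T w.
apply: (@le_trans _ _ (Rintegral P setT (fun=> s ^+ M))).
  apply: le_Rintegral => //.
  - exact: (eq_integrable _ _ _ _ (integrableB measurableT iZ iS)).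
  - exact: finite_measure_integrable_cst.
  - by move=> w _; have /andP[] := T w.
by rewrite Rintegral_cst// (_ : fine _ = 1) ?mulr1// [X in fine X]probability_setT.
Qed.

End conditional_outage.

(** * Power-law path loss outside the exclusion discs *)

Section power_law.
Context {R : realType}.
Local Notation mu := (@lebesgue_measure R).
Local Notation mu2 := (mu \x mu)%E.

(** Normalised to tau (r/|y|)^a, so that it equals tau t in the variable t of the radial
    substitution and tends to tau at the edge of the excluded disc. *)
Definition path_gain (r a tau : R) (y : R * R) : R :=
  if r < norm2 y then tau * (r `^ a * norm2 y `^ (- a)) else 0.

Lemma path_gain_ge0 r a tau y : 0 <= tau -> 0 <= path_gain r a tau y.
Proof. by move=> tau0; rewrite /path_gain; case: ifP => // _; rewrite !mulr_ge0 ?powR_ge0. Qed.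

Lemma measurable_norm2 : measurable_fun setT (@norm2 R).
Proof.
have m1 : measurable_fun setT (fun y : R * R => y.1) by exact: measurable_fst.
have m2 : measurable_fun setT (fun y : R * R => y.2) by exact: measurable_snd.
have ms : measurable_fun setT (Num.sqrt : R -> R).
  by apply: continuous_measurable_fun; exact: sqrt_continuous.
by apply: (measurableT_comp ms); apply: measurable_funD; apply: measurable_funX.
Qed.

Lemma measurable_path_gain r a tau : measurable_fun setT (path_gain r a tau).
Proof.
apply: measurable_fun_ifT => //.
  by apply: measurable_fun_ltr => //; exact: measurable_norm2.
apply: measurable_funM => //; apply: measurable_funM => //.
exact: (measurableT_comp (measurable_powR (- a)) measurable_norm2).
Qed.

Section tier.
Variables r a tau u : R.
Hypotheses (r0 : 0 < r) (a2 : 2 < a) (tau0 : 0 < tau) (u0 : 0 < u).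

Let dl01 : 0 < 2 / a < 1.
Proof.
have a0 : 0 < a by apply: lt_trans a2.
by rewrite divr_gt0//= ltr_pdivrMr// mul1r.
Qed.

Let F (t : R) := u * (tau * t) / (1 + u * (tau * t)).
Let p0 t : 0 < t -> 0 < 1 + u * (tau * t).
Proof. by move=> t0; rewrite addr_gt0// !mulr_gt0. Qed.
Let mF : measurable_fun setT F.
Proof.
have mc : measurable_fun setT (fun t => u * (tau * t)).
  by apply: measurable_funM => //; apply: measurable_funM.
apply: measurable_funM => //; apply: (measurableT_comp (@measurable_inv R)).
exact: measurable_funD.
Qed.
Let F0 t : 0 < t -> 0 <= F t.
Proof. by move=> t0; rewrite divr_ge0// ?(ltW (p0 t t0))// !mulr_ge0// ltW. Qed.

Lemma integral_path_gain :
  (\int[mu2]_y (u * path_gain r a tau y / (1 + u * path_gain r a tau y))%:E =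
  (pi * r ^+ 2 * weighted_integral (2 / a) F)%:E)%E.
Proof.
transitivity (\int[mu2]_y (if r < norm2 y then F (r `^ a * norm2 y `^ (- a)) else 0)%:E)%E.
  apply: eq_integral => y _; rewrite /path_gain; case: ifP => // _.
  by rewrite mulr0 mul0r.
rewrite integral_radial_power//.
- rewrite [RHS]EFinM; congr (_ * _)%E; rewrite /weighted_integral fineK//.
  apply: integrable_fin_num => //.
  apply: (integrable_weight _ dl01 F (u * tau)) => // t /andP[t0 _].
  rewrite ger0_norm ?F0// ler_pdivrMr ?p0// mulrA ler_peMr ?(ltW (mulr_gt0 (mulr_gt0 u0 tau0) t0))//.
  by rewrite lerDl; rewrite !mulr_ge0// ltW.
- by apply: lt_trans a2.
- move=> t t0; apply: cvgM; first by apply: cvgMr; apply: cvgMr.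
  apply: cvgV; first by rewrite gt_eqF// p0.
  by apply: cvgD; [exact: cvg_cst|apply: cvgMr; apply: cvgMr].
Qed.

End tier.

Section outage.
Context {K : nat} {d : measure_display} {Om : measurableType d}.
Variables (P : probability Om R) (X Gs : Om -> R) (Y : 'I_K -> nat -> Om -> R * R)
  (V : 'I_K -> nat -> Om -> R).
Hypotheses (mX : measurable_fun setT X) (mGs : measurable_fun setT Gs)
  (mY : forall j n, measurable_fun setT (Y j n))
  (mV : forall j n, measurable_fun setT (V j n)).
Hypothesis hV : forall j n B, measurable B ->
  P (V j n @^-1` B) = exponential_prob (1 : R) B.
Variable ell : 'I_K -> R.
Hypothesis hY : forall j, is_hPPP P (Y j) (ell j).
Hypothesis hind : mutually_independent P (components X Gs Y V).

Lemma power_law_outage (M : nat) (r a tau : 'I_K -> R) (sg : R) :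
  (0 < M)%N -> has_density P Gs (gamma_pdf M) ->
  (forall j, 0 <= ell j) -> (forall j, 0 < r j) -> (forall j, 2 < a j) -> (forall j, 0 < tau j) ->
  0 <= sg ->
  let g n := \sum_(j < K) ell j * (pi * r j ^+ 2) *
    weighted_integral (2 / a j) (tier_coef (tau j) n) in
  P [set w | ((Gs w)%:E <
     interference Y V (fun j => path_gain (r j) (a j) (tau j)) w + sg%:E)%E] =
  (1 - \sum_(m < M) expR (- sg - g 0%N) *
     \sum_(n < m.+1) sg ^+ (m - n) / (m - n)`!%:R *
       \sum_(i < M) (i`!%:R)^-1 * mxentry (toeplitz M g ^+ i) n 0)%:E.
Proof.
move=> M0 hGs ell0 r0 a2 tau0 sg0 g.
have dl01 j : 0 < 2 / a j < 1.
  have a0 : 0 < a j by apply: lt_trans (a2 j).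
  by rewrite divr_gt0//= ltr_pdivrMr// mul1r.
have A0 j : 0 <= ell j * (pi * r j ^+ 2) by rewrite mulr_ge0// mulr_ge0 ?pi_ge0 ?sqr_ge0.
have tc0 j n t : 0 < t -> 0 <= tier_coef (tau j) n t.
  move=> t0; have h : 0 <= tau j * t by rewrite mulr_ge0// ltW.
  rewrite /tier_coef; case: ifP => _; first by rewrite divr_ge0// addr_ge0.
  by rewrite divr_ge0// exprn_ge0// addr_ge0.
pose lin j := weighted_integral (2 / a j) (fun t => tau j * t).
have hsum s : 0 < s <= 2^-1 ->
    exists2 rho : R, 0 <= rho <= \sum_(j < K) ell j * (pi * r j ^+ 2) * lin j * s ^+ M &
    \sum_(j < K) ell j * fine (\int[mu2]_y ((1 - s) * path_gain (r j) (a j) (tau j) y /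
      (1 + (1 - s) * path_gain (r j) (a j) (tau j) y))%:E) =
    g 0%N - \sum_(1 <= n < M) s ^+ n * g n - rho.
  move=> /andP[s0 s12].
  have s1 : s < 1 by apply: le_lt_trans s12 _; rewrite invf_lt1// ltr1n.
  have u0 : 0 < 1 - s by rewrite subr_gt0.
  have s01 : 0 <= s <= 1 by rewrite !ltW.
  have /choice[rho hrho] j : exists rho : R, 0 <= rho <= s ^+ M * lin j /\
    weighted_integral (2 / a j) (fun t => (1 - s) * (tau j * t) / (1 + (1 - s) * (tau j * t))) =
    weighted_integral (2 / a j) (tier_coef (tau j) 0) -
    \sum_(1 <= n < M) s ^+ n * weighted_integral (2 / a j) (tier_coef (tau j) n) - rho.
    have [rho h1 h2] := weighted_integral_expansion (2 / a j) (dl01 j) (tau j) (tau0 j) s M s01 M0.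
    by exists rho.
  exists (\sum_(j < K) ell j * (pi * r j ^+ 2) * rho j).
    apply/andP; split.
      by apply: sumr_ge0 => j _; rewrite mulr_ge0//; have [/andP[]] := hrho j.
    apply: ler_sum => j _; rewrite -[leRHS]mulrA ler_wpM2l// mulrC.
    by have [/andP[]] := hrho j.
  have -> : \sum_(1 <= n < M) s ^+ n * g n = \sum_(j < K) ell j * (pi * r j ^+ 2) *
      \sum_(1 <= n < M) s ^+ n * weighted_integral (2 / a j) (tier_coef (tau j) n).
    rewrite /g; under eq_bigr do rewrite mulr_sumr.
    rewrite exchange_big/=; apply: eq_bigr => j _.
    by rewrite mulr_sumr; apply: eq_bigr => n _; ring.
  rewrite -!sumrB; apply: eq_bigr => j _.
  by rewrite integral_path_gain//=; have [_ ->] := hrho j; rewrite mulrA !mulrBr.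
(* [hsum] yields a remainder for each s separately; as a function of s it is defined as the
   difference, and [hsum] serves only to bound it. *)
pose rho s := g 0%N - \sum_(1 <= n < M) s ^+ n * g n -
  \sum_(j < K) ell j * fine (\int[mu2]_y ((1 - s) * path_gain (r j) (a j) (tau j) y /
      (1 + (1 - s) * path_gain (r j) (a j) (tau j) y))%:E).
apply: (interference_outage P X Gs Y V mX mGs mY mV hV ell hY hind M _ sg g rho) => //.
- by move=> j; exact: measurable_path_gain.
- by move=> j y; apply: path_gain_ge0; exact: ltW.
- move=> n _; apply: sumr_ge0 => j _; rewrite mulr_ge0//.
  by apply: weighted_integral_ge0 => // t /andP[t0 _]; exact: tc0.
- exists (\sum_(j < K) ell j * (pi * r j ^+ 2) * lin j) => s s0.
  have [rh h E] := hsum s s0; rewrite /rho E mulr_suml.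
  by rewrite opprB addrC subrK.
- move=> u j /andP[u0 _].
  by rewrite integral_path_gain// ltry.
- by move=> s s0; rewrite /rho subKr.
Qed.

End outage.
End power_law.

Lemma mxentry_scaleX {R : realType} n (A : 'M[R]_n) (c : R) i p q :
  mxentry ((c *: A) ^+ i) p q = c ^+ i * mxentry (A ^+ i) p q.
Proof.
have -> : (c *: A) ^+ i = c ^+ i *: (A ^+ i).
  elim: i => [|i IH]; first by rewrite !expr0 scale1r.
  rewrite !exprS IH -[LHS]/((c *: A) *m (c ^+ i *: A ^+ i)).
  by rewrite -scalemxAl -scalemxAr scalerA.
by rewrite /mxentry; case: insub => [p'|]; [case: insub => [q'|]|]; rewrite ?mxE ?mulr0.
Qed.

Section network.
Context {R : realType} {K : nat}.
Variables (lam Pw Bb al : 'I_K -> R) (Mn : 'I_K -> nat) (eps lamu W beta : R).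
Hypotheses (hlam : forall j, 0 < lam j) (hPw : forall j, 0 < Pw j)
  (hBb : forall j, 0 < Bb j) (hMn : forall j, (0 < Mn j)%N)
  (hal : forall j, 2 < al j) (hlamu : 0 < lamu)
  (hW : 0 <= W) (hbeta : 0 < beta).
Variable k : 'I_K.
Local Notation Omg := (Omg Pw Bb Mn).
Local Notation gkn := (gkn lam Pw Bb al Mn eps lamu beta k).
Local Notation Qmx := (Qmx lam Pw Bb al Mn eps lamu beta k).
Local Notation phi := (phi Bb al Mn beta).
Local Notation tau := (tau Bb Mn beta).
Local Notation sig := (sig Pw W beta k).
Local Notation rjk := (rjk Pw Bb al Mn).
Local Notation Act := (Act lam Pw Bb al Mn eps lamu).

Let hM j : 0 < (Mn j)%:R :> R. Proof. by rewrite ltr0n. Qed.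
Let al0 j : 0 < al j. Proof. exact: lt_trans (hal j). Qed.

Lemma Omg_gt0 j : 0 < Omg j.
Proof. by rewrite /Omg !mulr_gt0. Qed.

Lemma dlt_bounds j : 0 < dlt al j < 1.
Proof. by rewrite /dlt divr_gt0//= ltr_pdivrMr// mul1r. Qed.

Lemma tau_gt0 j : 0 < tau j k.
Proof. by rewrite /tau divr_gt0// mulr_gt0// divr_gt0. Qed.

Lemma sig_ge0 : 0 <= sig.
Proof. by rewrite /sig divr_ge0// ?mulr_ge0// ltW. Qed.

Lemma Act_ge0 j : 0 <= Act j.
Proof.
rewrite subr_ge0 -[X in _ <= X](@expR0 R) ler_expR oppr_le0.
rewrite !mulr_ge0 ?pi_ge0 ?(ltW hlamu)//.
by apply: Rintegral_ge0 => x _; exact: expR_ge0.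
Qed.

Lemma phi_weighted_integral j n :
  phi j k n = weighted_integral (dlt al j) (tier_coef (tau j k) n).
Proof.
rewrite /phi; case: eqP => [->|/eqP n0].
  by rewrite -(weighted_integral_hyp2F1_0 _ (dlt_bounds j) _ (tau_gt0 j)).
by rewrite -(weighted_integral_hyp2F1 _ (dlt_bounds j) _ (tau_gt0 j) _ _)// lt0n.
Qed.

Lemma rjk_gt0 j x : 0 < x -> 0 < rjk j k x.
Proof. by move=> x0; rewrite /rjk mulr_gt0// powR_gt0// divr_gt0// Omg_gt0. Qed.

(** The area factor of the excluded disc is the source of the terms [(Omg j / Omg k) ^ dlt j] and
    x^(delta_{j,k}) in [gkn], the variable there being the squared serving distance. *)
Lemma sqr_rjk j x : 0 < x ->
  rjk j k x ^+ 2 = (Omg j / Omg k) `^ dlt al j * (x ^+ 2) `^ (dlt al j / dlt al k).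
Proof.
move=> x0; have aj := al0 j; have ak := al0 k.
have aj0 : al j != 0 by rewrite gt_eqF.
have ak0 : al k != 0 by rewrite gt_eqF.
rewrite /rjk exprMn -!powR_mulrn ?powR_ge0 ?(ltW x0)// -!powRrM /dlt.
by congr (_ `^ _ * _ `^ _); field; rewrite ?aj0 ?ak0.
Qed.

Lemma powR_rjk j x : 0 < x -> rjk j k x `^ al j = Omg j / Omg k * x `^ al k.
Proof.
move=> x0; have aj0 : al j != 0 by rewrite gt_eqF.
have O0 : 0 <= Omg j / Omg k by rewrite divr_ge0// ltW// Omg_gt0.
rewrite /rjk powRM ?powR_ge0// -!powRrM mulVf// powRr1//.
by congr (_ * _ `^ _); field.
Qed.

(** Conditional probability of no outage as a function of the squared serving distance v. It has one
    factor pi less than the outage formula: that factor comes from the density, 2 pi lambda x dx =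
    pi lambda dv. *)
Definition success_probability (v : R) : R :=
  \sum_(i < Mn k) \sum_(m < Mn k) \sum_(n < m.+1)
    pi ^+ i * sig ^+ (m - n) / ((m - n)`!%:R * i`!%:R) * v `^ (al k / 2 * (m - n)%:R) *
    expR (- (sig * v `^ (al k / 2)) - pi * gkn 0 v) * mxentry (Qmx v ^+ i) n 0.

Lemma toeplitz_Qmx v i n :
  mxentry (toeplitz (Mn k) (fun n => pi * gkn n v) ^+ i) n 0 = pi ^+ i * mxentry (Qmx v ^+ i) n 0.
Proof.
have -> : toeplitz (Mn k) (fun n => pi * gkn n v) = pi *: Qmx v.
  by apply/matrixP => p q; rewrite !mxE; case: ifP => // _; rewrite mulr0.
exact: mxentry_scaleX.
Qed.

Lemma successE v : 0 <= v ->
  success_probability v = \sum_(m < Mn k) expR (- (sig * v `^ (al k / 2)) - pi * gkn 0 v) *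
     \sum_(n < m.+1) (sig * v `^ (al k / 2)) ^+ (m - n) / (m - n)`!%:R *
       \sum_(i < Mn k) (i`!%:R)^-1 *
         mxentry (toeplitz (Mn k) (fun n => pi * gkn n v) ^+ i) n 0.
Proof.
move=> v0; rewrite /success_probability exchange_big/=; apply: eq_bigr => m _.
rewrite exchange_big/=; move: (gkn 0 v) => g0; rewrite mulr_sumr; apply: eq_bigr => n _.
rewrite !mulr_sumr; apply: eq_bigr => i _; rewrite toeplitz_Qmx.
rewrite [X in _ = _ * (X / _ * _)](_ : _ = sig ^+ (m - n) * v `^ (al k / 2 * (m - n)%:R)); last first.
  rewrite exprMn; congr (_ * _).
  by rewrite -[LHS]powR_mulrn ?powR_ge0// -powRrM.
rewrite invfM.
ring.
Qed.

Section conditional.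
Context {d : measure_display} {Om : measurableType d}.
Variables (P : probability Om R) (X Gs : Om -> R) (Y : 'I_K -> nat -> Om -> R * R)
  (V : 'I_K -> nat -> Om -> R).
Hypotheses (mX : measurable_fun setT X) (mGs : measurable_fun setT Gs)
  (mY : forall j n, measurable_fun setT (Y j n))
  (mV : forall j n, measurable_fun setT (V j n)).
Hypothesis hV : forall j n B, measurable B ->
  P (V j n @^-1` B) = exponential_prob (1 : R) B.
Hypothesis hGs : has_density P Gs (gamma_pdf (Mn k)).
Hypothesis hY : forall j, is_hPPP P (Y j) (Act j * lam j).
Hypothesis hind : mutually_independent P (components X Gs Y V).

(** The interference of the statement with the serving distance frozen at x and each mark replaced
    by its positive part, which changes it only on a null event. *)
Definition received_interference (x : R) (w : Om) : \bar R :=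
  (\sum_(j < K) \sum_(n <oo) (if rjk j k x < norm2 (Y j n w)
     then Pw j * Num.max (V j n w) 0 * norm2 (Y j n w) `^ (- al j) else 0)%:E)%E.

(** The constant tau_{j,k} is made for this: tau_{j,k} Omega_j / Omega_k = beta P_j / P_k, while
    r_{j,k}^alpha_j = (Omega_j / Omega_k) x^alpha_k. The rescaled contribution of a point is
    therefore tau_{j,k} (r_{j,k}/|y|)^alpha_j times its mark. *)
Lemma received_interferenceE x w : 0 < x ->
  ((beta * x `^ al k / Pw k)%:E * received_interference x w =
   interference Y V (fun j => path_gain (rjk j k x) (al j) (tau j k)) w)%E.
Proof.
move=> x0; have ka0 : 0 < beta * x `^ al k / Pw k by rewrite divr_gt0 ?mulr_gt0 ?powR_gt0.
have t0 j n : (0 <= (if rjk j k x < norm2 (Y j n w)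
     then Pw j * Num.max (V j n w) 0 * norm2 (Y j n w) `^ (- al j) else 0)%:E)%E.
  rewrite lee_fin; case: ifP => // _.
  by rewrite !mulr_ge0 ?powR_ge0 ?(ltW (hPw j))// le_max lexx orbT.
rewrite ge0_sume_distrr; last by move=> j _; apply: nneseries_ge0 => n _ _; exact: t0.
apply: eq_bigr => j _; rewrite -nneseriesZl; last by move=> n _; exact: t0.
apply: eq_eseriesr => n _; rewrite -EFinM /path_gain; congr EFin.
case: ifP => _; last by rewrite mulr0 mul0r.
rewrite powR_rjk// /tau /Omg.
have h1 : Pw k != 0 by rewrite gt_eqF.
have h2 : Bb k != 0 by rewrite gt_eqF.
have h3 : Bb j != 0 by rewrite gt_eqF.
have h4 : (Mn j)%:R != 0 :> R by rewrite gt_eqF.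
have h5 : (Mn k)%:R != 0 :> R by rewrite gt_eqF.
by field; rewrite h1 h2 h3 h4 h5.
Qed.

Lemma conditional_outage x : 0 < x ->
  P [set w | ((Pw k * Gs w * x `^ (- al k))%:E <
     beta%:E * (received_interference x w + W%:E))%E] = (1 - success_probability (x ^+ 2))%:E.
Proof.
move=> x0; have xa0 : 0 < x `^ al k by rewrite powR_gt0.
have x2a : (x ^+ 2) `^ (al k / 2) = x `^ al k.
  by rewrite -powR_mulrn ?(ltW x0)// -powRrM mulrC divfK.
have ell0 j : 0 <= Act j * lam j by rewrite mulr_ge0 ?Act_ge0// ltW.
have sg0 : 0 <= sig * x `^ al k by rewrite mulr_ge0 ?sig_ge0// ltW.
have H := power_law_outage P X Gs Y V mX mGs mY mV hV (fun j => Act j * lam j) hY hind (Mn k)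
  (fun j => rjk j k x) al (fun j => tau j k) (sig * x `^ al k) (hMn k) hGs ell0
  (fun j => rjk_gt0 j x x0) hal tau_gt0 sg0.
have ka0 : 0 < beta * x `^ al k / Pw k by rewrite divr_gt0 ?mulr_gt0.
have c0 j y : 0 <= path_gain (rjk j k x) (al j) (tau j k) y.
  by apply: path_gain_ge0; exact/ltW/tau_gt0.
have E w : ((Pw k * Gs w * x `^ (- al k))%:E < beta%:E * (received_interference x w + W%:E))%E =
   ((Gs w)%:E < interference Y V
     (fun j => path_gain (rjk j k x) (al j) (tau j k)) w + (sig * x `^ al k)%:E)%E.
  have := interference_ge0 Y V _ c0 w; rewrite -received_interferenceE//.
  rewrite powRN /sig; have y0 : x `^ al k != 0 by rewrite gt_eqF.
  have p0 : Pw k != 0 by rewrite gt_eqF.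
  case: (received_interference x w) => [r||] //=.
  - move=> _; rewrite -!EFinD -!EFinM !lte_fin.
    have yp : 0 < x `^ al k / Pw k by rewrite divr_gt0.
    (* Multiplication by x^alpha_k / P_k isolates the gain and turns the noise into sigma_k
       x^alpha_k. *)
    rewrite -(ltr_pM2l yp); congr (_ < _); field; rewrite ?y0 ?p0//.
  - by move=> _; rewrite !gt0_muley ?lte_fin//= !ltry.
  - by rewrite gt0_muleNy ?lte_fin.
have -> : [set w | ((Pw k * Gs w * x `^ (- al k))%:E <
     beta%:E * (received_interference x w + W%:E))%E] =
   [set w | ((Gs w)%:E < interference Y V
     (fun j => path_gain (rjk j k x) (al j) (tau j k)) w + (sig * x `^ al k)%:E)%E].
  by apply/seteqP; split => w /=; rewrite E.
rewrite {}H; congr EFin; congr (1 - _).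
have gE n : \sum_(j < K) Act j * lam j * (pi * rjk j k x ^+ 2) *
    weighted_integral (2 / al j) (tier_coef (tau j k) n) = pi * gkn n (x ^+ 2).
  rewrite /Defs.gkn mulr_sumr; apply: eq_bigr => j _.
  by rewrite phi_weighted_integral sqr_rjk// /dlt; ring.
rewrite successE ?sqr_ge0// x2a; apply: eq_bigr => m _.
by rewrite gE (funext gE).
Qed.

End conditional.
End network.

(** * Averaging over the serving distance *)

Section continuity.
Context {R : realType}.

(* Continuity on [0, +oo[ is expressed through the even extension, because
   [x `^ p] is not continuous from the left at 0. *)
Definition ncontinuous (f : R -> R) := continuous (fun v : R => f `|v|).

Lemma ncontinuous_powR p : 0 <= p -> ncontinuous (fun v => v `^ p).
Proof.
rewrite le_eqVlt => /predU1P[<-|p0] v.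
  rewrite /continuous_at; under eq_fun do rewrite powRr0.
  by rewrite powRr0; exact: cvg_cst.
have [->|v0] := eqVneq v 0; last first.
  have c1 : {for v, continuous (fun v : R => `|v|)} by exact: norm_continuous.
  have c2 : {for `|v|, continuous (fun t : R => t `^ p)}.
    by apply: continuous_powR_gt0; rewrite normr_gt0.
  exact: (continuous_comp c1 c2).
rewrite /continuous_at normr0 powR0 ?gt_eqF//; apply/cvgrPdist_lt => e e0.
near=> t; rewrite sub0r normrN ger0_norm ?powR_ge0//.
rewrite [X in _ < X](_ : e = (e `^ p^-1) `^ p); last first.
  by rewrite -powRrM mulVf ?gt_eqF// powRr1// ltW.
apply: gt0_ltr_powR => //; rewrite ?nnegrE ?powR_ge0 ?normr_ge0//.
near: t; apply/nbhs_ballP; exists (e `^ p^-1) => /=; first by rewrite powR_gt0.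
by move=> t; rewrite /ball/= sub0r normrN.
Unshelve. all: by end_near. Qed.

Lemma ncontinuous_cst c : ncontinuous (fun=> c).
Proof. by move=> v; exact: cvg_cst. Qed.

Lemma ncontinuousM f g : ncontinuous f -> ncontinuous g -> ncontinuous (fun v => f v * g v).
Proof. by move=> cf cg v; apply: cvgM; [exact: cf|exact: cg]. Qed.

Lemma ncontinuousB f g : ncontinuous f -> ncontinuous g -> ncontinuous (fun v => f v - g v).
Proof. by move=> cf cg v; apply: cvgB; [exact: cf|exact: cg]. Qed.

Lemma ncontinuousN f : ncontinuous f -> ncontinuous (fun v => - f v).
Proof. by move=> cf v; apply: cvgN; exact: cf. Qed.

Lemma ncontinuous_sum (I : Type) (s : seq I) (f : I -> R -> R) :
  (forall i, ncontinuous (f i)) -> ncontinuous (fun v => \sum_(i <- s) f i v).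
Proof. by move=> cf v; apply: cvg_big => [|i _]; [exact: add_continuous|exact: cf]. Qed.

Lemma ncontinuous_expR f : ncontinuous f -> ncontinuous (fun v => expR (f v)).
Proof. by move=> cf v; apply: (continuous_comp (cf v)); exact: continuous_expR. Qed.

Lemma ncontinuous_mxentryX M (A : R -> 'M[R]_M) : (forall p q, ncontinuous (fun v => A v p q)) ->
  forall i p q, ncontinuous (fun v => mxentry (A v ^+ i) p q).
Proof.
move=> cA i; have H : forall p q, ncontinuous (fun v => (A v ^+ i) p q).
  elim: i => [|i IH] p q; first by move=> v; under eq_fun do rewrite expr0; exact: cvg_cst.
  have -> : (fun v => (A v ^+ i.+1) p q) = (fun v => \sum_j A v p j * (A v ^+ i) j q).
    by apply/funext => v; rewrite exprS -[A v * _]/(A v *m _) mxE.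
  by apply: ncontinuous_sum => j; exact: ncontinuousM.
move=> p q; rewrite /mxentry; case: insub => [p'|]; last exact: ncontinuous_cst.
by case: insub => [q'|]; [exact: H|exact: ncontinuous_cst].
Qed.

Lemma ncontinuous_within f a b : 0 <= a -> ncontinuous f -> {within `[a, b], continuous f}.
Proof.
move=> a0 cf; apply: (subspace_eq_continuous (f := fun v => f `|v|)); last first.
  exact: continuous_subspaceT.
move=> v; rewrite inE/= in_itv/= => /andP[av _] /=.
by rewrite ger0_norm// (le_trans a0).
Qed.

Lemma ncontinuous_integrable f a b : 0 <= a -> ncontinuous f ->
  (@lebesgue_measure R).-integrable `[a, b] (EFin \o f).
Proof.
move=> a0 cf; apply: continuous_compact_integrable; first exact: segment_compact.
exact: ncontinuous_within.
Qed.

Lemma ncontinuous_Rintegral_sum (I : Type) (s : seq I) (f : I -> R -> R) (a b : R) : 0 <= a ->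
  (forall i, ncontinuous (f i)) ->
  Rintegral (@lebesgue_measure R) `[a, b] (fun v => \sum_(i <- s) f i v) =
  \sum_(i <- s) Rintegral (@lebesgue_measure R) `[a, b] (f i).
Proof.
move=> a0 cf; elim: s => [|i s IH].
  by rewrite big_nil /Rintegral integral0_eq// => v _; rewrite big_nil.
rewrite big_cons -IH -RintegralD//.
- by apply: eq_Rintegral => v _; rewrite big_cons.
- exact: ncontinuous_integrable.
- by apply: ncontinuous_integrable => //; exact: ncontinuous_sum.
Qed.

End continuity.

Section distance_integral.
Context {R : realType} {K : nat}.
Variables (lam Pw Bb al : 'I_K -> R) (Mn : 'I_K -> nat) (eps lamu W beta : R).
Hypotheses (hlam : forall j, 0 < lam j) (hPw : forall j, 0 < Pw j)
  (hBb : forall j, 0 < Bb j) (hMn : forall j, (0 < Mn j)%N)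
  (hal : forall j, 2 < al j) (heps : 0 < eps).
Variable k : 'I_K.
Local Notation mu := (@lebesgue_measure R).
Local Notation gkn := (gkn lam Pw Bb al Mn eps lamu beta k).
Local Notation Qmx := (Qmx lam Pw Bb al Mn eps lamu beta k).
Local Notation sig := (sig Pw W beta k).
Local Notation assoc_exp := (assoc_exp lam Pw Bb al Mn k).
Local Notation Rk := (Rk Pw Bb al Mn eps k).
Local Notation Tk := (Tk lam Pw Bb al Mn eps k).
Local Notation fX := (fX lam Pw Bb al Mn eps k).
Local Notation success := (success_probability lam Pw Bb al Mn eps lamu W beta k).

Let al0 j : 0 < al j. Proof. exact: lt_trans (hal j). Qed.
Let dl0 j : 0 < dlt al j. Proof. by rewrite divr_gt0. Qed.

Lemma Rk_gt0 : 0 < Rk.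
Proof. by rewrite powR_gt0// divr_gt0// Omg_gt0. Qed.

Lemma Tk_ge0 : 0 <= Tk.
Proof.
rewrite !mulr_ge0 ?pi_ge0 ?(ltW (hlam k))//.
by apply: Rintegral_ge0 => x _; exact: expR_ge0.
Qed.

Lemma fX_ge0 x : 0 <= fX x.
Proof.
rewrite /Defs.fX; case: ifP => // /andP[x0 _].
by rewrite !mulr_ge0 ?expR_ge0 ?pi_ge0 ?invr_ge0 ?Tk_ge0 ?ltW.
Qed.

Lemma ncontinuous_gkn n : ncontinuous (gkn n).
Proof.
apply: ncontinuous_sum => j; apply: ncontinuousM; first exact: ncontinuous_cst.
by apply: ncontinuous_powR; rewrite divr_ge0// ltW.
Qed.

Lemma ncontinuous_assoc_exp : ncontinuous assoc_exp.
Proof.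
apply: ncontinuous_sum => j; apply: ncontinuousM; first exact: ncontinuous_cst.
by apply: ncontinuous_powR; rewrite divr_ge0// ltW.
Qed.

Lemma ncontinuous_Qmx i n : ncontinuous (fun x => mxentry (Qmx x ^+ i) n 0).
Proof.
apply: ncontinuous_mxentryX => p q.
have -> : (fun v => Qmx v p q) = (fun v => if (q < p)%N then gkn (p - q) v else 0).
  by apply/funext => v; rewrite mxE.
by case: (q < p)%N; [exact: ncontinuous_gkn|exact: ncontinuous_cst].
Qed.

Lemma ncontinuous_success : ncontinuous success.
Proof.
have a0 := ltW (al0 k).
apply: ncontinuous_sum => i; apply: ncontinuous_sum => m; apply: ncontinuous_sum => n.
apply: ncontinuousM; last exact: ncontinuous_Qmx.
apply: ncontinuousM.
  apply: ncontinuousM; first exact: ncontinuous_cst.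
  by apply: ncontinuous_powR; rewrite mulr_ge0// divr_ge0.
apply: ncontinuous_expR; apply: ncontinuousB.
- apply: ncontinuousN; apply: ncontinuousM; first exact: ncontinuous_cst.
  by apply: ncontinuous_powR; rewrite divr_ge0.
- by apply: ncontinuousM; [exact: ncontinuous_cst|exact: ncontinuous_gkn].
Qed.

Lemma measurable_success_sqr : measurable_fun setT (fun x : R => success (x ^+ 2)).
Proof.
have c := continuous_measurable_fun ncontinuous_success.
have -> : (fun x => success (x ^+ 2)) = (fun x => success `|x ^+ 2|).
  by apply/funext => x; rewrite ger0_norm// sqr_ge0.
by apply: (measurableT_comp c); exact: measurable_funX.
Qed.

Definition outage_integrand (i m n : nat) (x : R) : R :=
  pi ^+ i.+1 * sig ^+ (m - n) / ((m - n)`!%:R * i`!%:R) *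
  x `^ (al k / 2 * (m - n)%:R) *
  expR (- (sig * x `^ (al k / 2)) - pi * gkn 0 x - pi * assoc_exp x) *
  mxentry (Qmx x ^+ i) n 0.

Lemma ncontinuous_outage_integrand i m n : ncontinuous (outage_integrand i m n).
Proof.
have -> : outage_integrand i m n = (fun x => pi ^+ i.+1 * sig ^+ (m - n) / ((m - n)`!%:R * i`!%:R) *
    x `^ (al k / 2 * (m - n)%:R) *
    expR (- (sig * x `^ (al k / 2)) - pi * gkn 0 x - pi * assoc_exp x) *
    mxentry (Qmx x ^+ i) n 0) by [].
have a0 := ltW (al0 k).
apply: ncontinuousM; last exact: ncontinuous_Qmx.
apply: ncontinuousM.
  apply: ncontinuousM; first exact: ncontinuous_cst.
  by apply: ncontinuous_powR; rewrite mulr_ge0// divr_ge0.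
apply: ncontinuous_expR; apply: ncontinuousB; first apply: ncontinuousB.
- apply: ncontinuousN; apply: ncontinuousM; first exact: ncontinuous_cst.
  by apply: ncontinuous_powR; rewrite divr_ge0.
- by apply: ncontinuousM; [exact: ncontinuous_cst|exact: ncontinuous_gkn].
- by apply: ncontinuousM; [exact: ncontinuous_cst|exact: ncontinuous_assoc_exp].
Qed.

Let G v := lam k / Tk *
  \sum_(i < Mn k) \sum_(m < Mn k) \sum_(n < m.+1) outage_integrand i m n v.

Let GE v : G v = lam k / Tk * (pi * expR (- (pi * assoc_exp v)) * success v).
Proof.
rewrite /G /success_probability /outage_integrand.
move: (gkn 0 v) (assoc_exp v) => g0 ae; rewrite !mulr_sumr; apply: eq_bigr => i _.
rewrite !mulr_sumr; apply: eq_bigr => m _; rewrite !mulr_sumr; apply: eq_bigr => n _.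
by rewrite (expRD _ (- (pi * ae))) exprS; ring.
Qed.

Let cG : ncontinuous G.
Proof.
apply: ncontinuousM; first exact: ncontinuous_cst.
apply: ncontinuous_sum => i; apply: ncontinuous_sum => m; apply: ncontinuous_sum => n.
exact: ncontinuous_outage_integrand.
Qed.

(** Substitution v = x^2: the density supplies the factor 2x, the remaining pi and the association
    exponential. Continuity of each term on the closed segment then lets the integral pass through
    the triple sum. *)
Lemma success_integral :
  (\int[mu]_x (success (x ^+ 2) * fX x)%:E =
   (1 - outage_formula lam Pw Bb al Mn eps lamu W beta k)%:E)%E.
Proof.
have R0 := Rk_gt0; have R0' := ltW R0.
transitivity (\int[mu]_(x in `[0%R, Rk]) (G (x ^+ 2) * (2 * x))%:E)%E.
  rewrite [RHS]integral_mkcond; apply: eq_integral => x _.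
  rewrite patchE mem_setE in_itv/= /Defs.fX.
  (* The density is cut to 0 at x = 0 while the segment contains that point; the factor 2x makes
     both sides vanish there. *)
  have [->|x0] := eqVneq x 0; first by rewrite ltxx/= !mulr0; case: ifP.
  rewrite lt_neqAle eq_sym x0/=; case: ifP => [_|]; last by rewrite mulr0.
  by rewrite GE; congr EFin; ring.
have dF (x : R) : is_derive x (1 : R) (fun x => x ^+ 2) (2 * x).
  have := @is_deriveX R R id 2 x 1 1 (is_derive_id _ _).
  by rewrite /GRing.scale/= mulr1 expr1 (_ : id ^+ 2 = (fun x => x ^+ 2)).
have cf (x : R) : 0 <= x <= Rk -> {for x, continuous (fun x : R => 2 * x)}.
  by move=> _; apply: cvgMr.
have iF : {in `[0, Rk] &, {homo (fun x : R => x ^+ 2) : x y / x < y}}.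
  move=> x y; rewrite !in_itv/= => /andP[x0 _] /andP[y0 _] xy.
  by rewrite ltrXn2r.
have cG' : {within `[(0 : R) ^+ 2, Rk ^+ 2], continuous G}.
  by apply: ncontinuous_within => //; rewrite expr0n.
rewrite -(is_derive_substitution_increasing (fun x => x ^+ 2) (fun x => 2 * x) 0 Rk R0'
  (fun x _ => dF x) cf G iF cG') expr0n/=.
rewrite /outage_formula opprB addrC subrK.
rewrite -[LHS]fineK; last by apply: integrable_fin_num => //; exact: ncontinuous_integrable.
congr EFin; transitivity (Rintegral mu `[0, Rk ^+ 2] G) => //.
rewrite RintegralZl//; last first.
  apply: ncontinuous_integrable => //; apply: ncontinuous_sum => i.
  apply: ncontinuous_sum => m; apply: ncontinuous_sum => n.
  exact: ncontinuous_outage_integrand.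
congr (_ * _); rewrite ncontinuous_Rintegral_sum//; last first.
  move=> i; apply: ncontinuous_sum => m; apply: ncontinuous_sum => n.
  exact: ncontinuous_outage_integrand.
apply: eq_bigr => i _; rewrite ncontinuous_Rintegral_sum//; last first.
  by move=> m; apply: ncontinuous_sum => n; exact: ncontinuous_outage_integrand.
apply: eq_bigr => m _; rewrite ncontinuous_Rintegral_sum// => n.
exact: ncontinuous_outage_integrand.
Qed.

End distance_integral.

(** * Null events *)

Section null_sets.
Context {R : realType} {d : measure_display} {Om : measurableType d}.
Variable P : probability Om R.

Lemma eq_probability_negligible (A B N : set Om) : measurable A -> measurable B ->
  P.-negligible N -> A `\` N = B `\` N -> P A = P B.
Proof.
move=> mA mB [M [mM M0 NM]] AB.
have H (C D : set Om) : measurable C -> measurable D -> C `\` N `<=` D -> (P C <= P D)%E.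
  move=> mC mD CD; apply: (@le_trans _ _ (P (D `|` M))).
    apply: le_measure; rewrite ?inE//; first exact: measurableU.
    move=> w Cw; have [/NM ?|nN] := pselect (N w); first by right.
    by left; apply: CD.
  apply: (le_trans (measureU2 P mD mM)).
    by rewrite [X in (_ + X)%E](M0 : _ = 0%E) adde0.
apply/eqP; rewrite eq_le !H//.
  by rewrite -AB => w [].
by rewrite AB => w [].
Qed.

Lemma negligible_lt0_exponential (V : Om -> R) :
  measurable_fun setT V ->
  (forall B, measurable B -> P (V @^-1` B) = exponential_prob (1 : R) B) ->
  P.-negligible [set w | V w < 0].
Proof.
move=> mV hV; exists (V @^-1` `]-oo, 0[); split.
- by rewrite -[X in measurable X]setTI; exact: mV.
- rewrite hV// /exponential_prob; apply: integral0_eq => x; rewrite /= in_itv/= => x0.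
  by rewrite lt0_exponential_pdf.
- by move=> w /=; rewrite in_itv.
Qed.

Lemma negligible_le0_density (X : Om -> R) f :
  measurable_fun setT X -> has_density P X f -> (forall x, x <= 0 -> f x = 0) ->
  P.-negligible [set w | X w <= 0].
Proof.
move=> mX hX f0; exists (X @^-1` `]-oo, 0]); split.
- by rewrite -[X in measurable X]setTI; exact: mX.
- by rewrite hX//; apply: integral0_eq => x; rewrite /= in_itv/= => x0; rewrite f0.
- by move=> w /=; rewrite in_itv.
Qed.

Lemma negligible_bigcup_ord K (A : 'I_K -> nat -> set Om) :
  (forall j n, P.-negligible (A j n)) -> P.-negligible [set w | exists j n, A j n w].
Proof.
move=> hA.
pose F m := \bigcup_n (if insub m is Some j then A j n else set0).
have hF : P.-negligible (\bigcup_m F m).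
  apply: negligible_bigcup => m; apply: negligible_bigcup => n.
  by case: insub => [j|]; [exact: hA|exact: negligible_set0].
apply: negligibleS hF => w [j [n Aw]]; exists (val j) => //; exists n => //.
by rewrite valK.
Qed.

End null_sets.

Section outage_probability.
Context {R : realType} {K : nat}.
Variables (lam Pw Bb al : 'I_K -> R) (Mn : 'I_K -> nat) (eps lamu W beta : R).
Hypotheses (hlam : forall j, 0 < lam j) (hPw : forall j, 0 < Pw j)
  (hBb : forall j, 0 < Bb j) (hMn : forall j, (0 < Mn j)%N)
  (hal : forall j, 2 < al j) (heps : 0 < eps) (hlamu : 0 < lamu)
  (hW : 0 <= W) (hbeta : 0 < beta).
Variable k : 'I_K.
Local Notation mu := (@lebesgue_measure R).
Local Notation rjk := (rjk Pw Bb al Mn).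
Local Notation fX := (fX lam Pw Bb al Mn eps k).
Local Notation success := (success_probability lam Pw Bb al Mn eps lamu W beta k).
Local Notation received := (received_interference Pw Bb al Mn k).

Lemma measurable_fX : measurable_fun setT fX.
Proof.
have c := continuous_measurable_fun (ncontinuous_assoc_exp lam Pw Bb al Mn hal k).
have m2 : measurable_fun setT (fun x : R => assoc_exp lam Pw Bb al Mn k (x ^+ 2)).
  have -> : (fun x : R => assoc_exp lam Pw Bb al Mn k (x ^+ 2)) =
      (fun x : R => assoc_exp lam Pw Bb al Mn k `|x ^+ 2|).
    by apply/funext => x; rewrite ger0_norm// sqr_ge0.
  by apply: (measurableT_comp c); exact: measurable_funX.
apply: measurable_fun_ifT => //.
  by apply: measurable_and; [exact: measurable_fun_ltr|exact: measurable_fun_ler].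
apply: measurable_funM; first exact: measurable_funM.
by apply: measurableT_comp => //; apply: measurableT_comp => //; exact: measurable_funM.
Qed.

Section measurability.
Context {dT : measure_display} {T : measurableType dT}.
Variables (x : T -> R) (y : 'I_K -> nat -> T -> R * R) (v : 'I_K -> nat -> T -> R).
Hypotheses (mx : measurable_fun setT x) (my : forall j n, measurable_fun setT (y j n))
  (mv : forall j n, measurable_fun setT (v j n)).

Lemma measurable_interferer j n : measurable_fun setT (fun w =>
  if rjk j k (x w) < norm2 (y j n w) then Pw j * v j n w * norm2 (y j n w) `^ (- al j) else 0).
Proof.
have mn := measurableT_comp (@measurable_norm2 R) (my j n).
apply: measurable_fun_ifT => //.
  apply: measurable_fun_ltr => //; apply: measurable_funM => //.
  exact: (measurableT_comp (measurable_powR _) mx).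
apply: measurable_funM; first exact: measurable_funM.
exact: (measurableT_comp (measurable_powR _) mn).
Qed.

Lemma measurable_total_interference : measurable_fun setT (fun w =>
  (\sum_(j < K) \sum_(n <oo) (if rjk j k (x w) < norm2 (y j n w)
    then Pw j * v j n w * norm2 (y j n w) `^ (- al j) else 0)%:E)%E).
Proof.
apply: emeasurable_sum => j; apply: measurable_limn => N.
apply: emeasurable_sum => n; apply/measurable_EFinP; exact: measurable_interferer.
Qed.

Lemma measurable_outage (g : T -> R) : measurable_fun setT g ->
  measurable [set w | ((Pw k * g w * x w `^ (- al k))%:E < beta%:E *
   ((\sum_(j < K) \sum_(n <oo) (if rjk j k (x w) < norm2 (y j n w)
    then Pw j * v j n w * norm2 (y j n w) `^ (- al j) else 0)%:E) + W%:E))%E].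
Proof.
move=> mg; rewrite -[X in measurable X]setTI; apply: measurable_lte => //.
  apply/measurable_EFinP; apply: measurable_funM; first exact: measurable_funM.
  exact: (measurableT_comp (measurable_powR _) mx).
apply: measurable_funeM; apply: emeasurable_funD => //.
exact: measurable_total_interference.
Qed.

End measurability.

Section probability.
Context {d : measure_display} {Om : measurableType d}.
Variables (P : probability Om R) (X Gs : Om -> R) (Y : 'I_K -> nat -> Om -> R * R)
  (V : 'I_K -> nat -> Om -> R).
Hypotheses (mX : measurable_fun setT X) (mGs : measurable_fun setT Gs)
  (mY : forall j n, measurable_fun setT (Y j n))
  (mV : forall j n, measurable_fun setT (V j n)).
Hypothesis hX : has_density P X fX.
Hypothesis hGs : has_density P Gs (gamma_pdf (Mn k)).
Hypothesis hV : forall j n B, measurable B ->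
  P (V j n @^-1` B) = exponential_prob (1 : R) B.
Hypothesis hY : forall j, is_hPPP P (Y j) (Act lam Pw Bb al Mn eps lamu j * lam j).
Hypothesis hind : mutually_independent P (components X Gs Y V).
Local Notation others := (others (components X Gs Y V) (inl true)).

(** The outage event in two separate variables, the serving distance and the sample point carrying
    all other components; positive parts of the marks are used, and only positive distances are
    kept. *)
Let S : set (R * g_sigma_algebraType others) := [set z | 0 < z.1 /\
  ((Pw k * Gs z.2 * z.1 `^ (- al k))%:E < beta%:E * (received Y V z.1 z.2 + W%:E))%E].

Let mS : measurable S.
Proof.
have m1 : measurable_fun setT (fun z : R * g_sigma_algebraType others => z.1).
  exact: measurable_fst.
have m2 : measurable_fun setT (fun z : R * g_sigma_algebraType others => z.2).
  exact: measurable_snd.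
have aG : adapted others Gs.
  exact: (adapted_others (components X Gs Y V) (inl true) (inl false) Gs isT (components_G X Gs Y V)).
have aY j n : adapted others (Y j n).
  exact: (adapted_others (components X Gs Y V) (inl true) (inr (inl j)) (Y j n) isT
    (components_Y X Gs Y V j n)).
have aV j n : adapted others (fun w => Num.max (V j n w) 0).
  apply: measurable_maxr => //.
  exact: (adapted_others (components X Gs Y V) (inl true) (inr (inr (j, n))) (V j n) isT
    (components_V X Gs Y V j n)).
apply: measurableI.
  by have := m1 measurableT `]0, +oo[%classic (measurable_itv _); rewrite setTI; congr measurable;
    apply/seteqP; split => z /=; rewrite in_itv/= andbT.
exact: (measurable_outage (fun z : R * g_sigma_algebraType others => z.1)
  (fun j n z => Y j n z.2) (fun j n z => Num.max (V j n z.2) 0) m1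
  (fun j n => measurableT_comp (aY j n) m2) (fun j n => measurableT_comp (aV j n) m2)
  (fun z => Gs z.2) (measurableT_comp aG m2)).
Qed.

Let sO A : <<s others>> A -> measurable A.
Proof.
apply: smallest_sub; first exact: sigma_algebra_measurable.
by apply: others_measurable; exact: measurable_components.
Qed.

Let h (x : R) : \bar R := (if 0 < x then 1 - success (x ^+ 2) else 0)%:E.

Let section_S x : P [set w | S (x, w)] = h x.
Proof.
rewrite /h; case: ifPn => x0.
  rewrite -(conditional_outage lam Pw Bb al Mn eps lamu W beta hlam hPw hBb hMn hal hlamu hW hbeta k
    P X Gs Y V mX mGs mY mV hV hGs hY hind x x0).
  by congr (P _); apply/seteqP; split => w /= => [[]|].
rewrite (_ : [set w | S (x, w)] = set0) ?measure0//.
by apply/seteqP; split => w //= []; rewrite /= (negbTE x0).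
Qed.

Let mh : measurable_fun setT h.
Proof.
apply/measurable_EFinP; apply: measurable_fun_ifT => //; first exact: measurable_fun_ltr.
by apply: measurable_funB => //; exact: measurable_success_sqr.
Qed.

Let h0 x : (0 <= h x)%E. Proof. by rewrite -section_S. Qed.

Let mSx x : measurable ([set w | S (x, w)] : set Om).
Proof.
have /sO := measurable_xsection x mS.
by rewrite (_ : xsection S x = [set w | S (x, w)])//; apply/seteqP; split => w; rewrite /xsection/= inE.
Qed.

(** The sign is read off the probabilistic meaning, 1 - success being the probability of a section,
    rather than off the terms of the triple sum. *)
Let success01 x : 0 < x -> 0 <= success (x ^+ 2).
Proof.
move=> x0; have : (h x <= 1)%E by rewrite -section_S; exact: probability_le1 (mSx x).
by rewrite /h x0 lee_fin gerBl.
Qed.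

(** Up to a null event the outage event is {w : (X w, w) in S}, whose probability is the integral of
    the conditional outage against the density of X. The formula computes the integral of the
    conditional success, and the two add up to 1. *)
Lemma outage_probability :
  P [set w | ((Pw k * Gs w * X w `^ (- al k))%:E < beta%:E *
   ((\sum_(j < K) \sum_(n <oo) (if rjk j k (X w) < norm2 (Y j n w)
    then Pw j * V j n w * norm2 (Y j n w) `^ (- al j) else 0)%:E) + W%:E))%E] =
  (outage_formula lam Pw Bb al Mn eps lamu W beta k)%:E.
Proof.
pose B := [set w | S (X w, w)].
have mB : measurable B.
  have mid : measurable_fun setT (id : Om -> g_sigma_algebraType others).
    by move=> _ C mC; rewrite setTI; exact: sO.
  by have := measurable_fun_pair mX mid measurableT mS; rewrite setTI.
(* The two events can differ only where the serving distance is not positive or some mark is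
   negative. *)
rewrite (eq_probability_negligible P _ B
  ([set w | X w <= 0] `|` [set w | exists j n, V j n w < 0]))//; last first.
- have H w : ~ ([set w | X w <= 0] `|` [set w | exists j n, V j n w < 0]) w -> 0 < X w /\
      received Y V (X w) w = (\sum_(j < K) \sum_(n <oo) (if rjk j k (X w) < norm2 (Y j n w)
         then Pw j * V j n w * norm2 (Y j n w) `^ (- al j) else 0)%:E)%E.
    move=> nN; split; first by rewrite ltNge; apply/negP => Xw; apply: nN; left.
    apply: eq_bigr => j _; apply: eq_eseriesr => n _; rewrite max_l// leNgt.
    by apply/negP => Vw; apply: nN; right; exists j, n.
  apply/seteqP; split => w [Aw nN]; have [X0 E] := H w nN; split => //.
    by split => //; rewrite E.
  by case: Aw => _; rewrite /= E.
- apply: negligibleU.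
    apply: (negligible_le0_density P X fX mX hX) => x x0.
    by rewrite /Defs.fX ltNge x0.
  apply: (negligible_bigcup_ord P K (fun j n => [set w | V j n w < 0])) => j n.
  exact: (negligible_lt0_exponential P (V j n) (mV j n) (hV j n)).
- exact: (measurable_outage X Y V mX mY mV Gs mGs).
pose f (z : R * g_sigma_algebraType others) : \bar R := (\1_S z)%:E.
have mf : measurable_fun setT f by apply/measurable_EFinP; apply: measurable_indic; exact: mS.
have f0 z : (0 <= f z)%E by rewrite lee_fin.
have [E _] := fubini_others P (components X Gs Y V) (sigma_algebra_components X Gs Y V)
  (measurable_components X Gs Y V mX mGs mY mV) hind (inl true) X f (components_X X Gs Y V) mf f0.
have PB : P B = (\int[mu]_x (h x * (fX x)%:E))%E.
  rewrite -(has_density_integral P X fX mX measurable_fX (fX_ge0 lam Pw Bb al Mn eps hlam k) hX h mh h0).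
  transitivity (\int[P]_w f (X w, w))%E.
    transitivity (P (B `&` setT)); first by rewrite setIT.
    by rewrite -integral_indic.
  rewrite E; apply: eq_integral => w _; rewrite -section_S.
  transitivity (P ([set w' | S (X w, w')] `&` setT)); last by rewrite setIT.
  by rewrite -(integral_indic _ _ (mSx (X w))).
have T1 : (1 = \int[mu]_x (h x * (fX x)%:E) + \int[mu]_x (success (x ^+ 2) * fX x)%:E)%E.
  (* That the density integrates to 1 follows from its being the density of X, without computing
     [Tk]. *)
  have <- : (\int[mu]_x (fX x)%:E = 1)%E by rewrite -hX// preimage_setT probability_setT.
  have s0 x : 0 <= success (x ^+ 2) * fX x.
    have [x0|x0] := ltP 0 x; first by rewrite mulr_ge0 ?success01 ?fX_ge0.
    by rewrite /Defs.fX ltNge x0/= mulr0.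
  have ms : measurable_fun setT (fun x : R => success (x ^+ 2) * fX x).
    by apply: measurable_funM; [exact: measurable_success_sqr|exact: measurable_fX].
  rewrite -ge0_integralD//.
  - apply: eq_integral => x _; rewrite /h; case: ifPn => x0.
      by rewrite -EFinM -EFinD; congr EFin; ring.
    by rewrite /Defs.fX (negbTE x0)/= mulr0 mule0 adde0.
  - by move=> x _; rewrite mule_ge0// lee_fin fX_ge0.
  - by apply: emeasurable_funM => //; apply/measurable_EFinP; exact: measurable_fX.
  - by move=> x _; rewrite lee_fin.
  - exact/measurable_EFinP.
move: T1; rewrite -PB (success_integral lam Pw Bb al Mn eps lamu W beta hPw hBb hMn hal heps k).
have : P B \is a fin_num by rewrite fin_num_measure.
case: (P B) => [p||] // _; rewrite -EFinD => -[] H.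
congr EFin; rewrite addrA in H.
by apply/eqP; rewrite -subr_eq0; apply/eqP; lra.
Qed.

End probability.
End outage_probability.

(** * Equal path-loss exponents *)

Section equal_exponents.
Context {R : realType} {K : nat}.
Variables (lam Pw Bb al : 'I_K -> R) (Mn : 'I_K -> nat) (eps lamu W beta : R).
Hypotheses (hPw : forall j, 0 < Pw j)
  (hBb : forall j, 0 < Bb j) (hMn : forall j, (0 < Mn j)%N)
  (hal : forall j, 2 < al j).
Variables (k : 'I_K) (a : R).
Hypothesis ha : forall j, al j = a.
Local Notation Omg := (Omg Pw Bb Mn).
Local Notation gkn := (gkn lam Pw Bb al Mn eps lamu beta k).
Local Notation Qmx := (Qmx lam Pw Bb al Mn eps lamu beta k).
Local Notation theta := (theta lam Pw Bb al Mn eps lamu beta a k).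
Local Notation Theta := (Theta lam Pw Bb al Mn eps lamu beta a k).
Local Notation assoc_exp := (assoc_exp lam Pw Bb al Mn k).

Let a0 : 0 < a. Proof. by rewrite -(ha k); exact: lt_trans (hal k). Qed.

Let powR_dlt_ratio j x : 0 <= x -> x `^ (dlt al j / dlt al k) = x.
Proof. by move=> x0; rewrite /dlt !ha divff ?powRr1// mulf_neq0// invr_eq0 gt_eqF. Qed.

Lemma gkn_linear n x : 0 <= x -> gkn n x = x * theta n.
Proof.
move=> x0; rewrite /Defs.theta mulr_sumr; apply: eq_bigr => j _.
by rewrite powR_dlt_ratio// /dlt ha mulrC.
Qed.

Lemma assoc_exp_linear x : 0 <= x ->
  assoc_exp x = Lam lam Pw Bb Mn a / Omg k `^ (2 / a) * x.
Proof.
move=> x0; rewrite /Lam !mulr_suml; apply: eq_bigr => j _.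
have h l : 0 <= Omg l by apply/ltW/Omg_gt0.
rewrite powR_dlt_ratio// /dlt ha powRM ?invr_ge0// -[(Omg k)^-1]powR_inv1//.
by rewrite powRAC powR_inv1 ?powR_ge0// mulrA.
Qed.

Lemma Qmx_linear x : 0 <= x -> Qmx x = x *: Theta.
Proof.
move=> x0; apply/matrixP => p q; rewrite !mxE; case: (q < p)%N; last by rewrite mulr0.
exact: gkn_linear.
Qed.

(** The base 0 is separated because the exponent rule for [powR] is conditional there; when i > 0
    both sides are 0, since b >= 0 keeps the total exponent positive. *)
Let exprM_powR (x b : R) i : 0 <= x -> 0 <= b -> x ^+ i * x `^ b = x `^ (i%:R + b).
Proof.
rewrite le_eqVlt => /predU1P[<-|x0] b0; last first.
  rewrite powRD; first by rewrite powR_mulrn// ltW.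
  by rewrite (gt_eqF x0) implybT.
case: i => [|i]; first by rewrite expr0 mul1r add0r.
by rewrite expr0n/= mul0r powR0// gt_eqF// ltr_pwDl.
Qed.

(** With equal exponents delta_{j,k} = 1, so [gkn] and the association exponent are linear in x. The
    i-th power of the matrix then leaves the integral as x^i times a constant matrix, and the linear
    terms of the exponential combine into [Zk]. *)
Lemma outage_formula_eqE :
  outage_formula lam Pw Bb al Mn eps lamu W beta k =
  outage_formula_eq lam Pw Bb al Mn eps lamu W beta a k.
Proof.
congr (1 - _ * _); apply: eq_bigr => i _; apply: eq_bigr => m _; apply: eq_bigr => n _.
have b0 : 0 <= a / 2 by rewrite divr_ge0// ltW.
have b1 : 0 <= a / 2 * (m - n)%:R by rewrite mulr_ge0.
pose q x := x `^ (i%:R + a / 2 * (m - n)%:R) *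
  expR (- (sig Pw W beta k * x `^ (a / 2)) - pi * Zk lam Pw Bb al Mn eps lamu beta a k * x).
have cq : ncontinuous q.
  apply: ncontinuousM; first by apply: ncontinuous_powR; rewrite addr_ge0.
  apply: ncontinuous_expR; apply: ncontinuousB.
    apply: ncontinuousN; apply: ncontinuousM; first exact: ncontinuous_cst.
    exact: ncontinuous_powR.
  apply: ncontinuousM; first exact: ncontinuous_cst.
  by move=> v; exact: norm_continuous.
transitivity (Rintegral (@lebesgue_measure R) `[0, Rk Pw Bb al Mn eps k ^+ 2] (fun x =>
  pi ^+ i.+1 * sig Pw W beta k ^+ (m - n) / ((m - n)`!%:R * i`!%:R) *
    mxentry (Theta ^+ i) n 0 * q x)); last first.
  rewrite RintegralZl//; last exact: ncontinuous_integrable.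
  have -> : Rintegral (@lebesgue_measure R) `[0, Rk Pw Bb al Mn eps k ^+ 2] q =
    Qk lam Pw Bb al Mn eps lamu W beta a k i m n by [].
  by rewrite [in RHS](mulrC (i`!%:R)); ring.
apply: eq_Rintegral => x; rewrite inE/= in_itv/= => /andP[x0 _].
rewrite ha gkn_linear// assoc_exp_linear// Qmx_linear// mxentry_scaleX /q -exprM_powR//.
have -> : - (sig Pw W beta k * x `^ (a / 2)) - pi * (x * theta 0) -
    pi * (Lam lam Pw Bb Mn a / Omg k `^ (2 / a) * x) =
  - (sig Pw W beta k * x `^ (a / 2)) - pi * Zk lam Pw Bb al Mn eps lamu beta a k * x.
  by rewrite /Zk; ring.
ring.
Qed.

End equal_exponents.

Theorem theorem1 (R : realType) (K : nat)
  (lam Pw Bb al : 'I_K -> R) (Mn : 'I_K -> nat) (eps lamu W beta : R)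
  (hlam : forall j, 0 < lam j) (hPw : forall j, 0 < Pw j)
  (hBb : forall j, 0 < Bb j) (hMn : forall j, (0 < Mn j)%N)
  (hal : forall j, 2 < al j) (heps : 0 < eps) (hlamu : 0 < lamu)
  (hW : 0 <= W) (hbeta : 0 < beta)
  (k : 'I_K)
  (d : measure_display) (Omega : measurableType d) (P : probability Omega R)
  (X Gs : Omega -> R) (Y : 'I_K -> nat -> Omega -> R * R)
  (V : 'I_K -> nat -> Omega -> R)
  (mX : measurable_fun setT X) (mGs : measurable_fun setT Gs)
  (mY : forall j n, measurable_fun setT (Y j n))
  (mV : forall j n, measurable_fun setT (V j n))
  (hX : has_density P X (fX lam Pw Bb al Mn eps k))
  (hGs : has_density P Gs (gamma_pdf (Mn k)))
  (hV : forall j n B, measurable B ->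
          P (V j n @^-1` B) = exponential_prob (1 : R) B)
  (hY : forall j, is_hPPP P (Y j) (Act lam Pw Bb al Mn eps lamu j * lam j))
  (hind : mutually_independent P (fun c : comp_index K =>
     match c with
     | inl true => sigma_gen (fun _ : unit => X)
     | inl false => sigma_gen (fun _ : unit => Gs)
     | inr (inl j) => sigma_gen (Y j)
     | inr (inr (j, n)) => sigma_gen (fun _ : unit => V j n)
     end)) :
  let Io := fun w => (\sum_(j < K) \sum_(n <oo)
       (if rjk Pw Bb al Mn j k (X w) < norm2 (Y j n w)
        then Pw j * V j n w * norm2 (Y j n w) `^ (- al j) else 0)%:E)%E in
  let outage := P [set w | ((Pw k * Gs w * X w `^ (- al k))%:E
                            < beta%:E * (Io w + W%:E))%E] in
  outage = (outage_formula lam Pw Bb al Mn eps lamu W beta k)%:E /\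
  forall a : R, (forall j, al j = a) ->
    outage = (outage_formula_eq lam Pw Bb al Mn eps lamu W beta a k)%:E.
Proof.
move=> Io outage.
have E : outage = (outage_formula lam Pw Bb al Mn eps lamu W beta k)%:E.
  exact: (outage_probability lam Pw Bb al Mn eps lamu W beta hlam hPw hBb hMn hal heps hlamu hW hbeta
    k P X Gs Y V mX mGs mY mV hX hGs hV hY hind).
split=> // a ha; rewrite E (outage_formula_eqE lam Pw Bb al Mn eps lamu W beta hPw hBb hMn hal k a ha)//.
Qed.
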